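(* Let $(M,\phi,\xi,\eta,g)$ be a contact metric manifold which is not $K$-contact. Then $(M,\phi,\xi,\eta,g)$ is a contact metric $(\kappa,\mu)$-space (for some $\kappa,\mu\in\mathbb{R}$) if and only if $M$ admits an orthogonal bi-Legendrian structure $(\mathcal{F},\mathcal{G})$ such that the corresponding bi-Legendrian connection $\bar\nabla$ satisfies $\bar\nabla\phi=0$ and $\bar\nabla h=0$. Furthermore, the bi-Legendrian structure $(\mathcal{F},\mathcal{G})$ coincides with the one determined by the eigenspaces of $h$ (i.e. the tangent bundles of $\mathcal{F}$ and $\mathcal{G}$ are the eigendistributions $\mathcal{D}_{\lambda}$, $\mathcal{D}_{-\lambda}$ of $h$, where $\lambda=\sqrt{1-\kappa}$).
   Context: Conventions: $d\eta(V,W)=\frac12\big(V(\eta(W))-W(\eta(V))-\eta([V,W])\big)$; $R_{VW}=[\nabla_V,\nabla_W]-\nabla_{[V,W]}$ with $\nabla$ the Levi-Civita connection. An almost contact metric manifold is a $(2n+1)$-dimensional Riemannian manifold $(M,g)$ with a $(1,1)$-tensor field $\phi$, a $1$-form $\eta$ and a vector field $\xi$ (the Reeb vector field) such that $\eta(\xi)=1$, $\phi^2V=-V+\eta(V)\xi$, $g(\phi V,\phi W)=g(V,W)-\eta(V)\eta(W)$. Put $\Phi(V,W)=g(V,\phi W)$. It is a contact metric manifold if $d\eta=\Phi$. Put $\mathcal{D}=\ker\eta$ and $h=\frac12\mathcal{L}_\xi\phi$ (Lie derivative). A contact metric manifold is $K$-contact if $\xi$ is Killing, equivalently $h\equiv0$.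 A contact metric $(\kappa,\mu)$-space is a contact metric manifold such that for some real numbers $\kappa,\mu$ and all vector fields $V,W$, $$R_{VW}\xi=\kappa(\eta(W)V-\eta(V)W)+\mu(\eta(W)hV-\eta(V)hW).$$ It is known that $\kappa\le1$, that $\kappa=1$ implies $h=0$ (Sasakian), and that for $\kappa<1$ the eigenvalues of $h$ are $0,\pm\lambda$ with $\lambda=\sqrt{1-\kappa}$, with mutually orthogonal integrable eigendistributions $\mathbb{R}\xi$, $\mathcal{D}_\lambda$, $\mathcal{D}_{-\lambda}$, the last two of rank $n$ and defining Legendrian foliations. A Legendrian distribution is an $n$-dimensional subbundle $L$ of $\mathcal{D}$ with $d\eta(X,X')=0$ for all $X,X'\in\Gamma(L)$; a Legendrian foliation is a foliation whose tangent bundle is a Legendrian distribution. An orthogonal bi-Legendrian structure is a pair $(\mathcal{F},\mathcal{G})$ of complementary (transverse in $\mathcal{D}$), mutually $g$-orthogonal Legendrian foliations. Given two complementary Legendrian distributions $L,Q$ (so $TM=L\oplus Q\oplus\mathbb{R}\xi$), the bi-Legendrian connection associated to $(L,Q)$ is the unique linear connection $\bar\nabla$ on $M$, with torsion $\bar T$, such that: (i) $\bar\nabla L\subset L$, $\bar\nabla Q\subset Q$, $\bar\nabla(\mathbb{R}\xi)\subset\mathbb{R}\xi$; (ii) $\bar\nabla d\eta=0$; (iii) $\bar T(X,Y)=2d\eta(X,Y)\xi$ for all $X\in\Gamma(L)$, $Y\in\Gamma(Q)$, and $\bar T(V,\xi)=[\xi,V_L]_Q+[\xi,V_Q]_L$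 for all $V\in\Gamma(TM)$, where subscripts $L,Q$ denote projections onto $L,Q$. For a bi-Legendrian structure $(\mathcal{F},\mathcal{G})$ one takes $L=T\mathcal{F}$, $Q=T\mathcal{G}$.
   Formalization: The manifold M is assumed connected; without this the ''if'' direction fails, e.g. on a disjoint union of two non-K-contact (κ,μ)-spaces with different κ, where no single pair κ, μ works. *)

(* Defs.v *)
From HB Require Import structures.
From mathcomp Require Import all_boot all_order all_algebra.
From mathcomp Require Import all_classical all_reals all_analysis ring.
Set Implicit Arguments.
Unset Strict Implicit.
Unset Printing Implicit Defensive.
Import Order.TTheory GRing.Theory Num.Theory numFieldNormedType.Exports.
Local Open Scope classical_set_scope.
Local Open Scope ring_scope.

Section Smoothness.
Context {R : realType} {m : nat}.
Implicit Types (U : set 'rV[R]_m).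

(* f is of class C^k on U (meant for U open): all partial derivatives of order
   at most k exist and are continuous at every point of U. *)
Fixpoint Ck_on (W : normedModType R) (k : nat) U (f : 'rV[R]_m -> W) : Prop :=
  (forall x, U x -> {for x, continuous f}) /\
  if k is k'.+1 then
    forall i : 'I_m, (forall x, U x -> derivable f x (delta_mx ord0 i)) /\
                     Ck_on k' U ('D_(delta_mx ord0 i) f)
  else True.

Definition smooth_on (W : normedModType R) U (f : 'rV[R]_m -> W) : Prop :=
  forall k, Ck_on k U f.

Lemma Ck_on_congr (W : normedModType R) k U (f g : 'rV[R]_m -> W) :
  open U -> (forall x, U x -> f x = g x) -> Ck_on k U f -> Ck_on k U g.
Proof.
move=> oU.
have near_fg (f' g' : 'rV[R]_m -> W) x : (forall y, U y -> f' y = g' y) ->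
    U x -> \forall y \near x, f' y = g' y.
  by move=> fg' Ux; near=> y; apply: fg'; near: y; exact: open_nbhs_nbhs.
have cont_fg (f' g' : 'rV[R]_m -> W) : (forall y, U y -> f' y = g' y) ->
    (forall x, U x -> {for x, continuous f'}) ->
    forall x, U x -> {for x, continuous g'}.
  move=> fg' cf x Ux; rewrite /prop_for /continuous_at -(fg' _ Ux).
  exact: cvg_trans (near_eq_cvg (F := nbhs x) (near_fg _ _ _ fg' Ux)) (cf x Ux).
elim: k f g => [|k IH] f g fg [cf H]; first by split=> //; exact: cont_fg cf.
split; first exact: cont_fg cf.
move=> i; have [df Df] := H i; split.
  by move=> x Ux; apply: near_eq_derivable (df x Ux); exact: near_fg.
by apply: IH Df => x Ux; apply: near_eq_derive; exact: near_fg.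
Unshelve. all: by end_near. Qed.

Lemma Ck_on_leq (W : normedModType R) k U (f : 'rV[R]_m -> W) :
  Ck_on k.+1 U f -> Ck_on k U f.
Proof.
elim: k f => [|k IH] f [cf H]; first by split.
by split=> // i; have [df Df] := H i; split=> //; exact: IH.
Qed.

Lemma Ck_on_cst (W : normedModType R) k U (a : W) :
  open U -> Ck_on k U (fun=> a).
Proof.
move=> oU; elim: k a => [|k IH] a.
  by split=> // x _; exact: cst_continuous.
split; first by move=> x _; exact: cst_continuous.
move=> i; split; first by move=> x _; exact: derivable_cst.
by apply: Ck_on_congr (IH 0) => // x _; rewrite derive_cst.
Qed.

Lemma Ck_onB k U (f g : 'rV[R]_m -> R) :
  open U -> Ck_on k U f -> Ck_on k U g -> Ck_on k U (f \- g).
Proof.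
move=> oU; elim: k f g => [|k IH] f g [cf Hf] [cg Hg].
  by split=> // x Ux; apply: continuousB; [exact: cf | exact: cg].
split; first by move=> x Ux; apply: continuousB; [exact: cf | exact: cg].
move=> i; have [df Df] := Hf i; have [dg Dg] := Hg i; split.
  by move=> x Ux; apply: derivableB; [exact: df | exact: dg].
apply: Ck_on_congr (IH _ _ Df Dg) => // x Ux.
by rewrite /= deriveB; [|exact: df|exact: dg].
Qed.

Lemma Ck_onD k U (f g : 'rV[R]_m -> R) :
  open U -> Ck_on k U f -> Ck_on k U g -> Ck_on k U (f \+ g).
Proof.
move=> oU; elim: k f g => [|k IH] f g [cf Hf] [cg Hg].
  by split=> // x Ux; apply: continuousD; [exact: cf | exact: cg].
split; first by move=> x Ux; apply: continuousD; [exact: cf | exact: cg].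
move=> i; have [df Df] := Hf i; have [dg Dg] := Hg i; split.
  by move=> x Ux; apply: derivableD; [exact: df | exact: dg].
apply: Ck_on_congr (IH _ _ Df Dg) => // x Ux.
by rewrite /= deriveD; [|exact: df|exact: dg].
Qed.

Lemma Ck_onM k U (f g : 'rV[R]_m -> R) :
  open U -> Ck_on k U f -> Ck_on k U g -> Ck_on k U (f \* g).
Proof.
move=> oU; elim: k f g => [|k IH] f g; first case=> cf Hf [cg Hg].
  by split=> // x Ux; apply: continuousM; [exact: cf | exact: cg].
move=> Cf Cg; have Cf' := Ck_on_leq Cf; have Cg' := Ck_on_leq Cg.
case: Cf => cf Hf; case: Cg => cg Hg; split.
  by move=> x Ux; apply: continuousM; [exact: cf | exact: cg].
move=> i; have [df Df] := Hf i; have [dg Dg] := Hg i; split.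
  by move=> x Ux; apply: derivableM; [exact: df | exact: dg].
apply: Ck_on_congr (Ck_onD oU (IH _ _ Cf' Dg) (IH _ _ Cg' Df)) => // x Ux.
by rewrite /= deriveM; [|exact: df|exact: dg].
Qed.

End Smoothness.

(* A chart is a homeomorphism from an open subset of M onto an open subset of
   R^m; the values of chart_fun and chart_inv elsewhere are irrelevant. *)
Record chart (R : realType) (m : nat) (M : topologicalType) := Chart {
  chart_dom : set M;
  chart_fun : M -> 'rV[R]_m;
  chart_inv : 'rV[R]_m -> M;
  open_chart_dom : open chart_dom;
  open_chart_cod : open (chart_fun @` chart_dom);
  chart_funK : forall p, chart_dom p -> chart_inv (chart_fun p) = p;
  continuous_chart_fun :
    forall p, chart_dom p -> {for p, continuous chart_fun};
  continuous_chart_inv :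
    forall x, (chart_fun @` chart_dom) x -> {for x, continuous chart_inv} }.

Definition chart_cod (R : realType) (m : nat) (M : topologicalType)
  (c : chart R m M) : set 'rV[R]_m := chart_fun c @` chart_dom c.

(* Smooth manifold of dimension m (not assumed connected). *)
Record manifold (R : realType) (m : nat) := Manifold {
  carrier :> topologicalType;
  atlas : set (chart R m carrier);
  manifold_hausdorff : hausdorff_space carrier;
  manifold_second_countable : @second_countable carrier;
  atlas_cover : forall p : carrier, exists2 c, atlas c & chart_dom c p;
  atlas_compatible : forall c1 c2, atlas c1 -> atlas c2 ->
    smooth_on (chart_fun c1 @` (chart_dom c1 `&` chart_dom c2))
              (chart_fun c2 \o chart_inv c1) }.

Section SmoothFunctions.
Context {R : realType} {m : nat} (M : manifold R m).

Definition is_smooth (f : M -> R) : Prop :=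
  forall c, @atlas _ _ M c -> smooth_on (chart_cod c) (f \o chart_inv c).

Definition smooth_pred : {pred M -> R} := mem [set f | is_smooth f].

Record Cinf :=
  SmoothFun { smooth_val :> M -> R; _ : smooth_val \in smooth_pred }.
HB.instance Definition _ := [isSub for smooth_val].
HB.instance Definition _ := [Choice of Cinf by <:].

Lemma is_smooth_cst a : is_smooth (fun=> a).
Proof. by move=> c _ k; apply: Ck_on_cst; exact: open_chart_cod. Qed.

Lemma smooth_subring_closed : subring_closed smooth_pred.
Proof.
split=> [|f g|f g]; rewrite !inE /=; first exact: is_smooth_cst.
- move=> sf sg c ac k; apply: Ck_onB; first exact: open_chart_cod.
    exact: sf.
  exact: sg.
- move=> sf sg c ac k; apply: Ck_onM; first exact: open_chart_cod.
    exact: sf.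
  exact: sg.
Qed.

HB.instance Definition _ :=
  GRing.isSubringClosed.Build (M -> R) smooth_pred smooth_subring_closed.
HB.instance Definition _ := GRing.SubChoice_isSubComPzRing.Build
  (M -> R) smooth_pred Cinf smooth_subring_closed.

Lemma smooth_cst_subproof a : (fun=> a) \in smooth_pred.
Proof. by rewrite inE; exact: is_smooth_cst. Qed.

Definition csm (a : R) : Cinf := SmoothFun (smooth_cst_subproof a).

End SmoothFunctions.

Section VectorFields.
Context {R : realType} {m : nat} (M : manifold R m).
Local Notation C := (Cinf M).

(* Tangent vectors at p are the R-linear derivations at p of C^oo(M). *)
Definition tangent_pred (p : M) : {pred C -> R^o} :=
  mem [set v | (forall a f g, v (csm M a * f + g) = a * v f + v g) /\
               (forall f g : C, v (f * g) = f p * v g + g p * v f)].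

Record tangent (p : M) :=
  Tangent { tangent_val :> C -> R^o; _ : tangent_val \in tangent_pred p }.
HB.instance Definition _ p := [isSub for @tangent_val p].
HB.instance Definition _ p := [Choice of tangent p by <:].

Lemma tangent_submod_closed p : submod_closed (tangent_pred p).
Proof.
split.
  by rewrite inE /=; split=> [a f g|f g]; rewrite /GRing.zero /= !mulr0 addr0.
move=> a u v; rewrite !inE /= => -[u1 u2] [v1 v2].
by split=> [b f g|f g]; rewrite !fctE ?u1 ?v1 ?u2 ?v2 /GRing.scale /=; ring.
Qed.
HB.instance Definition _ p :=
  GRing.isSubmodClosed.Build _ _ (tangent_pred p) (tangent_submod_closed p).
HB.instance Definition _ p := [SubChoice_isSubLmodule of tangent p by <:].

(* Vector fields are the R-linear derivations of C^oo(M). *)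
Definition vfield_pred : {pred C -> C^o} :=
  mem [set X |
    (forall a (f g : C), X (csm M a * f + g) = csm M a * X f + X g) /\
    (forall f g : C, X (f * g) = f * X g + g * X f)].

Record vfield :=
  VField { vfield_val :> C -> C^o; _ : vfield_val \in vfield_pred }.
HB.instance Definition _ := [isSub for vfield_val].
HB.instance Definition _ := [Choice of vfield by <:].

Lemma vfield_submod_closed : submod_closed vfield_pred.
Proof.
split.
  by rewrite inE /=; split=> [a f g|f g]; rewrite /GRing.zero /= !mulr0 addr0.
move=> a X Y; rewrite !inE /= => -[X1 X2] [Y1 Y2].
by split=> [b f g|f g]; rewrite !fctE ?X1 ?Y1 ?X2 ?Y2 /GRing.scale /=; ring.
Qed.
HB.instance Definition _ :=
  GRing.isSubmodClosed.Build _ _ vfield_pred vfield_submod_closed.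
HB.instance Definition _ := [SubChoice_isSubLmodule of vfield by <:].

Lemma vfieldP (X : vfield) :
  (forall a (f g : C), X (csm M a * f + g) = csm M a * X f + X g) /\
  (forall f g : C, X (f * g) = f * X g + g * X f).
Proof. by case: X => X /= /set_mem. Qed.

Lemma at_point_subproof (X : vfield) (p : M) :
  (fun f => X f p) \in tangent_pred p.
Proof.
rewrite inE /=; have [X1 X2] := vfieldP X.
by split=> [a f g|f g]; rewrite ?X1 ?X2.
Qed.

Definition at_point (X : vfield) (p : M) : tangent p :=
  Tangent (at_point_subproof X p).

Lemma lie_subproof (X Y : vfield) :
  (fun f => X (Y f) - Y (X f)) \in vfield_pred.
Proof.
have [X1 X2] := vfieldP X; have [Y1 Y2] := vfieldP Y.
have XD (f g : C) : X (f + g) = X f + X g.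
  have := X1 1 f g; have -> : csm M 1 = 1 by exact/val_inj.
  by rewrite !mul1r.
have YD (f g : C) : Y (f + g) = Y f + Y g.
  have := Y1 1 f g; have -> : csm M 1 = 1 by exact/val_inj.
  by rewrite !mul1r.
by rewrite inE /=; split=> [a f g|f g]; rewrite ?(X1, Y1, X2, Y2) ?(XD, YD)
  ?(X2, Y2); ring.
Qed.

Definition lie (X Y : vfield) : vfield := VField (lie_subproof X Y).

Definition tangent_distribution := forall p : M, set (tangent p).

End VectorFields.

Section ContactGeometry.
Context {R : realType} {m : nat} {M : manifold R m}.
Local Notation C := (Cinf M).
Local Notation VF := (vfield M).
Implicit Types (T : VF -> VF) (g : VF -> VF -> C^o) (nabla : VF -> VF -> VF).
Implicit Types (phi : {linear VF -> VF}) (eta : {linear VF -> C^o}) (xi : VF).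
Implicit Types (L Q : tangent_distribution M).

Definition section_of L : set VF := [set V | forall p, L p (at_point V p)].

Definition subbundle (k : nat) L : Prop :=
  forall p, exists2 U : set M, open_nbhs p U & exists E : 'I_k -> VF,
    forall q, U q ->
      (forall c : 'I_k -> R,
          \sum_i c i *: at_point (E i) q = 0 -> forall i, c i = 0) /\
      L q = [set \sum_i c i *: at_point (E i) q | c in [set: 'I_k -> R]].

Definition involutive L : Prop :=
  forall V W, section_of L V -> section_of L W -> section_of L (lie V W).

(* The rank k foliation with tangent bundle L: foliations are given by their
   tangent bundles, which are the involutive subbundles of TM. *)
Definition foliation (k : nat) L : Prop := subbundle k L /\ involutive L.

Record riemannian_metric g : Prop := {
  metric_linear : forall V, linear (g V);
  metric_sym : forall V W, g V W = g W V;
  metric_pos : forall V p, at_point V p != 0 -> 0 < g V V p }.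

Record connection nabla : Prop := {
  conn_linearl : forall (f : C) V V' W,
    nabla (f *: V + V') W = f *: nabla V W + nabla V' W;
  conn_addr : forall V W W', nabla V (W + W') = nabla V W + nabla V W';
  conn_leibniz : forall (f : C) V W,
    nabla V (f *: W) = V f *: W + f *: nabla V W }.

Definition torsion nabla (V W : VF) : VF := nabla V W - nabla W V - lie V W.

Definition curvature nabla (V W Z : VF) : VF :=
  nabla V (nabla W Z) - nabla W (nabla V Z) - nabla (lie V W) Z.

Record levi_civita g nabla : Prop := {
  lc_connection : connection nabla;
  lc_torsion : forall V W, torsion nabla V W = 0;
  lc_metric : forall V W Z : VF,
    V (g W Z) = g (nabla V W) Z + g W (nabla V Z) }.

Definition ext_d eta (V W : VF) : C :=
  csm M 2^-1 * (V (eta W) - W (eta V) - eta (lie V W)).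

Record almost_contact_metric phi xi eta g : Prop := {
  acm_metric : riemannian_metric g;
  acm_reeb : eta xi = 1;
  acm_phi2 : forall V, phi (phi V) = - V + eta V *: xi;
  acm_compat : forall V W, g (phi V) (phi W) = g V W - eta V * eta W }.

Definition fundamental_form phi g (V W : VF) : C := g V (phi W).

Definition contact_metric phi xi eta g : Prop :=
  almost_contact_metric phi xi eta g /\
  forall V W, ext_d eta V W = fundamental_form phi g V W.

Definition lie_der_endo xi T (V : VF) : VF := lie xi (T V) - T (lie xi V).

Definition tensor_h phi xi (V : VF) : VF := csm M 2^-1 *: lie_der_endo xi phi V.

Definition killing g xi : Prop :=
  forall V W : VF, xi (g V W) - g (lie xi V) W - g V (lie xi W) = 0.

Definition K_contact phi xi eta g : Prop :=
  contact_metric phi xi eta g /\ killing g xi.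

(* nabla stands for the Levi-Civita connection of g. *)
Definition kappa_mu_space phi xi eta g nabla (kappa mu : R) : Prop :=
  let h := tensor_h phi xi in
  contact_metric phi xi eta g /\
  forall V W, curvature nabla V W xi =
    csm M kappa *: (eta W *: V - eta V *: W) +
    csm M mu *: (eta W *: h V - eta V *: h W).

Definition contact_dist eta : tangent_distribution M :=
  fun p => [set v | exists2 V : VF, at_point V p = v & eta V p = 0].
Arguments contact_dist eta p : clear implicits.

Definition reeb_line xi : tangent_distribution M :=
  fun p => [set t *: at_point xi p | t in [set: R]].
Arguments reeb_line xi p : clear implicits.

(* T is meant to be C^oo(M)-linear, so that the value of T V at p only depends
   on the value of V at p. *)
Definition eigendist T (c : R) : tangent_distribution M :=
  fun p =>
    [set v | exists2 V : VF, at_point V p = v & at_point (T V) p = c *: v].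
Arguments eigendist T c p : clear implicits.

Definition legendrian_dist (n : nat) eta L : Prop :=
  [/\ subbundle n L, forall p, L p `<=` contact_dist eta p &
      forall V W, section_of L V -> section_of L W -> ext_d eta V W = 0].

Definition legendrian_foliation (n : nat) eta L : Prop :=
  legendrian_dist n eta L /\ foliation n L.

(* L and Q are complementary in the contact distribution ker eta. *)
Definition complementary eta L Q : Prop :=
  forall p,
    (forall v, contact_dist eta p v ->
       exists l q, [/\ L p l, Q p q & v = l + q]) /\
    (forall v, L p v -> Q p v -> v = 0).

Definition orthogonal_dist g L Q : Prop :=
  forall V W, section_of L V -> section_of Q W -> g V W = 0.

Definition orthogonal_biLegendrian (n : nat) eta g L Q : Prop :=
  [/\ legendrian_foliation n eta L, legendrian_foliation n eta Q,
      complementary eta L Q & orthogonal_dist g L Q].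

(* A = V_L and B = V_Q with respect to TM = L + Q + R xi. *)
Definition components xi L Q (V A B : VF) : Prop :=
  [/\ section_of L A, section_of Q B & exists f : C, V = A + B + f *: xi].

Definition preserves nabla L : Prop :=
  forall V W, section_of L W -> section_of L (nabla V W).

Definition parallel_endo nabla T : Prop :=
  forall V W, nabla V (T W) = T (nabla V W).

Definition parallel_form nabla (w : VF -> VF -> C) : Prop :=
  forall V W Z : VF, V (w W Z) = w (nabla V W) Z + w W (nabla V Z).

Record biLegendrian_connection xi eta L Q nabla : Prop := {
  bl_connection : connection nabla;
  bl_preserves_L : preserves nabla L;
  bl_preserves_Q : preserves nabla Q;
  bl_preserves_xi : preserves nabla (reeb_line xi);
  bl_parallel : parallel_form nabla (ext_d eta);
  bl_torsion_LQ : forall V W, section_of L V -> section_of Q W ->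
    torsion nabla V W = (csm M 2 * ext_d eta V W) *: xi;
  (* T(V, xi) = [xi, V_L]_Q + [xi, V_Q]_L *)
  bl_torsion_xi : forall V VL VQ LL LQ QL QQ,
    components xi L Q V VL VQ ->
    components xi L Q (lie xi VL) LL LQ ->
    components xi L Q (lie xi VQ) QL QQ ->
    torsion nabla V xi = LQ + QL }.

End ContactGeometry.

(* Main.v *)
Require Import Defs.
From HB Require Import structures.
From mathcomp Require Import all_boot all_order all_algebra.
From mathcomp Require Import all_classical all_reals all_analysis ring lra.
Set Implicit Arguments.
Unset Strict Implicit.
Unset Printing Implicit Defensive.
Import Order.TTheory GRing.Theory Num.Theory numFieldNormedType.Exports.
Local Open Scope classical_set_scope.
Local Open Scope ring_scope.

(** The theorem rests on two computations with the operator
    A V = nabla_V xi = - phi V - phi (h V), in which h is symmetric, anticommutes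
    with phi and kills xi.

    Suppose the (kappa, mu)-condition. Evaluating R(xi, V) xi in two ways gives
    h h = (kappa - 1) phi phi and phi (nabla_xi h) = mu h [kappa_mu_sum]. As h is
    not zero, kappa < 1, and h has the eigenvalues lam and - lam, with
    lam = sqrt (1 - kappa), on two orthogonal distributions which phi exchanges.
    The condition also says that R(V, W) xi = 0 for V and W in the contact
    distribution. For three eigenfields X, Y, Z of the same eigenvalue, this, its
    analogue with phi Y in place of Y, and the closedness of the fundamental form
    are linear equations in the numbers g(nabla_X Y, phi Z) and their
    permutations, with only the zero solution [eig_geodesic]. Hence the explicit
    connection
      nbl V W = nabla V W - eta W A V + g(W, A V) xi + (mu / 2) eta V phi W
    preserves the eigendistributions [nbl_eig]; it is metric, has the required
    torsion, and makes h parallel. That phi is parallel follows from d Phi = 0,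
    because the tensor g((nabla_X phi) Y, phi Z) is then symmetric in X, Y and
    skew in Y, Z on each eigendistribution [nbl_phi]. The eigendistributions have
    rank n because with xi they span the tangent spaces and phi exchanges them
    [eig_subbundle].

    Conversely let nb be the bi-Legendrian connection of (L, Q), with phi and h
    parallel. It is metric on the contact distribution, its torsion vanishes on L
    and on Q, and the part of the torsion that carries the geometry is
    tau V = T(V, xi), which exchanges L and Q. The Bianchi identity expresses the
    curvature R(X, X') of nb on Q by tau, and its skew-symmetry forces
    tau = a phi on L, and likewise tau = b phi on Q [tau_scalar]. Then h is
    multiplication by l = (a - b) / 2 on L and by - l on Q. As h is parallel, a - b
    is constant; the Bianchi identity for (X, phi X, xi) shows that b is constant
    along L and a along Q [tau_coefficient_L], and since the brackets of L and Q
    reach xi, both are constant, M being connected [coefficient_const]. On the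
    contact distribution nabla and nb differ by multiples of xi only, which gives
    R(V, W) xi = 0 there [curvature_D_reeb], and R(xi, V) xi is computed from tau:
    the condition holds with kappa = 1 - l ^ 2 and mu = 2 - a - b
    [kappa_mu_of_scalar]. As h is l on L and - l on Q, these are the eigendistributions
    of h, with l = lam or l = - lam [structure_eigendist].

    Vector fields are derivations of the algebra of smooth functions, so that the
    passage between fields and tangent vectors has to be established first: local
    frames come from Hadamard's lemma [tangent_coordinates, local_frame], and
    linear maps between fields are tensorial [tensorial_vf]. Orthogonal projection
    onto a subbundle [orthogonal_projection] splits fields along L, Q and xi. *)

(** * Differential calculus on open subsets of R^m *)

Section Calculus.
Context {R : realType}.

(** Restriction to a line reduces directional derivatives to derivatives in one
    variable, for which the mean value theorem and the chain rule are available. *)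
Lemma derive_along (V W : normedModType R) (f : V -> W) x v s :
  derivable f (x + s *: v) v ->
  is_derive s (1 : R) (fun t : R => f (x + t *: v)) ('D_v f (x + s *: v)).
Proof.
have E : (fun h : R => h^-1 *: (((fun t => f (x + t *: v)) \o shift s) h%:A -
    f (x + s *: v))) =
    (fun h : R => h^-1 *: ((f \o shift (x + s *: v)) (h *: v) - f (x + s *: v))).
  apply/funext => h /=; congr (_ *: (f _ - _)).
  by rewrite [h%:A]mulr1 scalerDl addrCA.
by move=> df; apply: DeriveDef; rewrite ?/derivable ?/derive E.
Qed.

Lemma mean_value_along (W : normedModType R) (f : W -> R) x v (t : R) :
  (forall s : R, `|s| <= `|t| -> derivable f (x + s *: v) v) ->
  exists2 s : R, `|s| <= `|t| & f (x + t *: v) - f x = t * 'D_v f (x + s *: v).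
Proof.
move=> df.
have D (s : R) : `|s| <= `|t| ->
  is_derive s (1 : R) (fun t : R => f (x + t *: v)) ('D_v f (x + s *: v)).
  by move=> st; apply: derive_along; exact: df.
have C (s : R) : `|s| <= `|t| -> {for s, continuous (fun t : R => f (x + t *: v))}.
  move=> st; apply: differentiable_continuous; apply/derivable1_diffP.
  by have [] := D s st.
have [t0|t0] := leP 0 t.
  have [||c ct] := @MVT_segment R (fun t => f (x + t *: v))
    (fun s => 'D_v f (x + s *: v)) 0 t t0.
  - move=> s; rewrite in_itv /= => /andP[s0 st]; apply: D.
    by rewrite !ger0_norm // ltW.
  - apply: continuous_in_subspaceT => s; rewrite inE /= in_itv /= => /andP[s0 st].
    by apply: C; rewrite !ger0_norm.
  rewrite scale0r addr0 subr0 => ->; exists c; last by rewrite mulrC.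
  by move: ct; rewrite in_itv /= => /andP[? ?]; rewrite !ger0_norm.
have [||c ct] := @MVT_segment R (fun t => f (x + t *: v))
    (fun s => 'D_v f (x + s *: v)) t 0 (ltW t0).
- move=> s; rewrite in_itv /= => /andP[s0 st]; apply: D.
  by rewrite !ler0_norm ?lerN2 // ltW.
- apply: continuous_in_subspaceT => s; rewrite inE /= in_itv /= => /andP[s0 st].
  by apply: C; rewrite !ler0_norm ?lerN2 // ltW.
rewrite scale0r addr0 sub0r => E; exists c.
  move: ct; rewrite in_itv /= => /andP[? ?].
  by rewrite !ler0_norm ?lerN2 // ltW.
by rewrite -opprB E mulrN opprK mulrC.
Qed.

Lemma differentiable_of_linear (V W : normedModType R) (f : V -> W)
    (L : {linear V -> W}) x :
  continuous L ->
  (forall e : R, 0 < e ->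
     \forall h \near 0, `|f (h + x) - f x - L h| <= e * `|h|) ->
  differentiable f x.
Proof.
move=> cL H.
have E : f \o shift x = cst (f x) + L +o_ (0 : V) id.
  apply/eqaddoP => e e0; apply: filterS (H e e0) => h /=.
  by rewrite !fctE opprD addrA.
apply/diff_locallyP; rewrite (_ : 'd f x = L :> (V -> W)) //.
exact: diff_unique.
Qed.

Context {m : nat}.
Implicit Types (U : set 'rV[R]_m) (x : 'rV[R]_m).
Local Notation e_ := (delta_mx ord0 : 'I_m -> 'rV[R]_m).

(** Continuity and the existence of partial derivatives are conditions at each
    point, so that the class on U can be tested on singletons, although these are
    not open. *)
Lemma Ck_on_pt (W : normedModType R) k U (f : 'rV[R]_m -> W) :
  Ck_on k U f <-> forall x, U x -> Ck_on k [set x] f.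
Proof.
elim: k f => [|k IH] f; split.
- by move=> [cf _] x Ux; split=> // y ->; exact: cf.
- by move=> H; split=> // x Ux; have [cf _] := H x Ux; exact: cf.
- move=> [cf H] x Ux; split; first by move=> y ->; exact: cf.
  move=> i; have [df Df] := H i; split; first by move=> y ->; exact: df.
  by move/IH: Df; exact.
- move=> H; split; first by move=> x Ux; have [cf _] := H x Ux; exact: cf.
  move=> i; split.
    by move=> x Ux; have [_ /(_ i)[df _]] := H x Ux; exact: df.
  by apply/IH => x Ux; have [_ /(_ i)[_ Df]] := H x Ux.
Qed.

Lemma Ck_on_sub (W : normedModType R) k U V (f : 'rV[R]_m -> W) :
  V `<=` U -> Ck_on k U f -> Ck_on k V f.
Proof. by move=> VU /Ck_on_pt H; apply/Ck_on_pt => x Vx; exact/H/VU. Qed.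

Lemma smooth_on_sub (W : normedModType R) U V (f : 'rV[R]_m -> W) :
  V `<=` U -> smooth_on U f -> smooth_on V f.
Proof. by move=> VU H k; exact: Ck_on_sub (H k). Qed.

Lemma smooth_on_local (W : normedModType R) U (f : 'rV[R]_m -> W) :
  (forall x, U x -> exists2 V : set 'rV[R]_m, V x & smooth_on V f) ->
  smooth_on U f.
Proof.
move=> H k; apply/Ck_on_pt => x /H[V Vx sf].
by apply: Ck_on_sub (sf k) => y ->.
Qed.

Lemma smooth_on_congr (W : normedModType R) U (f g : 'rV[R]_m -> W) :
  open U -> (forall x, U x -> f x = g x) -> smooth_on U f -> smooth_on U g.
Proof. by move=> oU fg sf k; exact: Ck_on_congr (sf k). Qed.

Lemma smooth_on_continuous (W : normedModType R) U (f : 'rV[R]_m -> W) x :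
  smooth_on U f -> U x -> {for x, continuous f}.
Proof. by move=> /(_ 0) [cf _]; exact: cf. Qed.

Lemma smooth_on_derivable (W : normedModType R) U (f : 'rV[R]_m -> W) i x :
  smooth_on U f -> U x -> derivable f x (e_ i).
Proof. by move=> /(_ 1) [_ /(_ i) [df _]]; exact: df. Qed.

Lemma smooth_on_derive (W : normedModType R) U (f : 'rV[R]_m -> W) i :
  smooth_on U f -> smooth_on U ('D_(e_ i) f).
Proof. by move=> sf k; have [_ /(_ i) []] := sf k.+1. Qed.

Lemma mx_norm_coord (h : 'rV[R]_m) i : `|h ord0 i| <= `|h|.
Proof. by rewrite [leRHS]mx_normrE; exact: (le_bigmax _ _ (ord0, i)). Qed.

(* The vector whose coordinates below j are those of h, the others being 0. *)
Let trunc (h : 'rV[R]_m) j : 'rV[R]_m := \row_i (if (i < j)%N then h ord0 i else 0).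

(** One passes from x to x + h by changing one coordinate at a time, through the
    truncations of h; the mean value theorem applies to each step, and the
    continuity of the partial derivatives controls the error. *)
Lemma C1_differentiable U (f : 'rV[R]_m -> R) x :
  open U -> Ck_on 1 U f -> U x -> differentiable f x.
Proof.
move=> oU [cf H] Ux.
pose L := (fun h : 'rV[R]_m => \sum_i h ord0 i * 'D_(e_ i) f x) : 'rV[R]_m -> R^o.
have linL : linear L.
  move=> a u v; rewrite /L scaler_sumr -big_split /=; apply: eq_bigr => i _.
  by rewrite !mxE mulrDl scalerAl.
pose HL := GRing.isLinear.Build R 'rV[R]_m R^o *:%R L linL.
pose LL : {linear 'rV[R]_m -> R^o} := HB.pack L HL.
have cL : continuous LL.
  rewrite /= /L; apply: continuous_big => [|i _ z]; first exact: add_continuous.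
  apply: (@continuousM R _ (fun h : 'rV[R]_m => h ord0 i)
    (fun=> 'D_(e_ i) f x)); first exact: coord_continuous.
  exact: cst_continuous.
apply: (@differentiable_of_linear _ _ (f : 'rV[R]_m -> R^o) LL) => // e e0.
have H2 i : \forall y \near x, U y /\ `|'D_(e_ i) f y - 'D_(e_ i) f x| <= e / m.+1%:R.
  have [df [cDf _]] := H i.
  apply: filterI; first exact: open_nbhs_nbhs.
  have e0' : 0 < e / m.+1%:R by rewrite divr_gt0.
  have /cvgrPdist_le /(_ _ e0') := cDf x Ux.
  by apply: filterS => y; rewrite distrC.
have /nbhs_ballP [d /= d0 Hd] : \forall y \near x, forall i, U y /\
    `|'D_(e_ i) f y - 'D_(e_ i) f x| <= e / m.+1%:R.
  exact: (@filter_forall _ _ _ (nbhs x) _ H2).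
apply/nbhs_ballP; exists d => //= h.
rewrite -ball_normE /ball_ /= sub0r normrN => hd.
rewrite /= /L.
have hx j : `|trunc h j| <= `|h|.
  rewrite [leLHS]mx_normrE; apply/bigmax_leP; split=> // -[i' i] _ /=.
  by rewrite mxE; case: ifP => _; rewrite ?normr0 // mx_norm_coord.
have E (j : 'I_m) : `|f (x + trunc h j.+1) - f (x + trunc h j) -
    h ord0 j * 'D_(e_ j) f x| <= (e / m.+1%:R) * `|h|.
  have tS : trunc h j.+1 = trunc h j + h ord0 j *: e_ j.
    apply/rowP => i; rewrite !mxE eqxx ltnS leq_eqVlt /=.
    have [->|ij] := eqVneq i j.
      by rewrite eqxx ltnn /= mulr1 add0r.
    by rewrite -val_eqE /= in ij *; rewrite (negPf ij) /= mulr0 addr0.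
  have inball s : `|s| <= `|h ord0 j| -> ball x d (x + trunc h j + s *: e_ j).
    move=> sh; rewrite -ball_normE /ball_ /= opprD addrA opprD addrA subrr sub0r.
    rewrite -opprD normrN; apply: le_lt_trans hd.
    rewrite [leLHS]mx_normrE; apply/bigmax_leP; split=> // -[i' i] _ /=.
    rewrite !mxE !ord1 eqxx /=; have [->|ij] := eqVneq i j.
      by rewrite ltnn add0r mulr1 (le_trans sh) // mx_norm_coord.
    rewrite mulr0 addr0; case: ifP => _; rewrite ?normr0 //.
    exact: mx_norm_coord.
  rewrite tS addrA.
  have [|s sh ->] := @mean_value_along _ f (x + trunc h j) (e_ j) (h ord0 j).
    by move=> s /inball /Hd /(_ j) [Us _]; have [df _] := H j; exact: df.
  rewrite -mulrBr normrM mulrC ler_pM //.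
    by have [] := Hd _ (inball s sh) j.
  exact: mx_norm_coord.
have t0 : trunc h 0 = 0 by apply/rowP => i; rewrite !mxE.
have tm : trunc h m = h by apply/rowP => i; rewrite !mxE ltn_ord.
have T : f (h + x) - f x = \sum_(j < m) (f (x + trunc h j.+1) - f (x + trunc h j)).
  rewrite -(big_mkord predT (fun j => f (x + trunc h j.+1) - f (x + trunc h j))).
  by rewrite (telescope_sumr (fun j => f (x + trunc h j))) // t0 tm addr0 (addrC h).
rewrite T -sumrB (le_trans (ler_norm_sum _ _ _)) //.
rewrite (le_trans (ler_sum _ (fun j _ => E j))) // sumr_const card_ord.
rewrite -[X in X <= _]mulr_natl mulrA ler_wpM2r //.
rewrite mulrCA ger_pMr // ler_pdivrMr ?ltr0n // mul1r ler_nat //.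
Qed.

End Calculus.

Section Chain.
Context {R : realType}.

Lemma linear_sum_coord (W : lmodType R) m (L : {linear 'rV[R]_m -> W}) (h : 'rV[R]_m) :
  L h = \sum_i h ord0 i *: L (delta_mx ord0 i).
Proof.
rewrite {1}(matrix_sum_delta h) big_ord1 linear_sum.
by apply: eq_bigr => i _; rewrite linearZ.
Qed.

(** As f is differentiable, G need only be derivable along a single line. *)
Lemma derive_chain (V : normedModType R) m (U : set 'rV[R]_m) (f : 'rV[R]_m -> R)
    (G : V -> 'rV[R]_m) x v :
  open U -> Ck_on 1 U f -> U (G x) -> derivable G x v ->
  derivable (f \o G) x v /\
  'D_v (f \o G) x = \sum_j 'D_(delta_mx ord0 j) f (G x) * ('D_v G x) ord0 j.
Proof.
move=> oU Cf UGx dG.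
pose c (t : R) := G (x + t *: v).
have dc0 : is_derive (0 : R) (1 : R) c ('D_v G x).
  have := @derive_along R V 'rV[R]_m G x v 0.
  by rewrite scale0r addr0; apply.
have c0 : c 0 = G x by rewrite /c scale0r addr0.
have df : differentiable f (c 0) by rewrite c0; exact: C1_differentiable Cf UGx.
have dc : differentiable c 0 by apply/derivable1_diffP; case: dc0.
have dfc : differentiable (f \o c) 0 by exact: differentiable_comp.
have dfG : derivable (f \o G) x v.
  apply/derivable1P; move/derivable1_diffP: dfc; rewrite /c /=.
  by under [X in _ -> derivable X _ _]eq_fun do rewrite addrC.
split=> //.
have := @derive_along R V R (f \o G) x v 0.
rewrite scale0r addr0 => /(_ dfG)[_ <-].
rewrite -[fun t => _]/(f \o c) deriveE // diff_comp //=.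
have -> : 'd c 0 1 = 'D_v G x by rewrite -(deriveE _ dc); case: dc0.
rewrite linear_sum_coord c0; rewrite c0 in df; apply: eq_bigr => j _.
by rewrite [RHS]mulrC (deriveE _ df).
Qed.

Lemma Ck_on_coord m l k (U : set 'rV[R]_m) (G : 'rV[R]_m -> 'rV[R]_l) j :
  open U -> Ck_on k U G -> Ck_on k U (fun x => G x ord0 j).
Proof.
move=> oU; elim: k G => [|k IH] G [cG H].
  split=> // x Ux.
  exact: (continuous_comp (cG x Ux) (@coord_continuous _ _ _ ord0 j _)).
split.
  move=> x Ux.
  exact: (continuous_comp (cG x Ux) (@coord_continuous _ _ _ ord0 j _)).
move=> i; have [dG DG] := H i; split.
  by move=> x /dG /derivable_mxP.
apply: Ck_on_congr (IH _ DG) => // x Ux.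
by rewrite derive_mx ?mxE //; exact: dG.
Qed.

Lemma Ck_on_sum m k (U : set 'rV[R]_m) (I : Type) (s : seq I)
    (F : I -> 'rV[R]_m -> R) :
  open U -> (forall i, Ck_on k U (F i)) -> Ck_on k U (fun x => \sum_(i <- s) F i x).
Proof.
move=> oU CF; elim: s => [|i s IH].
  by apply: Ck_on_congr (Ck_on_cst _ 0 oU) => // x _; rewrite big_nil.
by apply: Ck_on_congr (Ck_onD oU (CF i) IH) => // x _; rewrite big_cons.
Qed.

(** Induction on k: the chain rule expresses the partial derivatives of f \o G by
    products of functions of class k, one of which is again a composition. *)
Lemma Ck_on_comp m l k (U : set 'rV[R]_m) (V : set 'rV[R]_l)
    (f : 'rV[R]_l -> R) (G : 'rV[R]_m -> 'rV[R]_l) :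
  open U -> open V -> (forall x, U x -> V (G x)) ->
  Ck_on k V f -> Ck_on k U G -> Ck_on k U (f \o G).
Proof.
move=> oU oV UV; elim: k f => [|k IH] f Cf CG; have [cf Hf] := Cf;
  have [cG HG] := CG.
  by split=> // x Ux; apply: continuous_comp; [exact: cG | exact/cf/UV].
split.
  by move=> x Ux; apply: continuous_comp; [exact: cG | exact/cf/UV].
have C1f : Ck_on 1 V f.
  split=> // i; have [df Df] := Hf i; split=> //; split=> //.
  by case: k Df {IH Cf CG Hf HG} => [|k] [].
move=> i; have [dG DG] := HG i.
have D x : U x -> derivable (f \o G) x (delta_mx ord0 i) /\
    'D_(delta_mx ord0 i) (f \o G) x =
    \sum_j 'D_(delta_mx ord0 j) f (G x) * ('D_(delta_mx ord0 i) G x) ord0 j.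
  by move=> Ux; apply: derive_chain C1f _ (dG _ Ux) => //; exact: UV.
split; first by move=> x /D [].
apply: Ck_on_congr (_ : Ck_on k U (fun x => \sum_j
  'D_(delta_mx ord0 j) f (G x) * ('D_(delta_mx ord0 i) G x) ord0 j)) => //.
  by move=> x /D [_ ->].
apply: Ck_on_sum => // j; apply: Ck_onM => //; last exact: Ck_on_coord.
by apply: (IH ('D_(delta_mx ord0 j) f)); [have [_] := Hf j | exact: Ck_on_leq].
Qed.

Lemma smooth_on_comp m l (U : set 'rV[R]_m) (V : set 'rV[R]_l)
    (f : 'rV[R]_l -> R) (G : 'rV[R]_m -> 'rV[R]_l) :
  open U -> open V -> (forall x, U x -> V (G x)) ->
  smooth_on V f -> smooth_on U G -> smooth_on U (f \o G).
Proof. by move=> oU oV UV sf sG k; exact: Ck_on_comp (sf k) (sG k). Qed.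

Lemma smooth_onM m (U : set 'rV[R]_m) (f g : 'rV[R]_m -> R) :
  open U -> smooth_on U f -> smooth_on U g -> smooth_on U (f \* g).
Proof. by move=> oU sf sg k; exact: Ck_onM. Qed.

Lemma smooth_onB m (U : set 'rV[R]_m) (f g : 'rV[R]_m -> R) :
  open U -> smooth_on U f -> smooth_on U g -> smooth_on U (f \- g).
Proof. by move=> oU sf sg k; exact: Ck_onB. Qed.

Lemma smooth_on_cst m (U : set 'rV[R]_m) (a : R) :
  open U -> smooth_on U (fun=> a).
Proof. by move=> oU k; exact: Ck_on_cst. Qed.

Lemma smooth_on_proj m (U : set 'rV[R]_m) (j : 'I_m) :
  open U -> smooth_on U (fun x => x ord0 j).
Proof.
move=> oU [|k]; first by split=> // x _; exact: coord_continuous.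
split; first by move=> x _; exact: coord_continuous.
move=> i; have D x : is_derive x (delta_mx ord0 i : 'rV[R]_m)
    (fun x : 'rV[R]_m => x ord0 j) ((delta_mx ord0 i : 'rV[R]_m) ord0 j).
  have dx := @derivable_id R _ x (delta_mx ord0 i : 'rV[R]_m).
  split; first by have /derivable_mxP := dx; exact.
  by have := derive_mx dx; rewrite derive_id => {2}->; rewrite mxE.
split; first by move=> x _; case: (D x).
apply: Ck_on_congr (Ck_on_cst k ((delta_mx ord0 i : 'rV[R]_m) ord0 j) oU) => // x _.
by case: (D x).
Qed.

Lemma Ck_onV m k (U : set 'rV[R]_m) (f : 'rV[R]_m -> R) :
  open U -> (forall x, U x -> f x != 0) -> Ck_on k U f ->
  Ck_on k U (fun x => (f x)^-1).
Proof.
move=> oU f0; elim: k => [|k IH] Cf; have [cf Hf] := Cf.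
  by split=> // x Ux; apply: continuousV; [exact: f0 | exact: cf].
split; first by move=> x Ux; apply: continuousV; [exact: f0 | exact: cf].
have {}IH := IH (Ck_on_leq Cf).
move=> i; have [df Df] := Hf i; split.
  by move=> x Ux; apply: derivableV; [exact: f0 | exact: df].
apply: (@Ck_on_congr _ _ _ _ _ (((fun=> 0) \- (fun x => (f x)^-1)) \*
    (fun x => (f x)^-1) \* 'D_(delta_mx ord0 i) f)) => //.
  move=> x Ux; rewrite /= deriveV ?f0 //; last exact: df.
  by rewrite sub0r !mulNr -exprVn expr2 scaleNr.
apply: Ck_onM => //; apply: Ck_onM => //; apply: Ck_onB => //.
exact: Ck_on_cst.
Qed.

End Chain.

(** * Flat functions *)

Section Flat.
Context {R : realType}.

(** The inverse powers of x are there because the derivatives of exp(-1/x) are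
    combinations of these functions, so that smoothness follows by induction. *)
Definition flat (k : nat) (x : R) : R :=
  if 0 < x then (x^-1) ^+ k * expR (- x^-1) else 0.

Lemma flat_gt0 k x : 0 < x -> 0 < flat k x.
Proof. by move=> x0; rewrite /flat x0 mulr_gt0 ?expR_gt0 // exprn_gt0 ?invr_gt0. Qed.

Lemma flat_le0 k x : x <= 0 -> flat k x = 0.
Proof. by rewrite /flat leNgt => /negPf ->. Qed.

Lemma flat_ge0 k x : 0 <= flat k x.
Proof. by have [/flat_le0->//|/(flat_gt0 k)/ltW] := leP x 0. Qed.

(** The Taylor polynomial of exp at 1/x bounds it from below. A quadratic bound is
    what the vanishing of the derivative at 0 requires. *)
Lemma flat_le_sqr k x : flat k x <= k.+2`!%:R * x ^+ 2.
Proof.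
rewrite /flat; case: ifPn => [x0|_]; last by rewrite mulr_ge0 // sqr_ge0.
rewrite expRN; have y0 : 0 < x^-1 by rewrite invr_gt0.
have := expR_ge1Dxn k.+1 (ltW y0); set y := x^-1 in y0 *.
have -> : x = y^-1 by rewrite invrK.
rewrite ler_pdivrMr ?expR_gt0 // => le.
have {}le : y ^+ k.+2 / k.+2`!%:R <= expR y by apply: le_trans le; rewrite lerDr.
rewrite ler_pdivrMr ?ltr0n ?fact_gt0 // in le.
by rewrite [y^-1 ^+ 2]exprVn mulrAC ler_pdivlMr ?exprn_gt0 // -exprD addn2 [leRHS]mulrC.
Qed.

Lemma flat_is_derive k (x : R) :
  is_derive x (1 : R) (flat k) (flat k.+2 x - k%:R * flat k.+1 x).
Proof.
have [x0|x0|->] := ltgtP x 0.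
- rewrite !flat_le0 ?ltW // mulr0 subr0.
  apply: (near_eq_is_derive (f := fun=> 0)).
    by near=> y; rewrite flat_le0 // ltW //; near: y; exact: lt_nbhsl.
- have xn0 : x != 0 by rewrite gt_eqF.
  have dV : is_derive x (1 : R) (fun y : R => y^-1) (- x ^- 2 *: (1 : R)).
    exact: is_deriveV.
  have dE : is_derive x (1 : R) (expR \o (fun y : R => - y^-1))
      (expR (- x^-1) * - (- x ^- 2 *: (1 : R))).
    exact: is_derive1_comp.
  have D := is_deriveM (is_deriveX k dV) dE.
  have E : \forall y \near x, ((fun y : R => y^-1) ^+ k *
      (expR \o (fun y : R => - y^-1))) y = flat k y.
    near=> y; rewrite /flat ifT; last by near: y; exact: lt_nbhsr.
    by rewrite [LHS]/= !fctE.
  have := near_eq_is_derive E D; congr is_derive.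
  rewrite /flat x0 /GRing.scale /= -exprVn mulr1 opprK.
  case: k {D E} => [|k]; first by rewrite !fctE /=; ring.
  by rewrite !fctE !exprS /=; ring.
have f0 : flat k 0 = 0 by rewrite flat_le0.
rewrite !flat_le0 // mulr0 subr0.
have C : (fun h : R => h^-1 *: ((flat k \o shift 0) (h *: (1 : R)) - flat k 0))
   @ 0^' --> (0 : R).
  apply/cvgrPdist_le => e e0; near=> h.
  rewrite sub0r normrN /= f0 subr0 addr0 [h *: _]mulr1 normrM normfV.
  have h0 : 0 < `|h| by rewrite normr_gt0; near: h; exact: nbhs_dnbhs_neq.
  rewrite mulrC ler_pdivrMr // ger0_norm ?flat_ge0 //.
  rewrite (le_trans (flat_le_sqr _ _)) // -real_normK ?num_real // expr2 mulrA.
  rewrite ler_wpM2r // mulrC -ler_pdivlMr ?ltr0n ?fact_gt0 //.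
  by near: h; apply: dnbhs0_le; rewrite divr_gt0 // ltr0n fact_gt0.
apply: DeriveDef; first by apply/cvg_ex; exists 0.
exact/cvg_lim.
Unshelve. all: by end_near. Qed.

(** The induction on the class has to run over all j at once, the derivative of
    flat j being expressed by flat j.+1 and flat j.+2. *)
Lemma Ck_on_flat m k j (U : set 'rV[R]_m) (u : 'rV[R]_m -> R) :
  open U -> Ck_on k U u -> Ck_on k U (flat j \o u).
Proof.
move=> oU.
have cf i : continuous (flat i).
  move=> x; apply: differentiable_continuous; apply/derivable1_diffP.
  by case: (flat_is_derive i x).
elim: k j => [|k IH] j Cu; have [cu Hu] := Cu.
  by split=> // x Ux; apply: continuous_comp; [exact: cu | exact: cf].
split; first by move=> x Ux; apply: continuous_comp; [exact: cu | exact: cf].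
have {}IH i := IH i (Ck_on_leq Cu).
move=> i; have [du Du] := Hu i.
pose v : 'rV[R]_m := delta_mx ord0 i.
have D x : U x -> is_derive x v (flat j \o u)
    ((flat j.+2 (u x) - j%:R * flat j.+1 (u x)) * 'D_v u x).
  move=> Ux; pose c (t : R) := u (x + t *: v).
  have dc : is_derive (0 : R) (1 : R) c ('D_v u x).
    have := @derive_along R _ R u x v 0.
    by rewrite scale0r addr0; apply; exact: du.
  have c0 : c 0 = u x by rewrite /c scale0r addr0.
  have dfc : is_derive (0 : R) (1 : R) (flat j \o c)
      ((flat j.+2 (u x) - j%:R * flat j.+1 (u x)) * 'D_v u x).
    by apply: is_derive1_comp; rewrite c0; exact: flat_is_derive.
  have dfu : derivable (flat j \o u) x v.
    apply/derivable1P; have [+ _] := dfc; rewrite /c /=.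
    by under [X in _ -> derivable X _ _]eq_fun do rewrite addrC.
  split=> //.
  have := @derive_along R _ R (flat j \o u) x v 0.
  rewrite scale0r addr0 => /(_ dfu)[_ <-].
  by have [_ <-] := dfc.
split; first by move=> x /D [].
apply: (@Ck_on_congr _ _ _ _ _ (((flat j.+2 \o u) \- ((fun=> j%:R) \*
   (flat j.+1 \o u))) \* 'D_v u)) => //.
  by move=> x /D [_ ->].
apply: Ck_onM => //; apply: Ck_onB => //; apply: Ck_onM => //.
exact: Ck_on_cst.
Qed.

End Flat.

(** * Hadamard's lemma *)

Lemma lipschitz_at_continuous (R : realType) (V W : normedModType R) (f : V -> W)
    (x : V) (K : R) : 0 < K ->
  (\forall y \near x, `|f x - f y| <= K * `|x - y|) -> {for x, continuous f}.
Proof.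
move=> K0 fK; apply/cvgrPdist_le => e e0.
near=> y; rewrite (_ : e = K * (e / K)); last by rewrite mulrC divfK // gt_eqF.
apply: (@le_trans _ _ (K * `|x - y|)); first by near: y.
rewrite (ler_wpM2l (ltW K0)) //; near: y; apply/nbhs_ballP.
exists (e / K); first by rewrite /= divr_gt0.
by move=> y; rewrite -ball_normE /ball_ /= => /ltW.
Unshelve. all: by end_near. Qed.

Lemma near_norm_lt (R : realType) (V : normedModType R) (a x : V) (r : R) :
  `|x - a| < r -> \forall y \near x, `|y - a| < r.
Proof.
move=> xr; apply/nbhs_ballP; exists (r - `|x - a|); first by rewrite /= subr_gt0.
move=> y; rewrite -ball_normE /ball_ /= distrC => xy.
by rewrite -(subrKA x) (le_lt_trans (ler_normD _ _)) // -ltrBrDr.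
Qed.

Lemma continuous_at_sum (R : realType) (T : topologicalType) (I : Type) (s : seq I)
    (f : I -> T -> R) (t : T) :
  (forall i, {for t, continuous (f i)}) ->
  {for t, continuous (fun t => \sum_(i <- s) f i t)}.
Proof.
move=> cf; elim: s => [|i s IH].
  rewrite (_ : (fun _ => _) = cst 0); first exact: cst_continuous.
  by apply/funext => y; rewrite big_nil.
rewrite (_ : (fun _ => _) = f i + (fun t => \sum_(i <- s) f i t)).
  exact: (@continuousD R R^o).
by apply/funext => y; rewrite big_cons.
Qed.

Lemma Rintegral01_cst (R : realType) (c : R) :
  \int[@lebesgue_measure R]_(_ in `[0%R, 1%R]) c = c.
Proof.
have E := @lebesgue_measure_itv R `[0, 1].
rewrite /= lte_fin ltr01 oppr0 adde0 in E.
rewrite Rintegral_cst // [X in _ * X](_ : _ = 1) ?mulr1 //.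
exact: (congr1 fine E).
Qed.

Lemma Rintegral01_sum (R : realType) (I : Type) (s : seq I) (c : I -> R)
    (f : I -> R -> R) :
  (forall i (t : R), t \in `[0%R, 1%R] -> {for t, continuous (f i)}) ->
  \int[@lebesgue_measure R]_(t in `[0%R, 1%R]) (\sum_(i <- s) c i * f i t) =
  \sum_(i <- s) c i * \int[@lebesgue_measure R]_(t in `[0%R, 1%R]) f i t.
Proof.
move=> cf.
have mI : measurable (`[0%R, 1%R] : set R) by exact: measurable_itv.
have cW (g : R -> R) : (forall t : R, t \in `[0%R, 1%R] -> {for t, continuous g}) ->
    (@lebesgue_measure R).-integrable `[0%R, 1%R] (EFin \o g).
  move=> cg; apply: continuous_compact_integrable; first exact: segment_compact.
  by apply: continuous_in_subspaceT => t /set_mem; exact: cg.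
have cZ i (t : R) : t \in `[0%R, 1%R] -> {for t, continuous (fun t => c i * f i t)}.
  move=> tI; apply: (@continuousM R _ (fun=> c i) (f i)); last exact: cf.
  exact: cst_continuous.
elim: s => [|i s IH].
  by under eq_Rintegral do rewrite big_nil; rewrite big_nil Rintegral_cst // mul0r.
rewrite big_cons -IH; under eq_Rintegral do rewrite big_cons.
rewrite RintegralD //; first by rewrite RintegralZl //; apply: cW; exact: cf.
- exact/cW/cZ.
- by apply: cW => t tI; apply: continuous_at_sum => k; exact: cZ.
Qed.

Section Hadamard.
Context {R : realType} {m : nat} (a : 'rV[R]_m) (r : R).
Local Notation B := (ball a r).
Local Notation e_ := (delta_mx ord0 : 'I_m -> 'rV[R]_m).
Local Notation mu := (@lebesgue_measure R).
Implicit Types (F : 'rV[R]_m -> R) (x y : 'rV[R]_m).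

Lemma ball_segment x t : `|x - a| < r -> `|t| <= 1 -> B (a + t *: (x - a)).
Proof.
move=> xr t1; rewrite -ball_normE /ball_ /= opprD addNKr normrN normrZ.
by rewrite (le_lt_trans _ xr) // ler_piMl.
Qed.

Lemma ballP x : B x <-> `|x - a| < r.
Proof. by rewrite -ball_normE /ball_ /= distrC. Qed.

Lemma openB : open B. Proof. exact: ball_open. Qed.

Lemma smooth_on_bounded F rho : rho < r -> smooth_on B F ->
  exists2 C : R, 0 < C & forall y, `|y - a| <= rho -> `|F y| <= C.
Proof.
move=> rr sF.
have [rho0|rho0] := ltP rho 0.
  by exists 1 => // y; rewrite leNgt (lt_le_trans rho0).
pose K := [set y : 'rV[R]_m | `|y - a| <= rho].
have KB : K `<=` B by move=> y /= yr; apply/ballP; exact: le_lt_trans yr rr.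
have cK : compact K.
  apply: bounded_closed_compact.
    exists (rho + `|a|); split; first exact: num_real.
    move=> M hM y /= yr; rewrite (le_trans _ (ltW hM)) //.
    by rewrite -(subrK a y) (le_trans (ler_normD _ _)) // lerD2r.
  rewrite (_ : K = closed_ball_ (@Num.Def.normr R _) a rho); first exact: closed_closed_ball_.
  by apply/seteqP; split=> y; rewrite /closed_ball_ /K /= distrC.
have [||c cK' H] := @EVT_max_rV R m (fun y => `|F y|) K _ cK.
- by exists a; rewrite /K /= subrr normr0.
- apply: continuous_in_subspaceT => y /set_mem /KB By.
  by apply: continuous_comp; [exact: smooth_on_continuous sF By|exact: norm_continuous].
exists (`|F c| + 1); first by rewrite ltr_wpDl.
by move=> y yr; rewrite (le_trans (H y _)) ?lerDl //; exact/mem_set.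
Qed.

Lemma smooth_derive_sum F x v : smooth_on B F -> B x ->
  differentiable F x /\ 'D_v F x = \sum_i v ord0 i * 'D_(e_ i) F x.
Proof.
move=> sF Bx; have dF : differentiable F x by exact: C1_differentiable openB (sF 1%N) Bx.
split=> //; rewrite (deriveE _ dF) linear_sum_coord.
by apply: eq_bigr => i _; rewrite (deriveE _ dF).
Qed.

(** The partial derivatives are bounded on a smaller closed ball, and balls are
    convex, so that the mean value theorem applies on segments. *)
Lemma smooth_on_lipschitz F rho : rho < r -> smooth_on B F ->
  exists2 C : R, 0 < C & forall x y, `|x - a| <= rho -> `|y - a| <= rho ->
    `|F y - F x| <= C * `|y - x|.
Proof.
move=> rr sF.
have H i : exists C : R, 0 < C /\ forall y, `|y - a| <= rho -> `|'D_(e_ i) F y| <= C.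
  by have [C C0 HC] := smooth_on_bounded rr (smooth_on_derive i sF); exists C.
have /choice [C HC] := H.
exists (\sum_i C i + 1).
  by rewrite ltr_wpDl // sumr_ge0 // => i _; rewrite ltW //; have [] := HC i.
move=> x y xr yr.
have seg (s : R) : 0 <= s <= 1 -> `|x + s *: (y - x) - a| <= rho.
  move=> /andP[s0 s1].
  have -> : x + s *: (y - x) - a = (1 - s) *: (x - a) + s *: (y - a).
    by apply/rowP => i; rewrite !mxE; ring.
  rewrite (le_trans (ler_normD _ _)) // !normrZ (ger0_norm s0) ger0_norm ?subr_ge0 //.
  rewrite (_ : rho = (1 - s) * rho + s * rho); last by ring.
  by rewrite lerD // ler_wpM2l ?subr_ge0.
have segB (s : R) : 0 <= s <= 1 -> B (x + s *: (y - x)).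
  by move=> /seg h; apply/ballP; exact: le_lt_trans h rr.
have D (s : R) : 0 <= s <= 1 ->
    is_derive s (1 : R) (fun t : R => F (x + t *: (y - x))) ('D_(y - x) F (x + s *: (y - x))).
  move=> /segB h; apply: derive_along; apply: diff_derivable.
  by have [] := smooth_derive_sum (y - x) sF h.
have [||s] := @MVT_segment R (fun t => F (x + t *: (y - x)))
    (fun s => 'D_(y - x) F (x + s *: (y - x))) 0 1 ler01.
- by move=> s /itvP sI; apply: D; rewrite !sI.
- apply: continuous_in_subspaceT => s /set_mem /= /itvP sI.
  apply: differentiable_continuous; apply/derivable1_diffP.
  by have [] := D s; rewrite ?sI.
move=> /itvP sI; rewrite scale1r scale0r addr0 subr0 mulr1 (addrC x) subrK => ->.
have [|_ ->] := @smooth_derive_sum F (x + s *: (y - x)) (y - x) sF.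
  by apply: segB; rewrite !sI.
rewrite (le_trans (ler_norm_sum _ _ _)) // mulrDl mul1r ler_wpDr // mulr_suml.
apply: ler_sum => i _; rewrite normrM mulrC ler_pM //; last exact: mx_norm_coord.
by have [_] := HC i; apply; apply: seg; rewrite !sI.
Qed.

Lemma eq_on_ball_of_derive0 F : smooth_on B F ->
  (forall i x, B x -> 'D_(e_ i) F x = 0) -> forall x, B x -> F x = F a.
Proof.
move=> sF D0 x /ballP xr.
have dF (s : R) : `|s| <= `|1 : R| -> derivable F (a + s *: (x - a)) (x - a).
  rewrite normr1 => s1; apply: diff_derivable.
  by have [] := smooth_derive_sum (x - a) sF (ball_segment xr s1).
have [s s1] := mean_value_along dF; rewrite normr1 in s1.
rewrite scale1r (addrC a) subrK mul1r => E; apply/eqP; rewrite -subr_eq0 E; apply/eqP.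
have [_ ->] := smooth_derive_sum (x - a) sF (ball_segment xr s1).
by apply: big1 => i _; rewrite D0 ?mulr0 //; exact: ball_segment.
Qed.

(** The case j = 0 gives the coefficients in Hadamard's lemma; the weights t ^ j
    appear when these are differentiated under the integral sign. *)
Definition radial_mean j F x : R :=
  \int[mu]_(t in `[0%R, 1%R]) (t ^+ j * F (a + t *: (x - a)))%R.

Lemma radial_continuous F j x (t : R) : smooth_on B F -> B x ->
  t \in `[0%R, 1%R] ->
  {for t, continuous (fun t : R => t ^+ j * F (a + t *: (x - a)))}.
Proof.
move=> sF /ballP xr /itvP tI.
apply: (@continuousM R _ (fun t : R => t ^+ j) (fun t : R => F (a + t *: (x - a)))).
  exact: exprn_continuous.
have Bt : B (a + t *: (x - a)).
  by apply: ball_segment xr _; rewrite ger0_norm ?tI.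
apply: differentiable_continuous; apply/derivable1_diffP.
have d : derivable F (a + t *: (x - a)) (x - a).
  by apply: diff_derivable; have [] := smooth_derive_sum 0 sF Bt.
by case: (derive_along d).
Qed.

Lemma radial_within F j x : smooth_on B F -> B x ->
  {within `[0%R, 1%R], continuous (fun t : R => t ^+ j * F (a + t *: (x - a)))}.
Proof.
move=> sF Bx; apply: continuous_in_subspaceT => t /set_mem tI.
exact: radial_continuous.
Qed.

Lemma radial_integrable F j x : smooth_on B F -> B x ->
  mu.-integrable `[0%R, 1%R] (EFin \o (fun t : R => t ^+ j * F (a + t *: (x - a)))).
Proof.
move=> sF Bx; apply: continuous_compact_integrable; first exact: segment_compact.
exact: radial_within.
Qed.

Lemma norm_delta_le1 (i : 'I_m) : `|e_ i| <= 1.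
Proof.
rewrite [leLHS]mx_normrE; apply/bigmax_leP; split=> // -[i' k] _ /=.
by rewrite mxE; case: andP => _; rewrite ?normr1 ?normr0.
Qed.

(** Differentiation under the integral sign; the derivative in x of
    F (a + t (x - a)) brings out one factor t. *)
Lemma radial_mean_is_derive F j x i : smooth_on B F -> B x ->
  is_derive x (e_ i) (radial_mean j F) (radial_mean j.+1 ('D_(e_ i) F) x).
Proof.
move=> sF Bx; have /ballP xr := Bx.
pose d := (r - `|x - a|) / 2; have d0 : 0 < d by rewrite divr_gt0 // subr_gt0.
have rr : `|x - a| + d < r by rewrite /d; lra.
have near_x (s : R) : s \in `]- d, d[ -> `|x + s *: e_ i - a| <= `|x - a| + d.
  rewrite in_itv /= => sd; rewrite addrAC (le_trans (ler_normD _ _)) // lerD2l.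
  rewrite normrZ (le_trans (ler_piMr _ (norm_delta_le1 i))) //.
  by rewrite ltW // ltr_norml.
have B_near (s : R) : s \in `]- d, d[ -> B (x + s *: e_ i).
  by move=> /near_x h; apply/ballP; exact: le_lt_trans h rr.
pose f (s t : R) := t ^+ j * F (a + t *: (x + s *: e_ i - a)).
have Df (s t : R) : s \in `]- d, d[ -> t \in `[0%R, 1%R] ->
    is_derive s (1 : R) (f ^~ t)
      (t ^+ j.+1 * 'D_(e_ i) F (a + t *: (x + s *: e_ i - a))).
  move=> sd tI; pose y := a + t *: (x - a).
  have Ey (s' : R) : a + t *: (x + s' *: e_ i - a) = y + (t * s') *: e_ i.
    by apply/rowP => k; rewrite !mxE; ring.
  have Bt : B (y + (t * s) *: e_ i).
    rewrite -Ey; apply: ball_segment.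
      by apply: le_lt_trans rr; exact: near_x.
    by rewrite ger0_norm ?(itvP tI).
  have d1 : is_derive (t * s) (1 : R) (fun u : R => F (y + u *: e_ i))
      ('D_(e_ i) F (y + (t * s) *: e_ i)).
    by apply: derive_along; exact: smooth_on_derivable sF Bt.
  have d2 : is_derive s (1 : R) (fun s' : R => t * s') t.
    have := is_deriveZ t (is_derive_id s (1 : R)).
    by rewrite /GRing.scale /= mulr1.
  have d3 := is_derive1_comp d1 d2.
  have := is_deriveZ (t ^+ j) d3.
  rewrite (_ : _ \*: _ = f ^~ t); last first.
    by apply/funext => s' /=; rewrite /f Ey.
  rewrite -Ey [t ^+ j *: _](_ : _ = t ^+ j.+1 *
    'D_(e_ i) F (a + t *: (x + s *: e_ i - a))) //.
  by rewrite /GRing.scale /= exprS; ring.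
have d1E (s t : R) : s \in `]- d, d[ -> t \in `[0%R, 1%R] ->
    partial1of2 f s t = t ^+ j.+1 * 'D_(e_ i) F (a + t *: (x + s *: e_ i - a)).
  by move=> sd tI; rewrite partial1of2E; case: (Df s t sd tI).
have [C C0 HC] := smooth_on_bounded rr (smooth_on_derive i sF).
have I0 : (0 : R) \in `]- d, d[ by rewrite in_itv /= oppr_lt0 d0.
have i_f (s : R) : `]- d, d[%classic s -> mu.-integrable `[0%R, 1%R] (EFin \o f s).
  by move=> sd; apply: radial_integrable => //; exact: B_near.
have d_f (s t : R) : `]- d, d[%classic s -> `[0%R, 1%R]%classic t -> derivable (f ^~ t) s 1.
  by move=> sd tI; case: (Df s t sd tI).
have i_C : mu.-integrable `[0%R, 1%R] (EFin \o (fun=> C)).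
  apply: continuous_compact_integrable; first exact: segment_compact.
  by apply: continuous_subspaceT => t; exact: cst_continuous.
have G_ub (s t : R) : `]- d, d[%classic s -> `[0%R, 1%R]%classic t -> `|partial1of2 f s t| <= C.
  move=> sd /= tI; rewrite d1E // normrM -[C]mul1r ler_pM //.
    by rewrite ger0_norm ?exprn_ge0 ?exprn_ile1 ?(itvP tI).
  apply: HC; rewrite addrC addKr normrZ (le_trans _ (near_x _ sd)) //.
  by rewrite ler_piMl // ger0_norm ?(itvP tI).
have mI : measurable (`[0%R, 1%R] : set R) by exact: measurable_itv.
have C0' (t : R) : 0 <= C by exact: ltW.
have der := @derivable_under_integral R _ _ mu f _ mI 0 (- d) d I0 i_f d_f
  (fun=> C) C0' i_C G_ub.
have dif := @differentiation_under_integral R _ _ mu f _ mI 0 (- d) d I0 i_f d_f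
  (fun=> C) C0' i_C G_ub.
have E : (fun s : R => \int[mu]_(t in `[0%R, 1%R]) f s t) =
    (fun s : R => radial_mean j F (x + s *: e_ i)) by [].
rewrite E in der dif.
have dR : derivable (radial_mean j F) x (e_ i).
  apply/derivable1P; move: der.
  by under [X in derivable X _ _ -> _]eq_fun do rewrite addrC.
split=> //.
have := @derive_along R _ R (radial_mean j F) x (e_ i) 0.
rewrite scale0r addr0 => /(_ dR)[_ <-]; rewrite -derive1E dif.
apply: eq_Rintegral => t /set_mem /= tI.
by rewrite d1E // scale0r addr0.
Qed.

Lemma radial_mean_continuous F j x : smooth_on B F -> B x ->
  {for x, continuous (radial_mean j F)}.
Proof.
move=> sF Bx; have /ballP xr := Bx.
pose rho := (r + `|x - a|) / 2; have rr : rho < r by rewrite /rho; lra.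
have xrho : `|x - a| < rho by rewrite /rho; lra.
have [C C0 HC] := smooth_on_lipschitz rr sF.
apply: (lipschitz_at_continuous C0).
apply: filterS (near_norm_lt xrho) => y /ltW yr.
have By : B y by apply/ballP; exact: le_lt_trans yr rr.
have mI : measurable (`[0%R, 1%R] : set R) by exact: measurable_itv.
have Ix := radial_integrable j sF Bx; have Iy := radial_integrable j sF By.
rewrite /radial_mean -RintegralB //.
have cB : {within `[0%R, 1%R], continuous (fun t : R =>
    t ^+ j * F (a + t *: (x - a)) - t ^+ j * F (a + t *: (y - a)))}.
  apply: continuous_in_subspaceT => t /set_mem tI.
  have cx := radial_continuous (t := t) (j := j) sF Bx tI.
  have cy := radial_continuous (t := t) (j := j) sF By tI.
  exact: (continuousB cx cy).
have IB : mu.-integrable `[0%R, 1%R] (EFin \o (fun t : R =>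
    t ^+ j * F (a + t *: (x - a)) - t ^+ j * F (a + t *: (y - a)))).
  by apply: continuous_compact_integrable cB; exact: segment_compact.
rewrite (le_trans (le_normr_Rintegral _ _)) //.
apply: (@le_trans _ _ (\int[mu]_(t in `[0%R, 1%R]) (C * `|x - y|))); last first.
  by rewrite Rintegral01_cst.
apply: le_Rintegral => //.
- exact: integrable_norm.
- apply: continuous_compact_integrable; first exact: segment_compact.
  by apply: continuous_subspaceT => t; exact: cst_continuous.
move=> t /= tI; rewrite -mulrBr normrM.
have t1 : `|t| <= 1 by rewrite ger0_norm ?(itvP tI).
rewrite (le_trans (ler_piMl _ _)) //.
  by rewrite normrX exprn_ile1.
have seg z : `|z - a| <= rho -> `|a + t *: (z - a) - a| <= rho.
  by move=> zr; rewrite addrC addKr normrZ (le_trans _ zr) // ler_piMl.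
rewrite (le_trans (HC _ _ (seg _ yr) (seg _ (ltW xrho)))) // (ler_wpM2l (ltW C0)) //.
have -> : a + t *: (x - a) - (a + t *: (y - a)) = t *: (x - y).
  by apply/rowP => k; rewrite !mxE; ring.
by rewrite normrZ ler_piMl.
Qed.

Lemma smooth_on_radial_mean F j : smooth_on B F -> smooth_on B (radial_mean j F).
Proof.
move=> sF k; elim: k j F sF => [|k IH] j F sF.
  by split=> // x Bx; exact: radial_mean_continuous.
split; first by move=> x Bx; exact: radial_mean_continuous.
move=> i; split.
  by move=> x Bx; case: (radial_mean_is_derive j i sF Bx).
apply: Ck_on_congr (IH j.+1 _ (smooth_on_derive i sF)); first exact: openB.
by move=> x Bx; case: (radial_mean_is_derive j i sF Bx).
Qed.

(** Integration over [0, 1] of the derivative of t |-> F (a + t (x - a)). *)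
Lemma hadamard F : 0 < r -> smooth_on B F -> exists G : 'I_m -> 'rV[R]_m -> R,
  [/\ forall i, smooth_on B (G i), forall i, G i a = 'D_(e_ i) F a &
      forall x, B x -> F x - F a = \sum_i (x - a) ord0 i * G i x].
Proof.
move=> r0 sF; exists (fun i => radial_mean 0 ('D_(e_ i) F)).
have Ba : B a by exact: ballxx.
have mI : measurable (`[0%R, 1%R] : set R) by exact: measurable_itv.
split=> [i|i|x Bx]; first exact/smooth_on_radial_mean/smooth_on_derive.
  rewrite /radial_mean; under eq_Rintegral do
    rewrite expr0 mul1r subrr scaler0 addr0.
  by rewrite Rintegral01_cst.
have /ballP xr := Bx.
pose c (t : R) := F (a + t *: (x - a)).
have Bt (t : R) : t \in `[0%R, 1%R] -> B (a + t *: (x - a)).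
  by move=> tI; apply: ball_segment xr _; rewrite ger0_norm ?(itvP tI).
have dc (t : R) : t \in `[0%R, 1%R] ->
    is_derive t (1 : R) c (\sum_i (x - a) ord0 i * 'D_(e_ i) F (a + t *: (x - a))).
  move=> tI; have [dF <-] := smooth_derive_sum (x - a) sF (Bt t tI).
  by apply: derive_along; exact: diff_derivable.
have cc (t : R) : t \in `[0%R, 1%R] -> {for t, continuous c}.
  move=> tI; apply: differentiable_continuous; apply/derivable1_diffP.
  by case: (dc t tI).
have cD : {within `[0%R, 1%R], continuous (fun t : R => \sum_i (x - a) ord0 i *
    (t ^+ 0 * 'D_(e_ i) F (a + t *: (x - a))))}.
  apply: continuous_in_subspaceT => t /set_mem tI.
  apply: continuous_at_sum => i.
  apply: (@continuousM R _ (fun=> (x - a) ord0 i)); first exact: cst_continuous.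
  exact: (radial_continuous (t := t) (j := 0) (smooth_on_derive i sF) Bx tI).
have LR : derivable_oo_LRcontinuous c 0 1.
  split.
  - by move=> t /subset_itv_oo_cc tI; case: (dc t tI).
  - by apply: cvg_at_right_filter; apply: cc; rewrite in_itv /= lexx ler01.
  - by apply: cvg_at_left_filter; apply: cc; rewrite in_itv /= lexx ler01.
have := continuous_FTC2 ltr01 cD LR.
have -> : c 1 = F x by rewrite /c scale1r (addrC a) subrK.
have -> : c 0 = F a by rewrite /c scale0r addr0.
move=> E; have {}E := congr1 fine (E _).
rewrite -EFinB /= in E; rewrite -E; last first.
  move=> t /subset_itv_oo_cc tI; rewrite derive1E; case: (dc t tI) => _ ->.
  by apply: eq_bigr => i _; rewrite expr0 mul1r.
apply: Rintegral01_sum => i t tI.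
exact: (radial_continuous (t := t) (j := 0) (smooth_on_derive i sF) Bx tI).
Qed.

End Hadamard.

(** * Smooth functions on a manifold *)

Section Germs.
Context {R : realType} {m : nat} (M : manifold R m).
Local Notation C := (Cinf M).
Implicit Types (f g : C) (p q : M).
Local Notation e_ := (delta_mx ord0 : 'I_m -> 'rV[R]_m).

Lemma cinfP f : is_smooth f.
Proof. by case: f => f /= /set_mem. Qed.

Definition mkcinf (f : M -> R) (sf : is_smooth f) : C := SmoothFun (mem_set sf).

Lemma cinfD f g p : (f + g) p = f p + g p. Proof. by []. Qed.
Lemma cinfB f g p : (f - g) p = f p - g p. Proof. by []. Qed.
Lemma cinfN f p : (- f) p = - f p. Proof. by []. Qed.
Lemma cinfM f g p : (f * g) p = f p * g p. Proof. by []. Qed.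
Lemma cinf1 p : (1 : C) p = 1. Proof. by []. Qed.
Lemma cinf0 p : (0 : C) p = 0. Proof. by []. Qed.
Lemma csmE a p : csm M a p = a. Proof. by []. Qed.
Lemma cinf_sum (I : Type) (s : seq I) (F : I -> C) p :
  (\sum_(i <- s) F i) p = \sum_(i <- s) F i p.
Proof. by elim/big_rec2: _ => // i x y _ <-. Qed.

Lemma cinf_eq f g : (forall p, f p = g p) -> f = g.
Proof. by move=> fg; apply/val_inj/funext. Qed.

Lemma open_preimage_on (S T : topologicalType) (U : set S) (f : S -> T) (O : set T) :
  open U -> (forall x, U x -> {for x, continuous f}) -> open O ->
  open (U `&` f @^-1` O).
Proof.
move=> oU cf oO; rewrite openE => x [Ux Ox]; rewrite /interior.
apply: filterI; first exact: open_nbhs_nbhs.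
by apply: cf => //; exact: open_nbhs_nbhs.
Qed.

Lemma chart_codP (c : chart R m M) x : chart_cod c x ->
  chart_dom c (chart_inv c x) /\ chart_fun c (chart_inv c x) = x.
Proof. by case=> p pc <-; rewrite (chart_funK pc). Qed.

Lemma chart_funE (c : chart R m M) p : chart_dom c p -> chart_cod c (chart_fun c p).
Proof. by move=> pc; exists p. Qed.

(** The same neighbourhood of p serves all charts; this makes smoothness a local
    property that can be glued. *)
Definition smooth_near (f : M -> R) (p : M) := exists2 O : set M, open_nbhs p O &
  forall c, atlas c ->
    smooth_on (chart_cod c `&` chart_inv c @^-1` O) (f \o chart_inv c).

Lemma open_chart_set (c : chart R m M) (O : set M) : open O ->
  open (chart_cod c `&` chart_inv c @^-1` O).
Proof.
move=> oO; apply: open_preimage_on => //; first exact: open_chart_cod.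
exact: continuous_chart_inv.
Qed.

Lemma is_smooth_near (f : M -> R) : (forall p, smooth_near f p) -> is_smooth f.
Proof.
move=> sf c ac; apply: smooth_on_local => x cx.
have [ O [oO Ox] /(_ c ac) sO] := sf (chart_inv c x).
by exists (chart_cod c `&` chart_inv c @^-1` O).
Qed.

Lemma smooth_near_cinf (f : M -> R) p (O : set M) g :
  open_nbhs p O -> (forall q, O q -> f q = g q) -> smooth_near f p.
Proof.
move=> [oO Op] fg; exists O => // c ac.
apply: (@smooth_on_congr _ _ _ _ (g \o chart_inv c)).
- exact: open_chart_set.
- by move=> x [_ Ox]; rewrite /= fg.
- by apply: smooth_on_sub (cinfP g ac) => x [].
Qed.

(** By the compatibility of the atlas, smoothness in one chart around p suffices. *)
Lemma smooth_near_chart (f : M -> R) p c (W : set 'rV[R]_m) (F : 'rV[R]_m -> R) :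
  atlas c -> chart_dom c p -> open W -> W (chart_fun c p) -> smooth_on W F ->
  (forall q, chart_dom c q -> W (chart_fun c q) -> f q = F (chart_fun c q)) ->
  smooth_near f p.
Proof.
move=> ac pc oW Wp sF fF; pose O := chart_dom c `&` chart_fun c @^-1` W.
have oO : open O.
  apply: open_preimage_on => //; first exact: open_chart_dom.
  exact: continuous_chart_fun.
exists O => // c' ac'; have openV := open_chart_set (c := c') oO.
apply: (@smooth_on_congr _ _ _ _ (F \o (chart_fun c \o chart_inv c'))) => //.
  by move=> x [_ [cx Wx]]; rewrite /= fF.
apply: (smooth_on_comp openV oW) => // [x [_ []] //|].
apply: smooth_on_sub (atlas_compatible ac' ac) => x [/chart_codP[c'x E] [cx Wx]].
by exists (chart_inv c' x).
Qed.

Lemma cinf_continuous f : continuous f.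
Proof.
move=> p; have [c ac pc] := atlas_cover p.
have cp := chart_funE pc.
have cf : {for p, continuous ((f \o chart_inv c) \o chart_fun c)}.
  apply: continuous_comp; first exact: continuous_chart_fun.
  exact: smooth_on_continuous (cinfP f ac) cp.
have E : \forall q \near p, ((f \o chart_inv c) \o chart_fun c) q = f q.
  have : nbhs p (chart_dom c).
    by apply: open_nbhs_nbhs; split=> //; exact: open_chart_dom.
  by apply: filterS => q qc; rewrite /= (chart_funK qc).
rewrite /continuous_at -[X in _ --> X](nbhs_singleton E).
exact: cvg_trans (near_eq_cvg E) cf.
Qed.

Lemma cinf_comp_flat f : is_smooth (flat 0 \o f).
Proof.
move=> c ac k; apply: (@Ck_on_flat R m k 0 (chart_cod c) (f \o chart_inv c)).
  exact: open_chart_cod.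
exact: cinfP.
Qed.

Lemma cinf_inv f : (forall p, f p != 0) -> is_smooth (fun p => (f p)^-1).
Proof.
move=> f0 c ac k; apply: (@Ck_onV R m k (chart_cod c) (f \o chart_inv c)).
- exact: open_chart_cod.
- by move=> x _; exact: f0.
- exact: cinfP.
Qed.

(** A flat function of f(p)^2/2 - f^2 is added to f^2: it is positive where f
    may vanish and zero near p. The sum is therefore invertible, and its
    inverse times f inverts f near p. *)
Lemma inverse_near f p : f p != 0 ->
  exists e : C, exists2 O : set M, open_nbhs p O & forall q, O q -> e q * f q = 1.
Proof.
move=> fp; have f2 : 0 < f p ^+ 2 by rewrite exprn_even_gt0.
pose b := mkcinf (cinf_comp_flat (csm M (f p ^+ 2 / 2) - f * f)).
have bE q : b q = flat 0 (f p ^+ 2 / 2 - f q * f q) by [].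
pose d := f * f + b.
have d0 q : d q != 0.
  rewrite gt_eqF // cinfD cinfM bE -expr2.
  have [fq|fq] := ltP (f q ^+ 2) (f p ^+ 2 / 2).
    by rewrite ltr_wpDl ?sqr_ge0 // flat_gt0 // subr_gt0.
  by rewrite ltr_pwDl ?flat_ge0 // (lt_le_trans _ fq) // divr_gt0.
pose i := mkcinf (cinf_inv d0); have iE q : i q = (d q)^-1 by [].
exists (f * i).
exists [set q | f p ^+ 2 / 2 < f q ^+ 2].
  split; last by rewrite /= ltr_pdivrMr // ltr_pMr // ltr1n.
  have : continuous (fun q => f q * f q).
    by move=> q; apply: continuousM; exact: cinf_continuous.
  move/continuousP => /(_ [set x | f p ^+ 2 / 2 < x]).
  by rewrite /preimage /=; apply; exact: open_gt.
move=> q fq; rewrite /= in fq; rewrite cinfM iE mulrAC.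
suff -> : d q = f q * f q by rewrite mulfV // -expr2 gt_eqF // (lt_trans _ fq) // divr_gt0.
by rewrite cinfD cinfM bE flat_le0 ?addr0 // -expr2 subr_le0 ltW.
Qed.

End Germs.

(** * Extension of local functions and coordinates of tangent vectors *)

Section Extension.
Context {R : realType} {m : nat}.
Local Notation e_ := (delta_mx ord0 : 'I_m -> 'rV[R]_m).

Definition bump (a : 'rV[R]_m) (s : R) (x : 'rV[R]_m) : R :=
  flat 0 (s ^+ 2 - \sum_i (x ord0 i - a ord0 i) ^+ 2).

Lemma smooth_on_bump a s (U : set 'rV[R]_m) : open U -> smooth_on U (bump a s).
Proof.
move=> oU k; apply: (@Ck_on_flat R m k 0 U (fun x =>
  s ^+ 2 - \sum_i (x ord0 i - a ord0 i) ^+ 2)) => //.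
apply: Ck_onB => //; first exact: Ck_on_cst.
apply: Ck_on_sum => // i.
have Ci : Ck_on k U (fun x : 'rV[R]_m => x ord0 i - a ord0 i).
  by apply: Ck_onB => //; [exact: smooth_on_proj | exact: Ck_on_cst].
by apply: Ck_on_congr (Ck_onM oU Ci Ci) => // x _; rewrite expr2.
Qed.

Lemma bump_gt0 a s : 0 < s -> 0 < bump a s a.
Proof.
move=> s0; rewrite flat_gt0 // big1 ?subr0 ?exprn_gt0 // => i _.
by rewrite subrr expr0n.
Qed.

(** The norm of a row vector is the supremum norm, which is at most the Euclidean
    distance that defines the bump. *)
Lemma bump_eq0 a s x : 0 < s -> s <= `|x - a| -> bump a s x = 0.
Proof.
move=> s0 sx; rewrite /bump; have [le|lt] := leP (s ^+ 2) (\sum_i (x ord0 i - a ord0 i) ^+ 2).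
  by rewrite flat_le0 // subr_le0.
suff : `|x - a| < s by rewrite ltNge sx.
rewrite [ltLHS]mx_normrE; apply/bigmax_ltP; split=> // -[i' i] _ /=.
rewrite ord1 !mxE ltNge; apply/negP => sy.
have : s ^+ 2 <= (x ord0 i - a ord0 i) ^+ 2.
  rewrite -[leRHS]real_normK ?num_real // lerXn2r ?nnegrE ?normr_ge0 //.
  exact: ltW.
rewrite leNgt => /negP; apply.
apply: le_lt_trans lt; rewrite (bigD1 i) //= lerDl sumr_ge0 // => j _.
exact: sqr_ge0.
Qed.

Context (M : manifold R m).
Local Notation C := (Cinf M).

(** Functions and vector fields are global objects here, so that an expression in
    coordinates must be cut off before it defines one. *)
Definition chart_ext (c : chart R m M) (a : 'rV[R]_m) (s : R)
    (F : 'rV[R]_m -> R) (q : M) : R :=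
  if pselect (chart_dom c q) then bump a s (chart_fun c q) * F (chart_fun c q)
  else 0.

Lemma chart_extE c a s F q : chart_dom c q ->
  chart_ext c a s F q = bump a s (chart_fun c q) * F (chart_fun c q).
Proof. by rewrite /chart_ext; case: pselect. Qed.

Lemma chart_ext_out c a s F q : ~ chart_dom c q -> chart_ext c a s F q = 0.
Proof. by rewrite /chart_ext; case: pselect. Qed.

(** The support lies in the image of a compact ball, which is closed because M is
    Hausdorff; hence every point has a neighbourhood inside the chart or one on
    which the extension vanishes. *)
Lemma chart_ext_smooth c a r F : atlas c -> 0 < r -> ball a r `<=` chart_cod c ->
  smooth_on (ball a r) F -> is_smooth (chart_ext c a (r / 2) F).
Proof.
move=> ac r0 Bc sF; apply: is_smooth_near => p.
have r20 : 0 < r / 2 by rewrite divr_gt0.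
have r2r : r / 2 < r by rewrite ltr_pdivrMr // ltr_pMr // ltr1n.
have oB : open (ball a r) by exact: ball_open.
pose K := closed_ball_ (@Num.Def.normr R _) a (r / 2).
have KB : K `<=` ball a r.
  by move=> x; rewrite -ball_normE /K /closed_ball_ /ball_ /= => /le_lt_trans; apply.
have cK : compact K.
  apply: bounded_closed_compact; last exact: closed_closed_ball_.
  exists (r + `|a|); split; first exact: num_real.
  move=> N hN x /KB; rewrite -ball_normE /ball_ /= => xr.
  rewrite (le_trans _ (ltW hN)) // -(subrK a x) (le_trans (ler_normD _ _)) //.
  by rewrite lerD2r distrC ltW.
have cIK : compact (chart_inv c @` K).
  apply: continuous_compact cK; apply: continuous_in_subspaceT => x /set_mem /KB /Bc.
  exact: continuous_chart_inv.
have clK : closed (chart_inv c @` K).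
  by apply: compact_closed cIK; exact: manifold_hausdorff.
have [pB|pB] := pselect (chart_dom c p /\ ball a r (chart_fun c p)).
  apply: (@smooth_near_chart _ _ _ _ p c (ball a r) (bump a (r / 2) \* F)) => //.
  - by case: pB.
  - by case: pB.
  - by apply: smooth_onM => //; exact: smooth_on_bump.
  - by move=> q cq _; rewrite chart_extE.
apply: (@smooth_near_cinf _ _ _ _ p (~` (chart_inv c @` K)) 0).
  split; first exact: closed_openC.
  move=> [x Kx xp]; apply: pB; rewrite -xp.
  by have [cx ->] := chart_codP (Bc _ (KB _ Kx)); split=> //; exact: KB.
move=> q qK; have [cq|cq] := pselect (chart_dom c q); last by rewrite chart_ext_out.
rewrite chart_extE // bump_eq0 ?mul0r // leNgt; apply/negP => h; apply: qK.
exists (chart_fun c q); last exact: chart_funK.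
by rewrite /K /closed_ball_ /= distrC ltW.
Qed.

Lemma chart_ball (c : chart R m M) p : chart_dom c p ->
  exists2 r, 0 < r & ball (chart_fun c p) r `<=` chart_cod c.
Proof.
move=> pc; have : nbhs (chart_fun c p) (chart_cod c).
  apply: open_nbhs_nbhs; split; first exact: open_chart_cod.
  exact: chart_funE.
by move=> /nbhs_ballP [r /= r0 H]; exists r.
Qed.

Lemma tangentP (p : M) (v : tangent p) :
  (forall a (f g : C), v (csm M a * f + g) = a * v f + v g) /\
  (forall f g : C, v (f * g) = f p * v g + g p * v f).
Proof. by case: v => v /= /set_mem. Qed.

Lemma tangentD (p : M) (v : tangent p) (f g : C) : v (f + g) = v f + v g.
Proof.
have [/(_ 1 f g) + _] := tangentP v.
by rewrite mul1r (_ : csm M 1 = 1) ?mul1r //; exact/val_inj.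
Qed.

Lemma tangentM (p : M) (v : tangent p) (f g : C) : v (f * g) = f p * v g + g p * v f.
Proof. by have [_] := tangentP v; apply. Qed.

Lemma tangent0 (p : M) (v : tangent p) : v 0 = 0.
Proof. by apply: (addrI (v 0)); rewrite -tangentD !addr0. Qed.

Lemma tangentN (p : M) (v : tangent p) (f : C) : v (- f) = - v f.
Proof. by apply: (addrI (v f)); rewrite -tangentD !subrr tangent0. Qed.

Lemma tangent_sum (p : M) (v : tangent p) (I : Type) (s : seq I) (F : I -> C) :
  v (\sum_(i <- s) F i) = \sum_(i <- s) v (F i).
Proof.
elim: s => [|i s IH]; first by rewrite !big_nil tangent0.
by rewrite !big_cons tangentD IH.
Qed.

Lemma tangent_csm (p : M) (v : tangent p) a : v (csm M a) = 0.
Proof.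
have v1 : v 1 = 0.
  have := tangentM v 1 1; rewrite mulr1 cinf1 mul1r => /eqP.
  by rewrite -subr_eq subrr => /eqP.
have [/(_ a 1 0) + _] := tangentP v.
by rewrite mulr1 addr0 tangent0 v1 mulr0 addr0.
Qed.

(** By Hadamard's lemma f - f(p) is, near p, a combination of the coordinates
    x_i - p_i with coefficients G_i taking the values of the partial derivatives
    at p; a derivation at p only sees the first factors. The identity is multiplied
    by bumps to make it global. *)
Lemma tangent_coordinates c (p : M) (v : tangent p) : atlas c -> chart_dom c p ->
  exists w : 'I_m -> R, forall f : C,
    v f = \sum_i w i * 'D_(e_ i) (f \o chart_inv c) (chart_fun c p).
Proof.
move=> ac pc; have [r r0 Bc] := chart_ball pc; set a := chart_fun c p in Bc *.
have oB : open (ball a r) by exact: ball_open.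
have Ba : ball a r a by exact: ballxx.
pose E F (sF : smooth_on (ball a r) F) := mkcinf (chart_ext_smooth ac r0 Bc sF).
have EE F sF q : E F sF q = chart_ext c a (r / 2) F q by [].
have s1 : smooth_on (ball a r) (fun _ : 'rV[R]_m => 1 : R) by exact: smooth_on_cst.
have sx i : smooth_on (ball a r) (fun x : 'rV[R]_m => x ord0 i - a ord0 i : R).
  by apply: smooth_onB => //; [exact: smooth_on_proj | exact: smooth_on_cst].
have b0 : bump a (r / 2) a != 0 by rewrite gt_eqF // bump_gt0 // divr_gt0.
exists (fun i => v (E _ (sx i)) / bump a (r / 2) a) => f.
have sf : smooth_on (ball a r) (f \o chart_inv c).
  exact: smooth_on_sub Bc (cinfP f ac).
have [G [sG Ga GE]] := hadamard r0 sf.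
have ext : E _ s1 * E _ s1 * (f - csm M (f p)) = \sum_i E _ (sx i) * E _ (sG i).
  apply: cinf_eq => q; rewrite cinf_sum !cinfM cinfB csmE EE.
  under eq_bigr do rewrite cinfM !EE.
  have [cq|cq] := pselect (chart_dom c q); last first.
    rewrite chart_ext_out // !mul0r big1 // => i _.
    by rewrite chart_ext_out // mul0r.
  rewrite chart_extE // mulr1.
  under eq_bigr do rewrite !chart_extE //.
  have [h|h] := ltP `|chart_fun c q - a| (r / 2); last first.
    rewrite bump_eq0 ?divr_gt0 // !mul0r big1 // => i _.
    by rewrite !mul0r.
  have Bq : ball a r (chart_fun c q).
    rewrite -ball_normE /ball_ /= distrC (lt_trans h) //.
    by rewrite ltr_pdivrMr // ltr_pMr // ltr1n.
  have := GE _ Bq; rewrite /= !chart_funK // => ->.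
  rewrite mulr_sumr; apply: eq_bigr => i _; rewrite !mxE; ring.
have := congr1 v ext; rewrite tangent_sum tangentM tangentD tangentN tangent_csm subr0.
rewrite cinfB csmE subrr mul0r addr0 cinfM EE !chart_extE // -/a mulr1 => vE.
apply: (mulfI (mulf_neq0 b0 b0)); rewrite vE mulr_sumr; apply: eq_bigr => i _.
rewrite tangentM !EE !chart_extE // -/a subrr mulr0 mul0r add0r Ga.
by rewrite mulrA; field.
Qed.

End Extension.

(** * Local frames *)

Section Frames.
Context {R : realType} {m : nat} (M : manifold R m).
Local Notation C := (Cinf M).
Local Notation VF := (vfield M).
Local Notation e_ := (delta_mx ord0 : 'I_m -> 'rV[R]_m).
Implicit Types (p q : M) (f : C) (V W : VF).

Lemma tangentE p (v w : tangent p) : (forall f, v f = w f) -> v = w.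
Proof. by move=> vw; apply/val_inj/funext. Qed.

Lemma tangent_addE p (v w : tangent p) f : (v + w) f = v f + w f. Proof. by []. Qed.
Lemma tangent_oppE p (v : tangent p) f : (- v) f = - v f. Proof. by []. Qed.
Lemma tangent_scaleE p a (v : tangent p) f : (a *: v) f = a * v f. Proof. by []. Qed.
Lemma tangent_sumE p (I : Type) (s : seq I) (F : I -> tangent p) f :
  (\sum_(i <- s) F i) f = \sum_(i <- s) F i f.
Proof. by elim/big_rec2: _ => // i x y _ <-. Qed.

Lemma vfieldE V W : (forall f, V f = W f) -> V = W.
Proof. by move=> vw; apply/val_inj/funext. Qed.

Lemma vf_addE V W f : (V + W) f = V f + W f. Proof. by []. Qed.
Lemma vf_oppE V f : (- V) f = - V f. Proof. by []. Qed.
Lemma vf_scaleE (a : C) V f : (a *: V) f = a * V f. Proof. by []. Qed.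
Lemma vf_zeroE f : (0 : VF) f = 0. Proof. by []. Qed.
Lemma lieE V W f : lie V W f = V (W f) - W (V f). Proof. by []. Qed.

Lemma at_pointE V p f : at_point V p f = V f p. Proof. by []. Qed.

Lemma at_pointD V W p : at_point (V + W) p = at_point V p + at_point W p.
Proof. exact/tangentE. Qed.
Lemma at_pointN V p : at_point (- V) p = - at_point V p.
Proof. exact/tangentE. Qed.
Lemma at_pointZ (a : C) V p : at_point (a *: V) p = a p *: at_point V p.
Proof. exact/tangentE. Qed.
Lemma at_point0 p : at_point (0 : VF) p = 0.
Proof. exact/tangentE. Qed.
Lemma at_point_sum (I : Type) (s : seq I) (F : I -> VF) p :
  at_point (\sum_(i <- s) F i) p = \sum_(i <- s) at_point (F i) p.
Proof.
elim: s => [|i s IH]; first by rewrite !big_nil at_point0.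
by rewrite !big_cons at_pointD IH.
Qed.

Lemma at_point_inj V W : (forall p, at_point V p = at_point W p) -> V = W.
Proof.
by move=> VW; apply: vfieldE => f; apply: cinf_eq => p; rewrite -at_pointE VW.
Qed.

Section Coordinates.
Context (c : chart R m M) (a : 'rV[R]_m) (r : R).
Context (ac : atlas c) (r0 : 0 < r) (Bc : ball a r `<=` chart_cod c).

Lemma smooth_partial f i : smooth_on (ball a r) ('D_(e_ i) (f \o chart_inv c)).
Proof. by apply/smooth_on_derive/(smooth_on_sub Bc); exact: cinfP. Qed.

Definition partial_fun i f : C :=
  mkcinf (chart_ext_smooth ac r0 Bc (smooth_partial f i)).

Lemma partial_funE i f q : chart_dom c q -> partial_fun i f q =
  bump a (r / 2) (chart_fun c q) * 'D_(e_ i) (f \o chart_inv c) (chart_fun c q).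
Proof. exact: chart_extE. Qed.

Lemma partial_fun_out i f q : ~ chart_dom c q -> partial_fun i f q = 0.
Proof. exact: chart_ext_out. Qed.

Lemma partial_subproof i : (partial_fun i : C -> C^o) \in @vfield_pred R m M.
Proof.
have dc f q : chart_dom c q -> derivable (f \o chart_inv c) (chart_fun c q) (e_ i).
  by move=> cq; apply: smooth_on_derivable (cinfP f ac) _; exact: chart_funE.
rewrite inE /=; split=> [b f g|f g]; apply: cinf_eq => q.
  rewrite cinfD cinfM csmE; have [cq|cq] := pselect (chart_dom c q); last first.
    by rewrite !partial_fun_out // mulr0 addr0.
  rewrite !partial_funE // (_ : (csm M b * f + g) \o chart_inv c =
    (b \*: (f \o chart_inv c)) + (g \o chart_inv c)) // deriveD; first last.
  - exact: dc.
  - by apply: derivableZ; exact: dc.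
  by rewrite deriveZ ?[_ *: 'D__ _ _]/(_ * _); [rewrite mulrDr mulrCA | exact: dc].
rewrite cinfD !cinfM; have [cq|cq] := pselect (chart_dom c q); last first.
  by rewrite !partial_fun_out // !mulr0 addr0.
rewrite !partial_funE // (_ : (f * g) \o chart_inv c =
  (f \o chart_inv c) * (g \o chart_inv c)) // deriveM; [|exact: dc|exact: dc].
rewrite /= !(chart_funK cq) /GRing.scale /=; ring.
Qed.

Definition partial_vf i : VF := VField (partial_subproof i).

Lemma partial_vfE i f q : chart_dom c q -> partial_vf i f q =
  bump a (r / 2) (chart_fun c q) * 'D_(e_ i) (f \o chart_inv c) (chart_fun c q).
Proof. exact: partial_funE. Qed.

End Coordinates.

(** Dividing by the bump near p turns the cut-off coordinates and coordinate fields
    into the genuine ones there. *)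
Lemma chart_frame p : exists c, atlas c /\ exists U : set M, open_nbhs p U /\
  U `<=` chart_dom c /\ exists X : 'I_m -> VF, exists u : 'I_m -> C,
  (forall q, U q -> forall i f,
     X i f q = 'D_(e_ i) (f \o chart_inv c) (chart_fun c q)) /\
  (forall q, U q -> forall i, u i q = chart_fun c q ord0 i).
Proof.
have [c ac pc] := atlas_cover p; exists c; split=> //.
have [r r0 Bc] := chart_ball pc; set a := chart_fun c p in Bc *.
have s1 : smooth_on (ball a r) (fun _ : 'rV[R]_m => 1 : R).
  by apply: smooth_on_cst; exact: ball_open.
have sx i : smooth_on (ball a r) (fun x : 'rV[R]_m => x ord0 i : R).
  by apply: smooth_on_proj; exact: ball_open.
pose b := mkcinf (chart_ext_smooth ac r0 Bc s1).
have bE q : chart_dom c q -> b q = bump a (r / 2) (chart_fun c q).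
  by move=> cq; rewrite -[RHS]mulr1; exact: chart_extE.
have bp : b p != 0 by rewrite bE // gt_eqF // bump_gt0 // divr_gt0.
have [e [ O [oO Op] He]] := inverse_near bp.
exists (O `&` chart_dom c); split.
  by split=> //; apply: openI => //; exact: open_chart_dom.
split; first by move=> q [].
exists (fun i => e *: partial_vf ac r0 Bc i).
exists (fun i => e * mkcinf (chart_ext_smooth ac r0 Bc (sx i))).
split=> q [Oq cq] i.
  by move=> f; rewrite vf_scaleE cinfM partial_vfE // -bE // mulrA He // mul1r.
rewrite cinfM [X in _ * X](chart_extE _ _ _ cq) -bE // mulrA He // mul1r //.
Qed.

(** The coefficients of a tangent vector on the coordinate fields are found by
    applying it to the coordinate functions. *)
Lemma local_frame p : exists U : set M, open_nbhs p U /\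
  exists X : 'I_m -> VF, exists u : 'I_m -> C, forall q, U q ->
  (forall i j, X i (u j) q = (i == j)%:R) /\
  (forall v : tangent q, v = \sum_i v (u i) *: at_point (X i) q).
Proof.
have [c [ac [U [[oU Up] [Uc [X [u [XE uE]]]]]]]] := chart_frame p.
exists U; split=> //; exists X, u => q Uq; have cq := Uc q Uq.
have D i j : X i (u j) q = (i == j)%:R.
  rewrite XE //; transitivity ('D_(e_ i) (fun x : 'rV[R]_m => x ord0 j) (chart_fun c q)).
    apply: near_eq_derive.
    have : nbhs (chart_fun c q) (chart_cod c `&` chart_inv c @^-1` U).
      apply: open_nbhs_nbhs; split; first exact: open_chart_set.
      by split; [exact: chart_funE | rewrite /= chart_funK].
    by apply: filterS => x [cx Ux]; rewrite /= uE //; have [_ ->] := chart_codP cx.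
  have dx := @derivable_id R _ (chart_fun c q) (e_ i).
  have := derive_mx dx; rewrite derive_id => /rowP /(_ j).
  by rewrite !mxE eqxx /= eq_sym.
split=> // v.
have [w vE] := tangent_coordinates v ac cq.
have wE j : v (u j) = w j.
  rewrite vE (bigD1 j) //= -XE // D eqxx mulr1 big1 ?addr0 // => i ij.
  by rewrite -XE // D (negPf ij) mulr0.
apply: tangentE => f; rewrite tangent_sumE vE; apply: eq_bigr => i _.
by rewrite tangent_scaleE at_pointE wE XE.
Qed.

(** In the domain of a frame all partial derivatives of f vanish, so that the
    level sets of f are open, and hence closed. *)
Lemma constant_of_derive0 f : connected [set: M] -> (forall V, V f = 0) ->
  exists k, f = csm M k.
Proof.
move=> conn f0.
have [[p0 _]|noM] := pselect (exists p0 : M, True); last first.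
  by exists 0; apply: cinf_eq => p; case: noM; exists p.
exists (f p0).
have loc p : \forall q \near p, f q = f p.
  have [c [ac [U [[oU Up] [Uc [X [u [XE _]]]]]]]] := chart_frame p.
  have [r r0 Br] : exists2 r, 0 < r &
      ball (chart_fun c p) r `<=` chart_cod c `&` chart_inv c @^-1` U.
    have : nbhs (chart_fun c p) (chart_cod c `&` chart_inv c @^-1` U).
      apply: open_nbhs_nbhs; split; first exact: open_chart_set.
      by split; [exact/chart_funE/Uc | rewrite /= chart_funK //; exact: Uc].
    by move=> /nbhs_ballP [r /= r0 H]; exists r.
  have sf : smooth_on (ball (chart_fun c p) r) (f \o chart_inv c).
    by apply: smooth_on_sub (cinfP f ac) => x /Br [].
  have H := eq_on_ball_of_derive0 sf _.
  have : nbhs p (U `&` chart_fun c @^-1` ball (chart_fun c p) r).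
    apply: filterI; first exact: open_nbhs_nbhs.
    apply: (continuous_chart_fun (Uc _ Up)); exact: nbhsx_ballx.
  apply: filterS => q [Uq Bq].
  have := H _ _ Bq; rewrite /= !chart_funK; [|exact: Uc|exact: Uc].
  apply=> i x /Br [cx Ux].
  by have := XE _ Ux i f; rewrite f0 cinf0; have [_ ->] := chart_codP cx.
apply: cinf_eq => p; rewrite csmE.
pose A := [set q | f q = f p0].
suff : A = setT by move=> AT; have : A p by rewrite AT.
apply: conn.
- by exists p0.
- exists A; last by rewrite setTI.
  by rewrite openE => q Aq; apply: filterS (loc q) => x /= E; rewrite /A /= E.
- exists A; last by rewrite setTI.
  rewrite -[A]setCK; apply: open_closedC; rewrite openE => q nAq.
  by apply: filterS (loc q) => x /= E; rewrite /A /= E.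
Qed.

End Frames.

(** * Tensoriality and gluing *)

Section Tensoriality.
Context {R : realType} {m : nat} {M : manifold R m}.
Local Notation C := (Cinf M).
Local Notation VF := (vfield M).
Implicit Types (p q : M) (f : C) (V W : VF).

Lemma cutoff (p : M) (U : set M) : open_nbhs p U ->
  exists b : C, b p = 1 /\ forall q, ~ U q -> b q = 0.
Proof.
move=> [oU Up]; have [c ac pc] := atlas_cover p.
have [r r0 Br] : exists2 r, 0 < r &
    ball (chart_fun c p) r `<=` chart_cod c `&` chart_inv c @^-1` U.
  have : nbhs (chart_fun c p) (chart_cod c `&` chart_inv c @^-1` U).
    apply: open_nbhs_nbhs; split; first exact: open_chart_set.
    by split; [exact/chart_funE | rewrite /= chart_funK].
  by move=> /nbhs_ballP [r /= r0 H]; exists r.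
set a := chart_fun c p in Br.
have Bc : ball a r `<=` chart_cod c by move=> x /Br [].
have s1 : smooth_on (ball a r) (fun _ : 'rV[R]_m => 1 : R).
  by apply: smooth_on_cst; exact: ball_open.
pose b := mkcinf (chart_ext_smooth ac r0 Bc s1).
have bE q : chart_dom c q -> b q = bump a (r / 2) (chart_fun c q).
  by move=> cq; rewrite -[RHS]mulr1; exact: chart_extE.
have bp : b p != 0 by rewrite bE // gt_eqF // bump_gt0 // divr_gt0.
exists (csm M (b p)^-1 * b); split; first by rewrite cinfM csmE mulVf.
move=> q nUq; rewrite cinfM [X in _ * X](_ : _ = 0) ?mulr0 //.
have [cq|cq] := pselect (chart_dom c q); last exact: chart_ext_out.
rewrite bE // bump_eq0 ?divr_gt0 // leNgt; apply/negP => h; apply: nUq.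
have /Br [_] : ball a r (chart_fun c q).
  rewrite -ball_normE /ball_ /= distrC (lt_trans h) //.
  by rewrite ltr_pdivrMr // ltr_pMr // ltr1n.
by rewrite /= chart_funK.
Qed.

(** After multiplication by a function equal to 1 at p, a field that vanishes at p
    is a combination of fields with coefficients vanishing at p. This is the form
    of locality which a map linear over the smooth functions respects. *)
Lemma vanishing_vf V p : at_point V p = 0 ->
  exists b : C, b p = 1 /\ exists F : 'I_m -> C, exists X : 'I_m -> VF,
    (forall i, F i p = 0) /\ b *: V = \sum_i F i *: X i.
Proof.
move=> V0; have [U [oU [X [u H]]]] := local_frame p.
have [b [bp bU]] := cutoff oU.
exists b; split=> //; exists (fun i => b * V (u i)), X; split=> [i|].
  by rewrite cinfM -at_pointE V0 mulr0.
apply: at_point_inj => q; rewrite at_point_sum at_pointZ.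
have [Uq|nUq] := pselect (U q); last first.
  by rewrite bU // scale0r big1 // => i _; rewrite at_pointZ cinfM bU // mul0r scale0r.
have [_ vE] := H q Uq; rewrite [at_point V q]vE scaler_sumr; apply: eq_bigr => i _.
by rewrite at_pointZ cinfM scalerA at_pointE.
Qed.

Lemma tensorial_vf (T : {linear VF -> VF}) V p :
  at_point V p = 0 -> at_point (T V) p = 0.
Proof.
move=> /vanishing_vf [b [bp [F [X [F0 E]]]]].
have := congr1 (fun V => at_point (T V) p) E.
rewrite linearZ linear_sum at_pointZ bp scale1r => ->.
by rewrite at_point_sum big1 // => i _; rewrite linearZ at_pointZ F0 scale0r.
Qed.

Lemma tensorial_fun (T : {linear VF -> C^o}) V p :
  at_point V p = 0 -> T V p = 0.
Proof.
move=> /vanishing_vf [b [bp [F [X [F0 E]]]]].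
have := congr1 (fun V => T V p) E.
rewrite linearZ linear_sum [LHS]cinfM bp mul1r => ->.
by rewrite cinf_sum big1 // => i _; rewrite linearZ [LHS]cinfM F0 mul0r.
Qed.

Lemma at_point_sub0 V W p : at_point V p = at_point W p -> at_point (V - W) p = 0.
Proof. by move=> E; rewrite at_pointD at_pointN E subrr. Qed.

Lemma tensorial_vf_eq (T : {linear VF -> VF}) V W p :
  at_point V p = at_point W p -> at_point (T V) p = at_point (T W) p.
Proof.
move=> /at_point_sub0 /(tensorial_vf T).
by rewrite linearB at_pointD at_pointN => /eqP; rewrite subr_eq0 => /eqP.
Qed.

Lemma tensorial_fun_eq (T : {linear VF -> C^o}) V W p :
  at_point V p = at_point W p -> T V p = T W p.
Proof.
move=> /at_point_sub0 /(tensorial_fun T).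
rewrite linearB => E; apply/eqP; rewrite -subr_eq0; exact/eqP.
Qed.

Lemma glue_cinf (a : M -> R) :
  (forall p, exists f, exists2 O : set M, open_nbhs p O & forall q, O q -> a q = f q) ->
  exists f, forall p, f p = a p.
Proof.
move=> H; have sa : is_smooth a.
  by apply: is_smooth_near => p; have [f [ O oO af]] := H p; exact: smooth_near_cinf af.
by exists (mkcinf sa).
Qed.

(** A family of tangent vectors acts on functions pointwise; only the smoothness of
    the result needs the local fields. *)
Lemma glue_vf (w : forall p : M, tangent p) :
  (forall p, exists V, exists2 O : set M, open_nbhs p O &
     forall q, O q -> w q = at_point V q) ->
  exists V, forall p, at_point V p = w p.
Proof.
move=> H.
have sw f : is_smooth (fun p => w p f).
  apply: is_smooth_near => p; have [V [ O oO wV]] := H p.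
  by apply: (smooth_near_cinf (g := V f) oO) => q /wV ->.
pose D f : C^o := mkcinf (sw f).
have DE f p : D f p = w p f by [].
have DP : D \in @vfield_pred R m M.
  rewrite inE /=; split=> [a f g|f g]; apply: cinf_eq => p.
    by rewrite cinfD cinfM !DE csmE; have [->] := tangentP (w p).
  by rewrite cinfD !cinfM !DE; have [_ ->] := tangentP (w p).
by exists (VField DP) => p; exact: tangentE.
Qed.

(** Evaluation at p, as a ring morphism, commutes with determinants. *)
Definition eval_cinf (p : M) (f : C) : R := f p.

Fact eval_cinf_zmod p : zmod_morphism (eval_cinf p). Proof. by []. Qed.
Fact eval_cinf_monoid p : monoid_morphism (eval_cinf p). Proof. by []. Qed.
HB.instance Definition _ p := GRing.isZmodMorphism.Build C R (eval_cinf p)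
  (eval_cinf_zmod p).
HB.instance Definition _ p := GRing.isMonoidMorphism.Build C R (eval_cinf p)
  (eval_cinf_monoid p).

End Tensoriality.

(** Equality of vector fields is tested on functions, where it becomes a ring
    identity. *)
Ltac vf_ring := apply: vfieldE => ?;
  rewrite ?(vf_addE, vf_oppE, vf_scaleE, vf_zeroE); ring.

(** * Riemannian metrics and subbundles *)

Section Metric.
Context {R : realType} {m : nat} {M : manifold R m}.
Local Notation C := (Cinf M).
Local Notation VF := (vfield M).
Context (g : VF -> VF -> C^o) (mg : riemannian_metric g).
Implicit Types (V W Z : VF) (f : C) (p : M).

Lemma gC V W : g V W = g W V :> C. Proof. exact: (Defs.metric_sym mg). Qed.
Lemma gDr V W Z : g V (W + Z) = (g V W : C) + g V Z :> C.
Proof. by have := metric_linear mg V 1 W Z; rewrite !scale1r. Qed.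
Lemma g0r V : g V 0 = 0 :> C.
Proof. by apply: (addrI (g V 0)); rewrite -gDr !addr0. Qed.
Lemma gZr f V W : g V (f *: W) = f * g V W :> C.
Proof. by have := metric_linear mg V f W 0; rewrite g0r !addr0. Qed.
Lemma gDl V W Z : g (V + W) Z = (g V Z : C) + g W Z :> C.
Proof. by rewrite gC gDr !(gC Z). Qed.
Lemma g0l V : g 0 V = 0 :> C. Proof. by rewrite gC g0r. Qed.
Lemma gZl f V W : g (f *: V) W = f * g V W :> C.
Proof. by rewrite gC gZr gC. Qed.
Lemma gNr V W : g V (- W) = - (g V W : C) :> C.
Proof. by apply: (addrI (g V W)); rewrite -gDr !subrr g0r. Qed.
Lemma gNl V W : g (- V) W = - (g V W : C) :> C.
Proof. by rewrite gC gNr gC. Qed.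
Lemma gBl V W Z : g (V - W) Z = (g V Z : C) - g W Z :> C.
Proof. by rewrite gDl gNl. Qed.
Lemma g_suml (I : Type) (s : seq I) (F : I -> VF) W :
  g (\sum_(i <- s) F i) W = \sum_(i <- s) (g (F i) W : C) :> C.
Proof.
elim: s => [|i s IH]; first by rewrite !big_nil g0l.
by rewrite !big_cons gDl IH.
Qed.

Fact g_linear V : linear (g V). Proof. exact: (metric_linear mg). Qed.
Definition g_lin V : {linear VF -> C^o} :=
  HB.pack (g V) (GRing.isLinear.Build _ _ _ _ (g V) (g_linear V)).

Lemma g_at V W W' p : at_point W p = at_point W' p -> g V W p = g V W' p.
Proof. exact: (tensorial_fun_eq (g_lin V)). Qed.

Lemma g_at0 V W p : at_point W p = 0 -> g V W p = 0.
Proof. exact: (tensorial_fun (g_lin V)). Qed.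

Lemma g_definite V p : g V V p = 0 -> at_point V p = 0.
Proof.
move=> gV; apply/eqP; apply: contraT => /(metric_pos mg).
by rewrite gV ltxx.
Qed.

Lemma g_ge0 V p : 0 <= g V V p.
Proof.
have [/eqP V0|/(metric_pos mg)/ltW//] := boolP (at_point V p == 0).
by rewrite g_at0.
Qed.

Lemma g_eq0 V : (forall W, g V W = 0) -> V = 0.
Proof.
move=> V0; apply: at_point_inj => p; rewrite at_point0.
by apply: g_definite; rewrite V0.
Qed.

Lemma g_inj V W : (forall Z, g V Z = g W Z) -> V = W.
Proof.
move=> VW; apply/eqP; rewrite -subr_eq0; apply/eqP/g_eq0 => Z.
by rewrite gBl VW subrr.
Qed.

End Metric.

Section Projection.
Context {R : realType} {m : nat} {M : manifold R m}.
Local Notation C := (Cinf M).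
Local Notation VF := (vfield M).
Context (g : VF -> VF -> C^o) (mg : riemannian_metric g).
Implicit Types (V W Z : VF) (f : C) (p : M).

(** A vector in the kernel of the Gram matrix at p gives a combination of the E i
    of length 0 at p. *)
Lemma gram_unit k p (E : 'I_k -> VF) :
  (forall c : 'I_k -> R, \sum_i c i *: at_point (E i) p = 0 -> forall i, c i = 0) ->
  (\det (\matrix_(i, j) g (E i) (E j) : 'M[C]_k)) p != 0.
Proof.
move=> freeE; set G := \matrix_(i, j) _.
rewrite -[_ p]/(eval_cinf p _) -det_map_mx; apply/negP => /det0P [v v0 vG].
have Z0 : at_point (\sum_i csm M (v ord0 i) *: E i) p = 0.
  apply: (g_definite mg); rewrite {1}(g_suml mg) cinf_sum.
  pose Z := \sum_i csm M (v ord0 i) *: E i; rewrite -/Z.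
  suff H j : g (E j) Z p = 0.
    by rewrite big1 // => j _; rewrite (gZl mg) cinfM H mulr0.
  rewrite (gC mg) (g_suml mg) cinf_sum; have /rowP /(_ j) := vG.
  rewrite !mxE => H0; rewrite -[RHS]H0; apply: eq_bigr => i _.
  by rewrite (gZl mg) cinfM csmE !mxE.
move/negP: v0; apply; apply/eqP/rowP => i; rewrite mxE.
apply: (freeE (fun i => v ord0 i)); rewrite -[RHS]Z0 at_point_sum; apply: eq_bigr => j _.
by rewrite at_pointZ csmE.
Qed.

Lemma subbundle_submod k (L : tangent_distribution M) p : subbundle k L ->
  forall a v w, L p v -> L p w -> L p (a *: v + w).
Proof.
move=> sL a v w; have [U [oU Up] [E H]] := sL p.
have [_ ->] := H p Up => -[c _ <-] [d _ <-].
exists (fun i => a * c i + d i) => //.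
rewrite scaler_sumr -big_split; apply: eq_bigr => i _.
by rewrite scalerDl scalerA.
Qed.

Lemma subbundle0 k (L : tangent_distribution M) p : subbundle k L -> L p 0.
Proof.
move=> sL; have [U [oU Up] [E H]] := sL p; have [_ ->] := H p Up.
by exists (fun=> 0) => //; rewrite big1 // => i _; rewrite scale0r.
Qed.

Lemma section_extends k (L : tangent_distribution M) p v : subbundle k L ->
  L p v -> exists2 V, section_of L V & at_point V p = v.
Proof.
move=> sL Lv; have [U oU [E H]] := sL p; have [b [bp bU]] := cutoff oU.
have [_ Lp] := H p oU.2; move: (Lv); rewrite {1}Lp => -[c _ cv].
exists (b *: \sum_i csm M (c i) *: E i); last first.
  rewrite at_pointZ bp scale1r at_point_sum -cv.
  by apply: eq_bigr => i _; rewrite at_pointZ.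
move=> q; rewrite at_pointZ; have [Uq|nUq] := pselect (U q); last first.
  by rewrite bU // scale0r; exact: subbundle0 sL.
have [_ ->] := H q Uq; exists (fun i => b q * c i) => //.
rewrite at_point_sum scaler_sumr; apply: eq_bigr => i _.
by rewrite at_pointZ scalerA.
Qed.

(** Near each point the projection is found by Cramer's rule from the Gram matrix
    of a local frame; pointwise uniqueness allows the local solutions to be glued. *)
Lemma orthogonal_projection k (L : tangent_distribution M) V : subbundle k L ->
  exists2 A, section_of L A & forall B, section_of L B -> g (V - A) B = 0.
Proof.
move=> sL.
pose P q (a : tangent q) := exists A, [/\ at_point A q = a, L q a &
  forall B, L q (at_point B q) -> g (V - A) B q = 0].
have uniqP q a a' : P q a -> P q a' -> a = a'.
  move=> [A [Aa La HA]] [A' [Aa' La' HA']].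
  have LD : L q (at_point (A - A') q).
    rewrite at_pointD at_pointN Aa Aa' addrC -scaleN1r.
    exact: (subbundle_submod sL).
  have : g (A - A') (A - A') q = 0.
    have -> : A - A' = (V - A') - (V - A) by vf_ring.
    rewrite {1}(gBl mg) cinfB.
    have -> : (V - A') - (V - A) = A - A' by vf_ring.
    by rewrite HA // HA' // subrr.
  move=> /(g_definite mg); rewrite at_pointD at_pointN Aa Aa' => /eqP.
  by rewrite subr_eq0 => /eqP.
have locP p : exists A, exists2 O : set M, open_nbhs p O &
    forall q, O q -> P q (at_point A q).
  have [U [oU Up] [E H]] := sL p.
  pose G : 'M[C]_k := \matrix_(i, j) g (E i) (E j).
  have detG : (\det G) p != 0 by apply: gram_unit; have [] := H p Up.
  have [e [ O [oO Op] He]] := inverse_near detG.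
  pose b : 'rV[C]_k := \row_j g V (E j).
  pose c : 'rV[C]_k := e *: (b *m \adj G).
  pose A := \sum_i c ord0 i *: E i.
  have gA j q : O q -> g A (E j) q = g V (E j) q.
    move=> Oq; have cG : c *m G = (e * \det G) *: b.
      by rewrite -scalemxAl -mulmxA mul_adj_mx mul_mx_scalar scalerA.
    have /rowP /(_ j) := cG; rewrite !mxE => cGj.
    rewrite (g_suml mg) -[RHS]mul1r -(He q Oq) -!cinfM -cGj !cinf_sum.
    by apply: eq_bigr => i _; rewrite (gZl mg) [G _ _]mxE.
  exists A; exists (U `&` O); first by split=> //; exact: openI.
  move=> q [Uq Oq]; have [_ Lq] := H q Uq; exists A; split=> //.
    rewrite Lq; exists (fun i => c ord0 i q) => //.
    by rewrite at_point_sum; apply: eq_bigr => i _; rewrite at_pointZ.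
  move=> B; rewrite Lq => -[d _ dB].
  have -> : g (V - A) B q = g (V - A) (\sum_i csm M (d i) *: E i) q.
    apply: (g_at mg); rewrite -dB at_point_sum.
    by apply: eq_bigr => i _; rewrite at_pointZ.
  rewrite (gC mg) (g_suml mg) cinf_sum big1 // => i _.
  by rewrite (gZl mg) (gC mg) (gBl mg) cinfM cinfB gA // subrr mulr0.
have exP q : exists a, P q a.
  by have [A [ O [_ Oq] HA]] := locP q; exists (at_point A q); exact: HA.
have [w Pw] : exists w : forall q, tangent q, forall q, P q (w q).
  by exists (fun q => sval (cid (exP q))) => q; exact: svalP.
have [A Aw] : exists A, forall q, at_point A q = w q.
  apply: glue_vf => p; have [A [ O oO HA]] := locP p.
  by exists A, O => // q Oq; apply: uniqP (Pw q) _; exact: HA.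
exists A => [q|B LB]; first by rewrite Aw; have [A' []] := Pw q.
apply: cinf_eq => q; have [A' [A'w _ H]] := Pw q.
rewrite -[RHS](H B (LB q)) (gC mg (V - A)) (gC mg (V - A')); apply: (g_at mg).
by rewrite !at_pointD !at_pointN Aw A'w.
Qed.

End Projection.

(** * Brackets, connections, torsion and curvature *)

Section VectorFieldCalculus.
Context {R : realType} {m : nat} {M : manifold R m}.
Local Notation C := (Cinf M).
Local Notation VF := (vfield M).
Implicit Types (V W Z : VF) (f : C) (p : M).

Lemma cinf_at (f h : C) : f = h -> forall p, f p = h p.
Proof. by move=> ->. Qed.

Lemma vfD V f h : V (f + h) = (V f : C) + V h :> C.
Proof.
have [/(_ 1 f h) + _] := vfieldP V.
by rewrite (_ : csm M 1 = 1) ?mul1r //; exact/val_inj.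
Qed.
Lemma vfM V f h : V (f * h) = f * V h + h * V f :> C.
Proof. by have [_] := vfieldP V; apply. Qed.
Lemma vf0 V : V 0 = 0 :> C.
Proof. by apply: (addrI (V 0)); rewrite -vfD !addr0. Qed.
Lemma vfN V f : V (- f) = - (V f : C) :> C.
Proof. by apply: (addrI (V f)); rewrite -vfD !subrr vf0. Qed.
Lemma vf_csm V a : V (csm M a) = 0 :> C.
Proof. by apply: cinf_eq => p; rewrite -at_pointE tangent_csm. Qed.
Lemma vf1 V : V 1 = 0 :> C.
Proof. by rewrite (_ : 1 = csm M 1) ?vf_csm //; exact/val_inj. Qed.

Lemma lieC V W : lie V W = - lie W V.
Proof. by apply: vfieldE => f; rewrite vf_oppE !lieE; ring. Qed.
Lemma lieDr V W Z : lie V (W + Z) = lie V W + lie V Z.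
Proof. by apply: vfieldE => f; rewrite vf_addE !lieE !vf_addE vfD; ring. Qed.
Lemma lieZr V f W : lie V (f *: W) = V f *: W + f *: lie V W.
Proof.
by apply: vfieldE => h; rewrite vf_addE !vf_scaleE !lieE !vf_scaleE vfM; ring.
Qed.
Lemma lieDl V W Z : lie (V + W) Z = lie V Z + lie W Z.
Proof. by apply: vfieldE => f; rewrite vf_addE !lieE !vf_addE vfD; ring. Qed.
Lemma lieZl V f W : lie (f *: V) W = f *: lie V W - W f *: V.
Proof.
by apply: vfieldE => h; rewrite vf_addE vf_oppE !vf_scaleE !lieE !vf_scaleE vfM; ring.
Qed.
Lemma lieNr V W : lie V (- W) = - lie V W.
Proof. by apply: vfieldE => f; rewrite vf_oppE !lieE !vf_oppE vfN; ring. Qed.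
Lemma lie0r V : lie V 0 = 0.
Proof. by apply: vfieldE => f; rewrite lieE !vf_zeroE vf0 subr0. Qed.
Lemma lievv V : lie V V = 0.
Proof. by apply: vfieldE => f; rewrite lieE vf_zeroE subrr. Qed.
Lemma jacobi U V W : lie (lie U V) W + lie (lie V W) U + lie (lie W U) V = 0.
Proof.
apply: vfieldE => f; rewrite !vf_addE !lieE vf_zeroE !(vfD, vfN); ring.
Qed.

Lemma cinf_half_add (f : C) : csm M 2^-1 * (f + f) = f.
Proof. by apply: cinf_eq => p; rewrite cinfM cinfD csmE; field. Qed.
Lemma cinf_dbl_inj (f f' : C) : f + f = f' + f' -> f = f'.
Proof. by move=> E; rewrite -[f]cinf_half_add E cinf_half_add. Qed.
Lemma cinf_sqr0 (f : C) : f * f = 0 -> f = 0.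
Proof.
move=> E; apply: cinf_eq => p; have := cinf_at E p; rewrite cinfM cinf0 => /eqP.
by rewrite mulf_eq0 orbb => /eqP.
Qed.

Lemma vf_dbl_inj V W : V + V = W + W -> V = W.
Proof.
move=> E; apply: vfieldE => f; apply: cinf_dbl_inj.
by rewrite -[LHS]vf_addE E.
Qed.

Section Connection.
Context (nb : VF -> VF -> VF) (cn : connection nb).

Lemma cnDr V W Z : nb V (W + Z) = nb V W + nb V Z.
Proof. exact: (conn_addr cn). Qed.
Lemma cnDl V W Z : nb (V + W) Z = nb V Z + nb W Z.
Proof. by have := conn_linearl cn 1 V W Z; rewrite !scale1r. Qed.
Lemma cnZr V f W : nb V (f *: W) = V f *: W + f *: nb V W.
Proof. exact: (conn_leibniz cn). Qed.
Lemma cn0l W : nb 0 W = 0.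
Proof. by apply: (addrI (nb 0 W)); rewrite -cnDl !addr0. Qed.
Lemma cn0r W : nb W 0 = 0.
Proof. by apply: (addrI (nb W 0)); rewrite -cnDr !addr0. Qed.
Lemma cnZl f V W : nb (f *: V) W = f *: nb V W.
Proof. by have := conn_linearl cn f V 0 W; rewrite cn0l !addr0. Qed.
Lemma cnNr V W : nb V (- W) = - nb V W.
Proof. by apply: (addrI (nb V W)); rewrite -cnDr !subrr cn0r. Qed.
Lemma cnNl V W : nb (- V) W = - nb V W.
Proof. by apply: (addrI (nb V W)); rewrite -cnDl !subrr cn0l. Qed.
Lemma cn_csm V a W : nb V (csm M a *: W) = csm M a *: nb V W.
Proof. by rewrite cnZr vf_csm scale0r add0r. Qed.

Lemma torsionC V W : torsion nb V W = - torsion nb W V.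
Proof. by rewrite /torsion (lieC V W); vf_ring. Qed.
Lemma torsionDl V V' W : torsion nb (V + V') W = torsion nb V W + torsion nb V' W.
Proof. rewrite /torsion cnDl cnDr lieDl; vf_ring. Qed.
Lemma torsionZl f V W : torsion nb (f *: V) W = f *: torsion nb V W.
Proof. rewrite /torsion cnZl cnZr lieZl; vf_ring. Qed.
Lemma torsionDr V W W' : torsion nb V (W + W') = torsion nb V W + torsion nb V W'.
Proof. rewrite torsionC torsionDl !(torsionC V); vf_ring. Qed.

Lemma curvatureC V W Z : curvature nb V W Z = - curvature nb W V Z.
Proof. rewrite /curvature (lieC V W) cnNl; vf_ring. Qed.
Lemma curvatureDl V V' W Z :
  curvature nb (V + V') W Z = curvature nb V W Z + curvature nb V' W Z.
Proof. rewrite /curvature lieDl !cnDl cnDr; vf_ring. Qed.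
Lemma curvatureZl f V W Z : curvature nb (f *: V) W Z = f *: curvature nb V W Z.
Proof. rewrite /curvature lieZl cnDl cnNl !cnZl cnZr; vf_ring. Qed.

(** The first Bianchi identity in the presence of torsion: what the Jacobi identity
    leaves of the six second derivatives. *)
Lemma bianchi U V W :
  curvature nb U V W + curvature nb V W U + curvature nb W U V =
  nb U (torsion nb V W) + nb V (torsion nb W U) + nb W (torsion nb U V)
  - (torsion nb (lie U V) W + torsion nb (lie V W) U + torsion nb (lie W U) V).
Proof.
have := jacobi U V W; rewrite /curvature /torsion !cnDr !cnNr => J.
apply/eqP; rewrite -subr_eq0 -[X in _ == X]oppr0 -J; apply/eqP; vf_ring.
Qed.

End Connection.
End VectorFieldCalculus.

(** * Contact metric manifolds *)

Section ContactMetric.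
Context {R : realType} {m : nat} {M : manifold R m}.
Local Notation C := (Cinf M).
Local Notation VF := (vfield M).
Context (phi : {linear VF -> VF}) (xi : VF) (eta : {linear VF -> C^o})
  (g : VF -> VF -> C^o) (nabla : VF -> VF -> VF).
Context (cm : contact_metric phi xi eta g) (lc : levi_civita g nabla).
Implicit Types (V W Z U X Y : VF) (f : C) (p : M).

Let acm : almost_contact_metric phi xi eta g := cm.1.
Let mg : riemannian_metric g := acm_metric acm.
Let cn : connection nabla := lc_connection lc.
Local Notation gE := (gDl mg, gDr mg, gNl mg, gNr mg, gZl mg, gZr mg).

Lemma etaD V W : eta (V + W) = (eta V : C) + eta W :> C.
Proof. exact: linearD. Qed.
Lemma etaN V : eta (- V) = - (eta V : C) :> C.
Proof. exact: linearN. Qed.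
Lemma etaZ f V : eta (f *: V) = f * eta V :> C.
Proof. by rewrite linearZ. Qed.
Lemma eta_xi : eta xi = 1 :> C. Proof. exact: (acm_reeb acm). Qed.
Lemma phiD V W : phi (V + W) = phi V + phi W. Proof. exact: linearD. Qed.
Lemma phiN V : phi (- V) = - phi V. Proof. exact: linearN. Qed.
Lemma phiZ f V : phi (f *: V) = f *: phi V. Proof. exact: linearZ. Qed.
Lemma phi2 V : phi (phi V) = - V + eta V *: xi. Proof. exact: (acm_phi2 acm). Qed.

Lemma xi_neq0_scale f : f *: xi = 0 -> f = 0.
Proof. by move=> /(congr1 eta); rewrite linear0 [X in X = _ -> _]etaZ eta_xi mulr1. Qed.

(** From phi (phi xi) = 0 it follows that phi xi = f xi, and then that f ^ 2 = 0. *)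
Lemma phi_xi : phi xi = 0.
Proof.
have E1 : phi (phi xi) = 0 by rewrite phi2 eta_xi scale1r addNr.
have E2 : phi xi = eta (phi xi) *: xi.
  by apply/eqP; rewrite -subr_eq0 -oppr_eq0 opprB addrC -phi2 E1 linear0.
have : eta (phi xi) *: (eta (phi xi) *: xi) = 0 by rewrite -E2 -phiZ -E2.
rewrite scalerA => /xi_neq0_scale /cinf_sqr0 e0.
by rewrite E2 e0 scale0r.
Qed.

Lemma eta_phi V : eta (phi V) = 0 :> C.
Proof.
apply: xi_neq0_scale; have := phi2 (phi V).
rewrite [phi (phi V)]phi2 phiD phiN phiZ phi_xi scaler0 addr0 => E.
by apply: (addrI (- phi V)); rewrite -E addr0.
Qed.

Lemma g_compat V W : g (phi V) (phi W) = (g V W : C) - eta V * eta W :> C.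
Proof. exact: (acm_compat acm). Qed.

Lemma g_xi V : g V xi = eta V :> C.
Proof.
have := g_compat V xi; rewrite phi_xi (g0r mg) eta_xi mulr1 => /eqP.
by rewrite eq_sym subr_eq0 => /eqP.
Qed.

Lemma g_xil V : g xi V = eta V :> C. Proof. by rewrite (gC mg) g_xi. Qed.

Lemma d_eta V W : (g V (phi W) : C) + g V (phi W) =
  V (eta W) - W (eta V) - eta (lie V W).
Proof.
have := cm.2 V W; rewrite /ext_d /fundamental_form => <-.
by rewrite -mulrDr cinf_half_add.
Qed.

Lemma phi_skew V W : g (phi V) W = - (g V (phi W) : C) :> C.
Proof.
apply: cinf_dbl_inj; rewrite (gC mg) d_eta -opprD d_eta (lieC V W) etaN; ring.
Qed.

Lemma eta_lie_xi V : eta (lie xi V) = xi (eta V) :> C.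
Proof.
have := d_eta xi V; rewrite (gC mg) phi_skew phi_xi (g0r mg) eta_xi vf1 subr0 oppr0 addr0.
by move=> /eqP; rewrite eq_sym subr_eq0 => /eqP.
Qed.

Lemma ext_dE V W : ext_d eta V W = g V (phi W).
Proof. exact: cm.2. Qed.

(** The fundamental form is d eta, hence closed; on the level of formulas this is
    the Jacobi identity. *)
Lemma closed_fundamental U V W :
  U (g V (phi W)) + V (g W (phi U)) + W (g U (phi V))
  - (g (lie U V) (phi W) : C) - g (lie V W) (phi U) - g (lie W U) (phi V) = 0 :> C.
Proof.
apply: cinf_dbl_inj; rewrite addr0.
have E V' W' Z' : Z' (g V' (phi W')) + Z' (g V' (phi W')) =
    Z' (V' (eta W') - W' (eta V') - eta (lie V' W')) :> C.
  by rewrite -vfD d_eta.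
have J : eta (lie (lie U V) W) + eta (lie (lie V W) U) + eta (lie (lie W U) V) = 0 :> C.
  by rewrite -!etaD jacobi; exact: linear0.
have E1 := E V W U; have E2 := E W U V; have E3 := E U V W.
have D1 := d_eta (lie U V) W; have D2 := d_eta (lie V W) U; have D3 := d_eta (lie W U) V.
rewrite !(vfD, vfN) in E1 E2 E3; rewrite !lieE in D1 D2 D3.
transitivity (eta (lie (lie U V) W) + eta (lie (lie V W) U) + eta (lie (lie W U) V)); last by [].
apply: cinf_eq => p.
have {}E1 := cinf_at E1 p; have {}E2 := cinf_at E2 p; have {}E3 := cinf_at E3 p.
have {}D1 := cinf_at D1 p; have {}D2 := cinf_at D2 p; have {}D3 := cinf_at D3 p.
rewrite !(cinfD, cinfN) in E1 E2 E3 D1 D2 D3 *.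
lra.
Qed.

Lemma lcC V W : nabla V W - nabla W V = lie V W.
Proof.
by have := lc_torsion lc V W; rewrite /torsion => /eqP; rewrite subr_eq0 => /eqP.
Qed.

Lemma lcM V W Z : V (g W Z) = (g (nabla V W) Z : C) + g W (nabla V Z) :> C.
Proof. exact: (lc_metric lc). Qed.

(** * The operator h *)

Lemma tensor_hE V :
  tensor_h phi xi V + tensor_h phi xi V = lie xi (phi V) - phi (lie xi V).
Proof.
rewrite /tensor_h -scalerDr /lie_der_endo; set D := _ - phi _.
by apply: vfieldE => f; rewrite vf_scaleE vf_addE cinf_half_add.
Qed.

Lemma tensor_h_linear : linear (tensor_h phi xi).
Proof.
move=> f V W; apply: vf_dbl_inj.
rewrite [LHS]tensor_hE; have := tensor_hE V; have := tensor_hE W.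
move: (tensor_h phi xi V) (tensor_h phi xi W) => a b Eb Ea.
transitivity (f *: (a + a) + (b + b)); last by vf_ring.
rewrite Ea Eb phiD phiZ !lieDr !lieZr !phiD !phiZ.
vf_ring.
Qed.

(** The operator h is replaced below by an abstract linear map with the same
    values: linearity then makes it tensorial, and its definition as a Lie
    derivative stays out of the way of rewriting. *)
Lemma tensor_h_exists : exists h : {linear VF -> VF}, forall V, h V = tensor_h phi xi V.
Proof.
pose H : {linear VF -> VF} := HB.pack (tensor_h phi xi)
  (GRing.isLinear.Build C VF VF *:%R (tensor_h phi xi) tensor_h_linear).
by exists H.
Qed.

Context (h : {linear VF -> VF}) (hdef : forall V, h V = tensor_h phi xi V).

Lemma hE V : h V + h V = lie xi (phi V) - phi (lie xi V).
Proof. by rewrite hdef tensor_hE. Qed.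

Lemma hD V W : h (V + W) = h V + h W. Proof. exact: linearD. Qed.
Lemma hN V : h (- V) = - h V. Proof. exact: linearN. Qed.
Lemma hZ f V : h (f *: V) = f *: h V. Proof. exact: linearZ. Qed.

Lemma h_xi : h xi = 0.
Proof. by apply: vf_dbl_inj; rewrite hE phi_xi lievv lie0r linear0 subrr addr0. Qed.

Lemma eta_h V : eta (h V) = 0 :> C.
Proof.
apply: cinf_dbl_inj; rewrite -etaD hE etaD etaN eta_lie_xi !eta_phi vf0; ring.
Qed.

Lemma h_phi V : h (phi V) = - phi (h V).
Proof.
apply/eqP; rewrite -subr_eq0 opprK; apply/eqP; apply: vf_dbl_inj.
rewrite addrACA hE -phiD hE phiD phiN !phi2 lieDr lieNr lieZr lievv eta_lie_xi.
vf_ring.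
Qed.

(** The Lie derivative of g along xi. It equals 2 g(V, h (phi W)), which links h
    both to the Killing equation and, by symmetry in V and W, to its adjoint. *)
Definition lie_metric V W : C := xi (g V W) - (g (lie xi V) W : C) - g V (lie xi W).

Lemma lie_metricC V W : lie_metric V W = lie_metric W V.
Proof. rewrite /lie_metric !(gC mg W) !(gC mg (lie xi W)); ring. Qed.

Lemma lie_metric_phi V W : lie_metric V (phi W) = - (g V (h W) : C) - g V (h W).
Proof.
have := closed_fundamental xi V W.
rewrite phi_xi !(g0r mg) vf0 g_xil eta_phi vf0 (lieC W xi) !gE.
rewrite (gC mg (lie xi W)) phi_skew => E.
have := congr1 (fun Z => g V Z : C) (hE W); rewrite !gE => H.
apply: cinf_eq => p; have {}E := cinf_at E p; have {}H := cinf_at H p.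
rewrite /lie_metric; rewrite !(vfN, cinfD, cinfN, cinf0) in E H *; lra.
Qed.

Lemma lie_metric_xi V : lie_metric V xi = 0.
Proof. rewrite /lie_metric !g_xi lievv (g0r mg) eta_lie_xi; ring. Qed.

Lemma lie_metricZr V f W : lie_metric V (f *: W) = f * lie_metric V W.
Proof. rewrite /lie_metric lieZr !gE vfM; ring. Qed.
Lemma lie_metricDr V W Z : lie_metric V (W + Z) = lie_metric V W + lie_metric V Z.
Proof. rewrite /lie_metric lieDr !gE vfD; ring. Qed.
Lemma lie_metricNr V W : lie_metric V (- W) = - lie_metric V W.
Proof. rewrite /lie_metric lieNr !gE vfN; ring. Qed.

Lemma lie_metricE V W : lie_metric V W = (g V (h (phi W)) : C) + g V (h (phi W)).
Proof.
have := lie_metric_phi V (phi W).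
rewrite phi2 lie_metricDr lie_metricNr lie_metricZr lie_metric_xi mulr0 addr0.
by move=> /(congr1 -%R); rewrite opprK => ->; ring.
Qed.

Lemma h_sym V W : g (h V) W = g V (h W) :> C.
Proof.
have E V' W' : g V' (h (phi W')) = g W' (h (phi V')) :> C.
  by apply: cinf_dbl_inj; rewrite -!lie_metricE lie_metricC.
have := E V (phi W).
rewrite phi2 hD hN hZ h_xi scaler0 addr0 h_phi !gE g_compat eta_h mulr0 subr0.
by move=> /oppr_inj ->; rewrite (gC mg).
Qed.

Lemma killing_of_h0 : (forall V, h V = 0) -> killing g xi.
Proof.
by move=> h0 V W; rewrite -[LHS]/(lie_metric V W) lie_metricE h0 (g0r mg) addr0.
Qed.

(** The symmetric part of nabla xi is half of the Lie derivative of g, the skew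
    part is d eta; both are known. *)
Lemma nabla_xi V : nabla V xi = - phi V - phi (h V).
Proof.
apply: (g_inj mg) => W; apply: cinf_dbl_inj.
have E1 := lie_metricE V W; rewrite /lie_metric lcM in E1.
rewrite -!lcC !gE in E1.
have := d_eta V W; rewrite -!g_xi !lcM -lcC !gE => E2.
rewrite !phi_skew h_sym; rewrite (gC mg W (nabla V xi)) in E2.
apply: cinf_eq => p; have {}E1 := cinf_at E1 p; have {}E2 := cinf_at E2 p.
rewrite !(cinfD, cinfN) in E1 E2 *; lra.
Qed.

Lemma h0_of_not_K_contact : ~ K_contact phi xi eta g -> exists V, h V <> 0.
Proof.
move=> nK; apply: contrapT => H; apply: nK; split=> //; apply: killing_of_h0 => V.
by apply: contrapT => hV; apply: H; exists V.
Qed.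

(** * The Levi-Civita connection in the Reeb direction *)

Lemma nabla_xi_xi : nabla xi xi = 0.
Proof. by rewrite nabla_xi h_xi linear0 phi_xi !oppr0 addr0. Qed.

Lemma phi2_ker V : eta V = 0 -> phi (phi V) = - V.
Proof. by move=> e; rewrite phi2 e scale0r addr0. Qed.

Lemma phi2_h V : phi (phi (h V)) = - h V.
Proof. exact/phi2_ker/eta_h. Qed.

Lemma eta_nabla_xi V : eta (nabla V xi) = 0 :> C.
Proof. rewrite nabla_xi etaD !etaN !eta_phi; ring. Qed.

(** Equate 2 h V with [xi, phi V] - phi [xi, V] and insert the formula for
    nabla xi. *)
Lemma nabla_xi_phi V : nabla xi (phi V) = phi (nabla xi V).
Proof.
have := hE V; rewrite -!lcC !nabla_xi !phiD !phiN h_phi !phiN !phiD !phiN !phi2_h.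
move=> E; apply/eqP; rewrite -subr_eq0; apply/eqP.
transitivity (h V + h V - (h V + h V)); last by rewrite subrr.
by rewrite {1}E; vf_ring.
Qed.

(** The formula for nabla xi turns second derivatives of xi into first derivatives
    of h; phi is parallel along xi. *)
Lemma reeb_curvature V : curvature nabla xi V xi =
  phi (phi V) + h (h V) - phi (nabla xi (h V) - h (nabla xi V)).
Proof.
rewrite /curvature nabla_xi_xi (cn0r cn) !nabla_xi -lcC nabla_xi.
rewrite (cnDr cn) !(cnNr cn) !nabla_xi_phi !(phiD, phiN, hD, hN).
rewrite ?(phiD, phiN, hD, hN, h_phi, phi2_h, opprK); vf_ring.
Qed.

Section KappaMu.
Context (kap mu : R) (km : forall V W, curvature nabla V W xi =
    csm M kap *: (eta W *: V - eta V *: W) +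
    csm M mu *: (eta W *: h V - eta V *: h W)).

Lemma kappa_mu_reeb V :
  csm M kap *: phi (phi V) - csm M mu *: h V = curvature nabla xi V xi.
Proof. rewrite km h_xi eta_xi phi2; vf_ring. Qed.

(** R(xi, V) xi is known from the nullity condition and from reeb_curvature. The
    two expressions are compared at V and at phi V: the terms h h and phi phi
    commute with phi while those in h and its derivative anticommute, so that the
    two kinds separate. *)
Lemma kappa_mu_sum V :
  h (h V) = csm M (kap - 1) *: phi (phi V) /\
  phi (nabla xi (h V) - h (nabla xi V)) = csm M mu *: h V.
Proof.
set S := nabla xi (h V) - h (nabla xi V).
have E1 := kappa_mu_reeb V; rewrite reeb_curvature -/S in E1.
have E2 := kappa_mu_reeb (phi V); rewrite reeb_curvature in E2.
have p3 W : phi (phi (phi W)) = - phi W by apply: phi2_ker; exact: eta_phi.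
have S1 : nabla xi (h (phi V)) - h (nabla xi (phi V)) = - phi S.
  by rewrite h_phi (cnNr cn) !nabla_xi_phi h_phi /S phiD phiN; vf_ring.
clearbody S; rewrite S1 !h_phi !hN !h_phi !p3 !phiN opprK in E2.
have E3 := congr1 phi E2.
rewrite !(phiD, phiN, phiZ) !phi2_h p3 in E3.
split; apply: vfieldE => f; apply: cinf_eq => p.
  have := cinf_at (congr1 (fun W : VF => W f : C) E1) p.
  have := cinf_at (congr1 (fun W : VF => W f : C) E3) p.
  rewrite !(vf_addE, vf_oppE, vf_scaleE) !(cinfD, cinfN, cinfM) !csmE.
  lra.
have := cinf_at (congr1 (fun W : VF => W f : C) E1) p.
have := cinf_at (congr1 (fun W : VF => W f : C) E3) p.
rewrite !(vf_addE, vf_oppE, vf_scaleE) !(cinfD, cinfN, cinfM) !csmE.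
lra.
Qed.
End KappaMu.

(** * Eigenfields of h *)

Definition eig (e : R) V := h V = csm M e *: V.

Lemma eigD e V W : eig e V -> eig e W -> eig e (V + W).
Proof. by rewrite /eig hD scalerDr => -> ->. Qed.
Lemma eigZ e f V : eig e V -> eig e (f *: V).
Proof. by rewrite /eig hZ => ->; vf_ring. Qed.
Lemma eigN e V : eig e V -> eig e (- V).
Proof. by rewrite /eig hN => ->; vf_ring. Qed.
Lemma eig0 e : eig e 0.
Proof. by rewrite /eig linear0 scaler0. Qed.

Lemma csm_mulI (e : R) (f f' : C) : e != 0 -> csm M e * f = csm M e * f' -> f = f'.
Proof.
move=> e0 E; apply: cinf_eq => p; have := cinf_at E p.
by rewrite !cinfM csmE => /(mulfI e0).
Qed.

Lemma eig_eta e V : e != 0 -> eig e V -> eta V = 0 :> C.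
Proof.
move=> e0 hV; apply: (csm_mulI e0); rewrite mulr0 -etaZ -hV; exact: eta_h.
Qed.

Lemma eig_phi e V : eig e V -> eig (- e) (phi V).
Proof.
rewrite /eig h_phi => ->; rewrite phiZ; apply: vfieldE => f; apply: cinf_eq => p.
by rewrite vf_oppE !vf_scaleE cinfN !cinfM !csmE mulNr.
Qed.

Lemma eig_phiK e V : e != 0 -> eig e V -> phi (phi V) = - V.
Proof. by move=> e0 /(eig_eta e0); exact: phi2_ker. Qed.

Lemma eig_orth e V W : e != 0 -> eig e V -> eig (- e) W -> g V W = 0 :> C.
Proof.
move=> e0 hV hW; have := h_sym V W; rewrite hV hW !gE => E.
apply: cinf_eq => p; have {}E := cinf_at E p.
rewrite !cinfM !csmE in E; rewrite cinf0.
by apply/eqP; rewrite -(mulrI_eq0 _ (mulfI e0)); apply/eqP; lra.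
Qed.

Lemma eig_legendrian e V W : e != 0 -> eig e V -> eig e W -> g V (phi W) = 0 :> C.
Proof. by move=> e0 hV /eig_phi hW; exact: eig_orth hV hW. Qed.

Lemma nabla_xi_eig e V : eig e V -> nabla V xi = - (csm M (1 + e) *: phi V).
Proof.
move=> hV; rewrite nabla_xi hV phiZ; apply: vfieldE => f; apply: cinf_eq => p.
by rewrite !(vf_addE, vf_oppE, vf_scaleE) !(cinfD, cinfN, cinfM) !csmE; ring.
Qed.

(** The unknowns are the numbers g(nabla_X Y, phi Z) for the six orderings of three
    eigenfields. Adding up the equations shows that their sum vanishes, after which
    the primed and unprimed unknowns can be identified. *)
Lemma legendrian_system (F : realFieldType) (e a a' b b' c c' : F) : e != 0 ->
  a + b + c = a' + b' + c' ->
  (1 + e) * (a' - b) = (1 - e) * (a - b') ->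
  (1 + e) * (b' - c) = (1 - e) * (b - c') ->
  (1 + e) * (a' + c) = (1 - e) * (a + c') ->
  (1 + e) * (b' + a) = (1 - e) * (b + a') ->
  (1 + e) * (c' + b) = (1 - e) * (c + b') -> a = 0.
Proof.
move=> e0 s E1 E2 F1 F2 F3.
have S : e * (a + b + c + a' + b' + c') = 0 by lra.
have {}S : a + b + c + a' + b' + c' = 0.
  by apply: (mulfI e0); rewrite S mulr0.
have ec : c = - a - b by lra.
have ec' : c' = - a' - b' by lra.
rewrite ec ec' in E2 F1 F3.
have aa' : a' = a by lra.
rewrite aa' in E1 F1 F2 F3.
have : e * a = 0 by lra.
by move=> /(congr1 (fun x => e^-1 * x)); rewrite mulKf // mulr0.
Qed.

Section FlatContactPlanes.
Context (flat_D : forall V W, eta V = 0 -> eta W = 0 -> curvature nabla V W xi = 0).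

(** R(X, Y) xi = 0, paired with Z. *)
Lemma eig_codazzi e X Y Z (p : M) : e != 0 -> eig e X -> eig e Y -> eig e Z ->
  (1 + e) * (g (nabla X Z) (phi Y) p - g (nabla Y Z) (phi X) p) =
  (1 - e) * (g (nabla X Y) (phi Z) p - g (nabla Y X) (phi Z) p).
Proof.
move=> e0 eX eY eZ.
have := flat_D (eig_eta e0 eX) (eig_eta e0 eY); rewrite /curvature.
rewrite (nabla_xi_eig eX) (nabla_xi_eig eY) nabla_xi !(cnNr cn) !(cn_csm cn) -lcC.
move=> /(congr1 (fun W => g W Z : C)).
rewrite !(phiD, phiN, hD, hN) !gE (g0l mg) !phi_skew !h_sym (h_phi Z) eZ phiZ !gE.
have E1 := lcM X (phi Y) Z; have E2 := lcM Y (phi X) Z.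
rewrite !(gC mg (phi Y)) (eig_legendrian e0 eZ eY) vf0 in E1.
rewrite !(gC mg (phi X)) (eig_legendrian e0 eZ eX) vf0 in E2.
move=> E; have {}E := cinf_at E p; have {}E1 := cinf_at E1 p; have {}E2 := cinf_at E2 p.
rewrite !(cinfD, cinfN, cinfM, csmE, cinf0) in E E1 E2.
nra.
Qed.

(** R(X, phi Y) xi = 0, paired with phi Z. *)
Lemma eig_mixed e X Y Z (p : M) : e != 0 -> eig e X -> eig e Y -> eig e Z ->
  (1 - e) * g (nabla X Y) (phi Z) p - (1 + e) * g (nabla X Z) (phi Y) p +
  (1 + e) * (g (nabla (phi Y) (phi X)) (phi Z) p - g (nabla (phi Y) X) Z p) = 0.
Proof.
move=> e0 eX eY eZ; have etaZ0 := eig_eta e0 eZ.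
have := flat_D (eig_eta e0 eX) (eta_phi Y); rewrite /curvature.
rewrite (nabla_xi_eig eX) (nabla_xi_eig (eig_phi eY)) (eig_phiK e0 eY) scalerN opprK.
rewrite nabla_xi !(cnNr cn) !(cn_csm cn) -lcC.
move=> /(congr1 (fun W => g W (phi Z) : C)).
rewrite !gE (g0l mg) !g_compat etaZ0 !mulr0 !subr0 h_sym eZ !gE => E.
have E1 := lcM X (phi Y) Z; rewrite !(gC mg (phi Y)) (eig_legendrian e0 eZ eY) vf0 in E1.
have {}E := cinf_at E p; have {}E1 := cinf_at E1 p.
rewrite !(cinfD, cinfN, cinfM, csmE, cinf0) in E E1.
nra.
Qed.

(** Symmetrising eig_mixed in X and Z removes the derivatives along phi Y, because
    phi is an isometry on the contact planes. *)
Lemma eig_mixed_sym e X Y Z (p : M) : e != 0 -> eig e X -> eig e Y -> eig e Z ->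
  (1 + e) * (g (nabla X Z) (phi Y) p + g (nabla Z X) (phi Y) p) =
  (1 - e) * (g (nabla X Y) (phi Z) p + g (nabla Z Y) (phi X) p).
Proof.
move=> e0 eX eY eZ; have E1 := eig_mixed p e0 eX eY eZ.
have E2 := eig_mixed p e0 eZ eY eX.
have := congr1 (fun f : C => phi Y f : C) (g_compat X Z).
rewrite (eig_eta e0 eX) mul0r subr0 !lcM !(gC mg (phi X)) !(gC mg X).
move=> E; have {}E := cinf_at E p; rewrite !cinfD in E; nra.
Qed.

(** The eigendistributions are totally geodesic. Closedness of the fundamental
    form, eig_codazzi and eig_mixed_sym are exactly the hypotheses of
    legendrian_system. *)
Lemma eig_geodesic e X Y Z : e != 0 -> eig e X -> eig e Y -> eig e Z ->
  g (nabla X Y) (phi Z) = 0 :> C.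
Proof.
move=> e0 eX eY eZ; apply: cinf_eq => p.
apply: (legendrian_system (e := e) (a' := g (nabla X Z) (phi Y) p)
  (b := g (nabla Y Z) (phi X) p) (b' := g (nabla Y X) (phi Z) p)
  (c := g (nabla Z X) (phi Y) p) (c' := g (nabla Z Y) (phi X) p)) => //.
- have := cinf_at (closed_fundamental X Y Z) p.
  rewrite (eig_legendrian e0 eY eZ) (eig_legendrian e0 eZ eX).
  rewrite (eig_legendrian e0 eX eY) !vf0 -!lcC !gE !(cinfD, cinfN, cinf0); lra.
- by have := eig_codazzi p e0 eX eY eZ.
- by have := eig_codazzi p e0 eY eZ eX.
- by have := eig_mixed_sym p e0 eX eY eZ.
- by have := eig_mixed_sym p e0 eY eZ eX.
- by have := eig_mixed_sym p e0 eZ eX eY.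
Qed.

End FlatContactPlanes.

Lemma g_self_eq0 V : g V V = 0 :> C -> V = 0.
Proof.
move=> V0; apply: at_point_inj => p; rewrite at_point0; apply: (g_definite mg).
exact: cinf_at V0 p.
Qed.

(** * A metric connection adapted to the eigendistributions *)

Section TwoEigenvalues.
Context (lam : R) (lam0 : lam != 0)
  (h2 : forall V, h (h V) = - (csm M (lam * lam) *: phi (phi V))).

(** On the contact planes this is the projector (h + e) / 2e onto the e-eigenspace
    along the (-e)-eigenspace; it kills xi. *)
Definition eigproj (e : R) V := csm M (2 * e)^-1 *: (h V + csm M e *: (V - eta V *: xi)).

Lemma eigproj_eig e V : e * e = lam * lam -> eig e (eigproj e V).
Proof.
move=> ee; rewrite /eig /eigproj hZ hD hZ hD hN hZ h_xi h2 phi2 -ee.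
apply: vfieldE => f; apply: cinf_eq => p.
rewrite !(vf_addE, vf_oppE, vf_scaleE, vf_zeroE).
by rewrite !(cinfD, cinfN, cinfM, csmE, cinf0); ring.
Qed.

Lemma eig_split e V : e != 0 -> V = eigproj e V + eigproj (- e) V + eta V *: xi.
Proof.
move=> e0; apply: vfieldE => f; apply: cinf_eq => p.
rewrite /eigproj !(vf_addE, vf_oppE, vf_scaleE).
by rewrite !(cinfD, cinfN, cinfM, csmE); field.
Qed.

Lemma eig_neq0 (e : R) : e * e = lam * lam -> e != 0.
Proof. by move=> ee; rewrite -[e == 0]orbb -mulf_eq0 ee mulf_neq0. Qed.

Lemma eig_decomposition e V : e * e = lam * lam -> exists X Y,
  [/\ eig e X, eig (- e) Y & V = X + Y + eta V *: xi].
Proof.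
move=> ee; exists (eigproj e V), (eigproj (- e) V); split.
- exact: eigproj_eig.
- by apply: eigproj_eig; rewrite mulrNN.
- exact/eig_split/eig_neq0.
Qed.

(** The eigenspaces for e and - e are orthogonal and exchanged by phi. *)
Lemma eig_test e V : e * e = lam * lam -> eta V = 0 :> C ->
  (forall Z, eig e Z -> g V (phi Z) = 0 :> C) -> eig e V.
Proof.
move=> ee etaV H; have e0 := eig_neq0 ee.
have e0' : - e != 0 by rewrite oppr_eq0.
have [P [N [eP eN VE]]] := eig_decomposition V ee.
rewrite etaV scale0r addr0 in VE.
have eZ : eig e (phi N) by have := eig_phi eN; rewrite opprK.
have := H _ eZ; rewrite (eig_phiK e0' eN) VE !gE (eig_orth e0 eP eN) ?oppr0 add0r.
by move=> /(congr1 -%R); rewrite opprK oppr0 => /g_self_eq0 ->; rewrite addr0.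
Qed.

Context (mu : R)
  (dh : forall V, phi (nabla xi (h V) - h (nabla xi V)) = csm M mu *: h V)
  (flat_D : forall V W, eta V = 0 -> eta W = 0 -> curvature nabla V W xi = 0).

(** The second and third terms make xi parallel without spoiling metricity; the
    last one, which is skew as well, cancels the derivative of h along xi. *)
Definition nbl V W := nabla V W - eta W *: nabla V xi + g W (nabla V xi) *: xi
  + (csm M (mu / 2) * eta V) *: phi W.

Lemma nbl_connection : connection nbl.
Proof.
split=> [f V V' W|V W W'|f V W]; rewrite /nbl.
- rewrite !(cnDl cn) !(cnZl cn) !gE etaD etaZ; vf_ring.
- rewrite !(cnDr cn) !gE etaD phiD; vf_ring.
- rewrite !(cnZr cn) !gE etaZ phiZ; vf_ring.
Qed.
Let bn := nbl_connection.

Lemma nbl_metric V W Z : V (g W Z) = (g (nbl V W) Z : C) + g W (nbl V Z) :> C.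
Proof.
rewrite lcM /nbl !gE g_xil g_xi phi_skew (gC mg (nabla V xi) Z); ring.
Qed.

Lemma nbl_xi V : nbl V xi = 0.
Proof. rewrite /nbl g_xil eta_nabla_xi phi_xi scaler0 eta_xi; vf_ring. Qed.

Lemma eta_nbl V W : eta (nbl V W) = V (eta W) :> C.
Proof. by rewrite -!g_xi nbl_metric nbl_xi (g0r mg) addr0. Qed.

Lemma nbl_eig_g V W Z e : e != 0 -> eig e W -> eig e Z ->
  g (nbl V W) (phi Z) = (g (nabla V W) (phi Z) : C) +
    csm M (mu / 2) * eta V * g W Z :> C.
Proof.
move=> e0 eW eZ; rewrite /nbl !gE g_xil eta_phi (eig_eta e0 eW) g_compat (eig_eta e0 eW).
ring.
Qed.

(** Along eigenfields for e this is eig_geodesic; along eigenfields for - e it is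
    eig_geodesic for - e, with the derivative moved to the other factor of the
    scalar product; along xi it is the equation for the derivative of h, which
    fixes the coefficient mu / 2. *)
Lemma nbl_eig e V W : e * e = lam * lam -> eig e W -> eig e (nbl V W).
Proof.
move=> ee eW; have e0 := eig_neq0 ee.
have e0' : - e != 0 by rewrite oppr_eq0.
have [X [Y [eX eY ->]]] := eig_decomposition V ee.
rewrite !(cnDl bn) (cnZl bn); apply: eigD; first apply: eigD.
- apply: eig_test => // [|Z eZ]; first by rewrite eta_nbl (eig_eta e0 eW) vf0.
  rewrite (nbl_eig_g X e0 eW eZ) (eig_eta e0 eX) mulr0 mul0r addr0.
  exact: (eig_geodesic flat_D e0 eX eW eZ).
- apply: eig_test => // [|Z eZ]; first by rewrite eta_nbl (eig_eta e0 eW) vf0.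
  rewrite (nbl_eig_g Y e0 eW eZ) (eig_eta e0' eY) mulr0 mul0r addr0.
  have := eig_geodesic flat_D e0' eY (eig_phi eZ) (eig_phi eW).
  rewrite (eig_phiK e0 eW) gE => H; have := lcM Y W (phi Z).
  rewrite (eig_legendrian e0 eW eZ) vf0 (gC mg W) => E.
  apply: cinf_eq => p; have {}E := cinf_at E p; have {}H := cinf_at H p.
  by rewrite !(cinfD, cinfN, cinf0) in E H *; lra.
apply: eigZ; apply: eig_test => // [|Z eZ].
  by rewrite eta_nbl (eig_eta e0 eW) vf0.
rewrite (nbl_eig_g xi e0 eW eZ) eta_xi mulr1; apply: (csm_mulI e0); rewrite mulr0.
have := congr1 (fun U => g U Z : C) (dh W).
rewrite eW (cn_csm cn) phiD phiN phiZ !gE !phi_skew h_sym h_phi eZ phiZ !gE.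
move=> E; apply: cinf_eq => p; have {}E := cinf_at E p.
by rewrite !(cinfD, cinfN, cinfM, csmE, cinf0) in E *; lra.
Qed.

Lemma nbl_h V W : nbl V (h W) = h (nbl V W).
Proof.
have ee' : - lam * - lam = lam * lam by rewrite mulrNN.
have H e W' : e * e = lam * lam -> eig e W' -> nbl V (h W') = h (nbl V W').
  by move=> ee eW; rewrite (nbl_eig V ee eW) eW (cn_csm bn).
have [X [Y [eX eY WE]]] := eig_decomposition W (erefl (lam * lam)).
have -> : h W = h X + h Y by rewrite {1}WE !hD hZ h_xi scaler0 addr0.
have -> : nbl V W = nbl V X + nbl V Y + V (eta W) *: xi.
  by rewrite {1}WE !(cnDr bn) (cnZr bn) nbl_xi scaler0 addr0.
rewrite (cnDr bn) (H lam) // (H (- lam)) //.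
rewrite (hD (nbl V X + nbl V Y)) (hD (nbl V X)) (hZ (V (eta W))) h_xi.
by rewrite scaler0 addr0.
Qed.

(** The tensor g((nabla_Y phi) Z, phi T) on an eigendistribution is skew in Z and T
    because phi is an isometry, and symmetric in Y and Z because the fundamental
    form is closed; so it vanishes. *)
Lemma nbl_phi_eig e X W : e * e = lam * lam -> eig e X -> eig e W ->
  nbl X (phi W) = phi (nbl X W).
Proof.
move=> ee eX eW; have e0 := eig_neq0 ee.
have ee' : - e * - e = lam * lam by rewrite mulrNN.
have e0' : - e != 0 by rewrite oppr_eq0.
have ePW : eig (- e) (nbl X (phi W) - phi (nbl X W)).
  by apply: eigD; [exact/nbl_eig/eig_phi|exact/eigN/eig_phi/nbl_eig].
pose D Y Z T := (g (nabla Y (phi Z)) (phi T) : C) - g (nabla Y Z) T.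
have skewD Y Z T : eig e Z -> eig e T -> D Y Z T = - D Y T Z.
  move=> eZ eT; have := congr1 (fun f : C => Y f : C) (g_compat Z T).
  rewrite (eig_eta e0 eZ) mul0r subr0 !lcM /D !(gC mg (phi Z)) !(gC mg Z) => E.
  apply: cinf_eq => p; have {}E := cinf_at E p.
  by rewrite !(cinfD, cinfN) in E *; lra.
have symD Y Z T : eig e Y -> eig e Z -> eig e T -> D Y Z T = D Z Y T.
  move=> eY eZ eT; rewrite (skewD Y) //.
  have H U S : eig e U -> eig e S -> g (nabla (phi T) U) (phi S) = 0 :> C.
    move=> eU eS; have eN := nbl_eig (phi T) ee eU.
    have := nbl_eig_g (phi T) e0 eU eS.
    by rewrite (eig_legendrian e0 eN eS) eta_phi mulr0 mul0r addr0 => <-.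
  have := closed_fundamental Y Z (phi T).
  rewrite (eig_phiK e0 eT) (eig_legendrian e0 eY eZ) vf0 -!lcC !gE !vfN !lcM.
  rewrite (H Y Z) // (H Z Y) // (gC mg Z) (gC mg (phi T)) /D => E.
  apply: cinf_eq => p; have {}E := cinf_at E p.
  by rewrite !(cinfD, cinfN, cinf0) in E *; lra.
have D0 Z : eig e Z -> D X W Z = 0.
  move=> eZ; apply: cinf_dbl_inj; rewrite addr0.
  rewrite {1}symD // skewD // symD // -skewD // symD // skewD // addNr //.
set U := nbl X (phi W) - phi (nbl X W) in ePW.
have etaX : eta X = 0 :> C := eig_eta e0 eX.
have etaW : eta W = 0 :> C := eig_eta e0 eW.
have UD Z : eig e Z -> g U (phi Z) = D X W Z.
  move=> eZ; have etaZ0 : eta Z = 0 :> C := eig_eta e0 eZ.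
  rewrite /U /D /nbl !(phiD, phiN, phiZ) phi_xi scaler0.
  rewrite !gE (g0l mg) !g_compat g_xil !eta_phi etaX etaW etaZ0; ring.
apply/eqP; rewrite -subr_eq0 -/U; apply/eqP/g_self_eq0.
have eZ : eig e (phi U) by have := eig_phi ePW; rewrite opprK.
have := UD _ eZ; rewrite D0 // (eig_phiK e0' ePW) gNr // => /(congr1 -%R).
by rewrite opprK oppr0.
Qed.

Lemma nbl_phi V W : nbl V (phi W) = phi (nbl V W).
Proof.
have H e Z : e * e = lam * lam -> eig e Z -> nbl V (phi Z) = phi (nbl V Z).
  move=> ee eZ; have e0 := eig_neq0 ee.
  have ee' : - e * - e = lam * lam by rewrite mulrNN.
  have [X [Y [eX eY ->]]] := eig_decomposition V ee.
  rewrite !(cnDl bn) !(cnZl bn) (phiD (nbl X Z + nbl Y Z)) (phiD (nbl X Z)).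
  rewrite (phiZ (eta V)) (nbl_phi_eig ee eX eZ).
  have H1 := nbl_phi_eig ee' eY (eig_phi eZ).
  rewrite (eig_phiK e0 eZ) (cnNr bn) in H1.
  have := congr1 phi H1; rewrite phi2_ker; last first.
    by rewrite eta_nbl eta_phi vf0.
  rewrite phiN => /oppr_inj ->; congr (_ + _ *: _).
  rewrite /nbl !eta_phi (eig_eta e0 eZ) nabla_xi_xi !(g0r mg) nabla_xi_phi.
  by rewrite !(phiD, phiZ, phiN) ?phi_xi ?scale0r ?linear0 ?scaler0.
have [X [Y [eX eY WE]]] := eig_decomposition W (erefl (lam * lam)).
have ee' : - lam * - lam = lam * lam by rewrite mulrNN.
have -> : phi W = phi X + phi Y by rewrite {1}WE !phiD phiZ phi_xi scaler0 addr0.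
have -> : nbl V W = nbl V X + nbl V Y + V (eta W) *: xi.
  by rewrite {1}WE !(cnDr bn) (cnZr bn) nbl_xi scaler0 addr0.
rewrite (cnDr bn) (H lam) // (H (- lam)) //.
rewrite (phiD (nbl V X + nbl V Y)) (phiD (nbl V X)) (phiZ (V (eta W))) phi_xi.
by rewrite scaler0 addr0.
Qed.

Lemma section_eigendist e V :
  section_of (eigendist (tensor_h phi xi) e) V <-> eig e V.
Proof.
split=> [sV|eV p]; last by exists V => //; rewrite -hdef eV at_pointZ csmE.
apply: at_point_inj => p; rewrite at_pointZ csmE.
have [V' V'p] := sV p; rewrite -hdef => hV'.
by rewrite -hV'; apply: tensorial_vf_eq; rewrite V'p.
Qed.

Lemma section_reeb_line V : section_of (reeb_line xi) V <-> V = eta V *: xi.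
Proof.
split=> [sV|VE p]; last by exists (eta V p) => //; rewrite {2}VE at_pointZ.
apply: at_point_inj => p; rewrite at_pointZ; have [t _ tV] := sV p.
rewrite -tV; congr (_ *: _).
have -> : eta V p = eta (csm M t *: xi) p.
  by apply: tensorial_fun_eq; rewrite at_pointZ csmE.
by rewrite etaZ eta_xi mulr1.
Qed.

Lemma nbl_torsion_D V W : eta V = 0 :> C -> eta W = 0 :> C ->
  torsion nbl V W = (csm M 2 * ext_d eta V W) *: xi.
Proof.
move=> eV eW; rewrite /torsion /nbl -lcC eV eW ext_dE.
have -> : csm M 2 = 1 + 1 by apply: cinf_eq => p; rewrite cinfD csmE cinf1.
have := d_eta V W; rewrite -!g_xi !lcM -lcC !gE => E.
have {}E : (g V (phi W) : C) + g V (phi W) = (g W (nabla V xi) : C) - g V (nabla W xi).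
  by rewrite E; ring.
rewrite mulrDl mul1r E; vf_ring.
Qed.

Lemma nbl_torsion_xi V : torsion nbl V xi = lie xi V - nbl xi V.
Proof. by rewrite /torsion nbl_xi (lieC V); vf_ring. Qed.

(** The terms involving the Levi-Civita connection cancel and only a multiple of
    phi V remains. *)
Lemma nbl_torsion_xi_eig e V : e * e = lam * lam -> eig e V ->
  eig (- e) (lie xi V - nbl xi V).
Proof.
move=> ee eV; have e0 := eig_neq0 ee.
suff -> : lie xi V - nbl xi V = csm M (1 + e - mu / 2) *: phi V.
  exact/eigZ/eig_phi.
rewrite -lcC /nbl (nabla_xi_eig eV) nabla_xi_xi (g0r mg) eta_xi.
apply: vfieldE => f; apply: cinf_eq => p.
rewrite !(vf_addE, vf_oppE, vf_scaleE, vf_zeroE).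
by rewrite !(cinfD, cinfN, cinfM, csmE, cinf0, cinf1); ring.
Qed.

Lemma eig_sum0 e X Y f : e != 0 -> eig e X -> eig (- e) Y -> X + Y + f *: xi = 0 ->
  X = 0 /\ Y = 0.
Proof.
move=> e0 eX eY E; have e0' : - e != 0 by rewrite oppr_eq0.
have f0 : f = 0.
  have := congr1 eta E; rewrite linear0 !etaD etaZ (eig_eta e0 eX) (eig_eta e0' eY).
  by rewrite eta_xi mulr1 !add0r.
rewrite f0 scale0r addr0 in E.
have X0 : X = 0.
  apply: g_self_eq0; have := congr1 (fun Z => g X Z : C) E.
  by rewrite !gE (g0r mg) (eig_orth e0 eX eY) addr0.
by split=> //; rewrite X0 add0r in E.
Qed.

(** For the condition on the torsion with xi, uniqueness of the splitting of [xi, V]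
    identifies the given components with those read off from the connection. *)
Lemma nbl_biLegendrian : biLegendrian_connection xi eta
  (eigendist (tensor_h phi xi) lam) (eigendist (tensor_h phi xi) (- lam)) nbl.
Proof.
have ee : lam * lam = lam * lam by [].
have ee' : - lam * - lam = lam * lam by rewrite mulrNN.
have l0' : - lam != 0 by rewrite oppr_eq0.
split=> //.
- by move=> V W /section_eigendist eW; apply/section_eigendist/nbl_eig.
- by move=> V W /section_eigendist eW; apply/section_eigendist/nbl_eig.
- move=> V W /section_reeb_line WE; apply/section_reeb_line.
  by rewrite eta_nbl {1}WE (cnZr bn) nbl_xi scaler0 addr0.
- move=> V W Z; rewrite !ext_dE nbl_metric.
  by rewrite (nbl_phi).
- move=> V W /section_eigendist eV /section_eigendist eW; apply: nbl_torsion_D.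
    exact: eig_eta eV.
  exact: eig_eta eW.
move=> V A B LL LQ QL QQ [/section_eigendist eA /section_eigendist eB [f VE]].
move=> [/section_eigendist eLL /section_eigendist eLQ [f1 E1]].
move=> [/section_eigendist eQL /section_eigendist eQQ [f2 E2]].
have H1 := nbl_torsion_xi_eig ee eA; have H2 := nbl_torsion_xi_eig ee' eB.
rewrite opprK in H2.
have eNA := nbl_eig xi ee eA; have eNB := nbl_eig xi ee' eB.
have D1 : (LL - nbl xi A) + (LQ - (lie xi A - nbl xi A)) + f1 *: xi = 0.
  by rewrite {1}E1; vf_ring.
have [_ /eqP] := eig_sum0 lam0 (eigD eLL (eigN eNA)) (eigD eLQ (eigN H1)) D1.
rewrite subr_eq0 => /eqP ->.
have D2 : (QL - (lie xi B - nbl xi B)) + (QQ - nbl xi B) + f2 *: xi = 0.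
  by rewrite {1}E2; vf_ring.
have [/eqP + _] := eig_sum0 lam0 (eigD eQL (eigN H2)) (eigD eQQ (eigN eNB)) D2.
rewrite subr_eq0 => /eqP ->.
rewrite nbl_torsion_xi VE !lieDr lieZr lievv !(cnDr bn) (cnZr bn) nbl_xi.
by vf_ring.
Qed.

(** * The rank of the eigendistributions *)

Definition lcomb k (E : 'I_k -> VF) (a : 'rV[R]_k) : VF := \sum_i csm M (a 0 i) *: E i.

Lemma at_lcomb k (E : 'I_k -> VF) a p :
  at_point (lcomb E a) p = \sum_i a 0 i *: at_point (E i) p.
Proof. by rewrite at_point_sum; apply: eq_bigr => i _; rewrite at_pointZ csmE. Qed.

Lemma eig_lcomb e k (E : 'I_k -> VF) a : (forall i, eig e (E i)) -> eig e (lcomb E a).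
Proof.
move=> eE; rewrite /lcomb.
elim/big_ind: _ => [|V W eV eW|i _]; [exact: eig0 | exact: eigD | exact: eigZ].
Qed.

Lemma phi_lcomb k (E : 'I_k -> VF) a : phi (lcomb E a) = lcomb (fun i => phi (E i)) a.
Proof. by rewrite /lcomb linear_sum; apply: eq_bigr => i _; rewrite linearZ. Qed.

Definition free_at k (E : 'I_k -> VF) p :=
  forall a : 'rV[R]_k, at_point (lcomb E a) p = 0 -> a = 0.

Section Coordinates.
Context (u : 'I_m -> C) (p : M).
Definition crd V : 'rV[R]_m := \row_j V (u j) p.
Definition crd_mx k (E : 'I_k -> VF) := \matrix_(i, j) E i (u j) p.

Lemma crdD V W : crd (V + W) = crd V + crd W.
Proof. by apply/rowP => j; rewrite !mxE. Qed.
Lemma crd_at V W : at_point V p = at_point W p -> crd V = crd W.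
Proof. by move=> E; apply/rowP => j; rewrite !mxE -!at_pointE E. Qed.

Lemma crd_lcomb k (E : 'I_k -> VF) a : crd (lcomb E a) = a *m crd_mx E.
Proof.
apply/rowP => j; rewrite !mxE -at_pointE at_lcomb tangent_sumE.
by apply: eq_bigr => i _; rewrite tangent_scaleE mxE.
Qed.

Lemma row_crd_mx k (E : 'I_k -> VF) i : row i (crd_mx E) = crd (E i).
Proof. by apply/rowP => j; rewrite !mxE. Qed.

Context (X : 'I_m -> VF).
Context (XE : forall i j, X i (u j) p = (i == j)%:R).
Context (vE : forall v : tangent p, v = \sum_i v (u i) *: at_point (X i) p).

Lemma at_crd V : at_point V p = at_point (lcomb X (crd V)) p.
Proof. by rewrite at_lcomb [LHS]vE; apply: eq_bigr => i _; rewrite mxE. Qed.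

Lemma crd_inj V W : crd V = crd W -> at_point V p = at_point W p.
Proof. by move=> VW; rewrite (at_crd V) (at_crd W) VW. Qed.

(** The difference D of the two sides is an e-eigenfield whose value at p is that of
    a sum of a (-e)-eigenfield and a multiple of xi, both orthogonal to D. *)
Lemma eig_span e V : e * e = lam * lam -> eig e V ->
  at_point V p = at_point (lcomb (fun i => eigproj e (X i)) (crd V)) p.
Proof.
move=> ee eV; have e0 : e != 0 by exact: (eig_neq0 ee).
have ee' : - e * - e = lam * lam by rewrite mulrNN.
set A := lcomb _ _; have eA : eig e A.
  by apply: eig_lcomb => i; apply: (eigproj_eig).
set B := lcomb (fun i => eigproj (- e) (X i)) (crd V); have eB : eig (- e) B.
  by apply: eig_lcomb => i; apply: (eigproj_eig).
pose f : C := \sum_i csm M (crd V 0 i) * eta (X i).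
have XAB : lcomb X (crd V) = A + B + f *: xi.
  rewrite /A /B /lcomb /f scaler_suml -!big_split /=; apply: eq_bigr => i _.
  by rewrite -(scalerA _ _ xi) -!scalerDr -(eig_split (X i) e0).
have D0 : at_point (V - A) p = at_point (B + f *: xi) p.
  by rewrite at_pointD at_pointN (at_crd V) XAB -addrA (at_pointD A) addrAC subrr add0r.
have eD : eig e (V - A) by exact/eigD/eigN.
suff : at_point (V - A) p = 0.
  by rewrite at_pointD at_pointN => /eqP; rewrite subr_eq0 => /eqP.
apply: (g_definite mg); rewrite (g_at mg _ D0) gDr // gZr // g_xi.
by rewrite (eig_orth e0 eD eB) (eig_eta e0 eD) mulr0 addr0 cinf0.
Qed.
End Coordinates.

(** The values at p of the eigenprojections of a frame span the eigenspace, and a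
    basis is extracted by Gaussian elimination. Its image under phi is a basis of
    the opposite eigenspace, so that with xi one gets a basis of the tangent space:
    the coordinate matrix F of this family is row free and row full, whence its
    number of rows. *)
Lemma eig_basis e p : e * e = lam * lam -> exists r (E : 'I_r -> VF),
  [/\ forall i, eig e (E i), free_at E p, (r + (r + 1) = m)%N &
      forall V, eig e V -> exists a, at_point V p = at_point (lcomb E a) p].
Proof.
move=> ee; have e0 : e != 0 by exact: (eig_neq0 ee).
have e0' : - e != 0 by rewrite oppr_eq0.
have ee' : - e * - e = lam * lam by rewrite mulrNN.
have [U [[oU Up] [X [u H]]]] := local_frame p; have [XE vE] := H p Up.
pose A i := eigproj e (X i).
have eA i : eig e (A i) by apply: (eigproj_eig).
pose S := crd_mx u p A; pose r := \rank S; exists r.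
have [c cS] : exists c : 'M[R]_(r, m), row_base S = c *m S.
  by apply/submxP; rewrite eq_row_base.
pose E i := lcomb A (row i c).
have ES : crd_mx u p E = row_base S.
  by apply/row_matrixP => i; rewrite row_crd_mx crd_lcomb cS row_mul.
have eE i : eig e (E i) by exact: eig_lcomb.
have freeE : free_at E p.
  move=> a aE; have : crd u p (lcomb E a) = crd u p 0.
    by apply: crd_at; rewrite aE at_point0.
  rewrite crd_lcomb ES => aS; apply: (row_free_inj (row_base_free S)).
  by rewrite mul0mx aS; apply/rowP => j; rewrite !mxE.
have spanE V : eig e V -> exists a, at_point V p = at_point (lcomb E a) p.
  move=> eV; have : (crd u p V <= S)%MS.
    apply/submxP; exists (crd u p V); rewrite -crd_lcomb; apply: crd_at.
    exact: eig_span ee eV.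
  rewrite -(eq_row_base S) => /submxP [a aE]; exists a; apply: (crd_inj vE).
  by rewrite aE crd_lcomb ES.
exists E; split=> //.
pose PE i := phi (E i).
pose F := col_mx (crd_mx u p E) (col_mx (crd_mx u p PE) (crd u p xi)).
have crdF (a b : 'rV[R]_r) (t : 'rV[R]_1) :
    crd u p (lcomb E a + (phi (lcomb E b) + csm M (t 0 0) *: xi)) =
    row_mx a (row_mx b t) *m F.
  rewrite !mul_row_col -!crd_lcomb !crdD -phi_lcomb; congr (_ + (_ + _)).
  by rewrite /lcomb big_ord1.
have freeF : row_free F.
  apply: inj_row_free => v; rewrite -[v]hsubmxK -[rsubmx v]hsubmxK.
  move: (lsubmx v) (lsubmx (rsubmx v)) (rsubmx (rsubmx v)) => a b t.
  set V := lcomb E a; set W := lcomb E b.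
  have eV : eig e V by exact: eig_lcomb.
  have eW : eig e W by exact: eig_lcomb.
  rewrite -crdF -/V -/W => T0.
  have {}T0 : at_point (V + (phi W + csm M (t 0 0) *: xi)) p = 0.
    rewrite -(at_point0 p); apply: (crd_inj vE); rewrite T0.
    by apply/rowP => j; rewrite !mxE.
  have a0 : a = 0.
    apply: freeE; apply: (g_definite mg); have := g_at0 mg V T0.
    rewrite gDr // gDr // gZr // g_xi (eig_eta e0 eV) (eig_legendrian e0 eV eW).
    by rewrite mulr0 !addr0.
  have b0 : b = 0.
    apply: freeE; apply: (g_definite mg); have := g_at0 mg (phi W) T0.
    rewrite gDr // gDr // gZr // g_xi eta_phi g_compat (eig_eta e0 eW) (gC mg (phi W)).
    by rewrite (eig_legendrian e0 eV eW) !mulr0 !addr0 subr0 add0r.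
  have t0 : t = 0.
    have := tensorial_fun eta T0; rewrite !etaD etaZ eta_xi eta_phi (eig_eta e0 eV).
    by rewrite !add0r mulr1 csmE => t00; apply/rowP => i; rewrite ord1 t00 mxE.
  by rewrite a0 b0 t0 !row_mx0.
have fullF : row_full F.
  rewrite -sub1mx; apply/row_subP => i.
  have -> : row i 1%:M = crd u p (X i).
    by apply/rowP => j; rewrite !mxE XE.
  have [V [W [eV eW VW]]] := eig_decomposition (X i) ee.
  have eW' : eig e (- phi W) by apply: eigN; have := eig_phi eW; rewrite opprK.
  have [a aE] := spanE _ eV; have [b bE] := spanE _ eW'.
  have {}bE : at_point W p = at_point (phi (lcomb E b)) p.
    rewrite -(tensorial_vf_eq phi bE); congr (at_point _ p).
    by rewrite phiN (eig_phiK e0' eW) opprK.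
  pose t : 'rV[R]_1 := \row__ eta (X i) p.
  suff -> : crd u p (X i) = row_mx a (row_mx b t) *m F by rewrite submxMl.
  rewrite -crdF; apply: crd_at; rewrite [in LHS]VW !at_pointD !at_pointZ aE bE csmE mxE.
  by rewrite addrA.
by have := eqP freeF; rewrite (eqP fullF).
Qed.

Local Notation eigd := (eigendist (tensor_h phi xi)).

Lemma eigendist_eig e p (v : tangent p) : e * e = lam * lam ->
  eigd e v <-> exists2 V, eig e V & at_point V p = v.
Proof.
move=> ee; have e0 : e != 0 by exact: (eig_neq0 ee).
split=> [[V Vp]|[V eV Vp]]; last first.
  by exists V => //; rewrite -hdef eV at_pointZ csmE Vp.
rewrite -hdef => hV; exists (eigproj e V); first exact: (eigproj_eig).
have etaV : eta V p = 0.
  have D0 : at_point (h V - csm M e *: V) p = 0.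
    by rewrite at_pointD at_pointN at_pointZ csmE hV Vp subrr.
  have := tensorial_fun eta D0; rewrite etaD etaN etaZ eta_h add0r.
  rewrite cinfN cinfM csmE => /eqP; rewrite oppr_eq0 mulf_eq0 (negPf e0) /=.
  by move=> /eqP.
rewrite /eigproj !(at_pointZ, at_pointD, at_pointN) !csmE hV Vp etaV scale0r subr0.
rewrite -scalerDl scalerA -[RHS]scale1r; congr (_ *: _); by field.
Qed.

Context (n : nat) (mn : m = n.*2.+1).

Lemma eig_basis_rank e p : e * e = lam * lam -> exists E : 'I_n -> VF,
  [/\ forall i, eig e (E i), free_at E p &
      forall V, eig e V -> exists a, at_point V p = at_point (lcomb E a) p].
Proof.
move=> ee; have [r [E [eE fE rm sE]]] := eig_basis p ee.
have rn : r = n by move: rm; rewrite mn addnA addn1 addnn => -[] /double_inj.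
by subst r; exists E.
Qed.

Lemma lcomb_change k (E E' : 'I_k -> VF) (A : 'M[R]_k) p a :
  (forall i, at_point (E i) p = at_point (lcomb E' (row i A)) p) ->
  at_point (lcomb E a) p = at_point (lcomb E' (a *m A)) p.
Proof.
move=> EA; rewrite !at_lcomb; under eq_bigr => i _ do rewrite EA at_lcomb scaler_sumr.
rewrite exchange_big /=; apply: eq_bigr => j _; rewrite mxE scaler_suml.
by apply: eq_bigr => i _; rewrite scalerA mxE.
Qed.

(** A basis at p consisting of eigenfields stays free near p, since its Gram
    determinant does; it then spans, because eig_basis_rank gives the eigenspaces
    the same dimension everywhere. *)
Lemma eig_subbundle e : e * e = lam * lam -> subbundle n (eigd e).
Proof.
move=> ee p; have [E [eE fE _]] := eig_basis_rank p ee.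
have freeE : forall c : 'I_n -> R,
    \sum_i c i *: at_point (E i) p = 0 -> forall i, c i = 0.
  move=> c cE i; have := fE (\row_i c i); rewrite at_lcomb.
  under eq_bigr => j _ do rewrite mxE.
  by move=> /(_ cE) /rowP /(_ i); rewrite !mxE.
have := gram_unit (g := g) mg freeE; set G := \matrix_(i, j) _ => Gp.
have [d [ O Op dO]] := inverse_near Gp; exists O => //; exists E => q Oq.
have fq : free_at E q.
  move=> a aE; pose Gq : 'M[R]_n := \matrix_(i, j) g (E i) (E j) q.
  have detG : \det Gq != 0.
    have -> : \det Gq = (\det G) q.
      rewrite -[RHS]/(eval_cinf q _) -det_map_mx; congr (\det _).
      by apply/matrixP => i j; rewrite !mxE.
    by apply/eqP => h0; have := dO q Oq; rewrite h0 mulr0 => /eqP; rewrite eq_sym oner_eq0.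
  have aG : a *m Gq = 0.
    apply/rowP => j; have E0 := g_at0 mg (E j) aE; rewrite !mxE -[RHS]E0.
    rewrite (gC mg) (g_suml mg) cinf_sum.
    by apply: eq_bigr => i _; rewrite gZl // cinfM csmE !mxE.
  have uG : Gq \in unitmx by rewrite unitmxE unitfE.
  by rewrite -[a](mulmxK uG) aG mul0mx.
split=> [c cE i|].
  have := fq (\row_i c i); rewrite at_lcomb.
  under eq_bigr => j _ do rewrite mxE.
  by move=> /(_ cE) /rowP /(_ i); rewrite !mxE.
apply/seteqP; split=> [v /(eigendist_eig _ ee) [V eV <-]|v [c _ <-]]; last first.
  apply/(eigendist_eig _ ee); exists (lcomb E (\row_i c i)); first exact: eig_lcomb.
  by rewrite at_lcomb; apply: eq_bigr => i _; rewrite mxE.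
have [E' [eE' fE' sE']] := eig_basis_rank q ee.
have [A AE] : exists A : 'M[R]_n, forall i, at_point (E i) q = at_point (lcomb E' (row i A)) q.
  have H i : exists a, at_point (E i) q = at_point (lcomb E' a) q by exact: sE'.
  exists (\matrix_(i, j) sval (cid (H i)) 0 j) => i.
  rewrite [LHS](svalP (cid (H i))); congr (at_point (lcomb E' _) q).
  by apply/rowP => j; rewrite !mxE.
have uA : A \in unitmx.
  rewrite -row_free_unit; apply: inj_row_free => a aA; apply: fq.
  by rewrite (lcomb_change a AE) aA at_lcomb big1 // => i _; rewrite mxE scale0r.
have [b bV] := sE' _ eV; exists (fun i => (b *m invmx A) 0 i) => //.
by rewrite -at_lcomb (lcomb_change _ AE) mulmxKV // bV.
Qed.

(** The torsion of nbl vanishes on an eigendistribution, which nbl preserves. *)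
Lemma eig_lie e V W : e * e = lam * lam -> eig e V -> eig e W -> eig e (lie V W).
Proof.
move=> ee eV eW; have e0 : e != 0 by exact: (eig_neq0 ee).
have := nbl_torsion_D (eig_eta e0 eV) (eig_eta e0 eW).
rewrite ext_dE (eig_legendrian e0 eV eW) mulr0 scale0r /torsion => /eqP.
rewrite subr_eq0 => /eqP <-; apply/eigD/eigN.
  exact: (nbl_eig _ ee eW).
exact: (nbl_eig _ ee eV).
Qed.

Lemma eig_legendrian_foliation e : e * e = lam * lam ->
  legendrian_foliation n eta (eigd e).
Proof.
move=> ee; have e0 : e != 0 by exact: (eig_neq0 ee).
have sec V := section_eigendist e V.
split; split; try exact: eig_subbundle.
- move=> p v /(eigendist_eig _ ee) [V eV <-]; exists V => //.
  by rewrite (eig_eta e0 eV) cinf0.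
- by move=> V W /sec eV /sec eW; rewrite ext_dE (eig_legendrian e0 eV eW).
- by move=> V W /sec eV /sec eW; apply/sec; exact: eig_lie.
Qed.

Lemma eig_orthogonal_biLegendrian : orthogonal_biLegendrian n eta g (eigd lam) (eigd (- lam)).
Proof.
have ee := erefl (lam * lam); have ee' : - lam * - lam = lam * lam by rewrite mulrNN.
split; try exact: eig_legendrian_foliation; last first.
  move=> V W /section_eigendist eV /section_eigendist eW.
  exact: (eig_orth lam0 eV eW).
move=> p; split=> [v [V Vp etaV]|v].
  have [X [Y [eX eY VE]]] := eig_decomposition V ee.
  exists (at_point X p), (at_point Y p); split.
  - by apply/(eigendist_eig _ ee); exists X.
  - by apply/(eigendist_eig _ ee'); exists Y.
  - by rewrite -Vp VE !at_pointD at_pointZ etaV scale0r addr0.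
move=> /(eigendist_eig _ ee) [V eV Vp] /(eigendist_eig _ ee') [W eW Wp].
rewrite -Vp; apply: (g_definite mg); rewrite (g_at mg V (W' := W)) ?Vp //.
by rewrite (eig_orth lam0 eV eW) cinf0.
Qed.

End TwoEigenvalues.

(** * From the nullity condition to a bi-Legendrian structure *)

Section KappaMuStructure.
Context (n : nat).
Context (kap mu : R) (km : forall V W, curvature nabla V W xi =
  csm M kap *: (eta W *: V - eta V *: W) + csm M mu *: (eta W *: h V - eta V *: h W)).

(** By kappa_mu_sum, g(h V, h V) = (1 - kap) g(phi V, phi V). *)
Lemma kappa_lt1 V : h V <> 0 -> kap < 1.
Proof.
move=> hV; have [p pV] : exists p, at_point (h V) p != 0.
  apply: contrapT => H; apply: hV; apply: at_point_inj => p; rewrite at_point0.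
  by apply/eqP; apply: contrapT => np; apply: H; exists p; apply/negP.
have := metric_pos mg pV; rewrite -h_sym => hp.
rewrite (kappa_mu_sum km V).1 in hp.
have ge0 := g_ge0 mg (phi V) p.
rewrite gZl // (phi_skew (phi V)) cinfM cinfN csmE in hp; nra.
Qed.

Lemma kappa_mu_structure V : h V <> 0 -> m = n.*2.+1 ->
  exists L Q, orthogonal_biLegendrian n eta g L Q /\
  exists nb, [/\ biLegendrian_connection xi eta L Q nb, parallel_endo nb phi &
    forall V W, nb V (h W) = h (nb V W)].
Proof.
move=> /kappa_lt1 k1 mn; set lam := Num.sqrt (1 - kap).
have lam2 : lam * lam = 1 - kap by rewrite -expr2 sqr_sqrtr // subr_ge0 ltW.
have lam0 : lam != 0 by rewrite gt_eqF // sqrtr_gt0 subr_gt0.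
have h2 W : h (h W) = - (csm M (lam * lam) *: phi (phi W)).
  rewrite (kappa_mu_sum km W).1 -scaleNr lam2; congr (_ *: _).
  by apply: cinf_eq => p; rewrite cinfN !csmE opprB.
have dh W := (kappa_mu_sum km W).2.
have flat V1 W : eta V1 = 0 -> eta W = 0 -> curvature nabla V1 W xi = 0.
  by move=> eV eW; rewrite km eV eW !scale0r subrr !scaler0 addr0.
exists (eigendist (tensor_h phi xi) lam), (eigendist (tensor_h phi xi) (- lam)); split.
  exact: (eig_orthogonal_biLegendrian lam0 h2 dh flat mn).
exists (nbl mu); split.
- exact: (nbl_biLegendrian lam0 h2 dh flat).
- exact: (nbl_phi lam0 h2 dh flat).
- exact: (nbl_h lam0 h2 dh flat).
Qed.
End KappaMuStructure.

(** * Orthogonal bi-Legendrian structures *)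

Section BiLegendrian.
Context (n : nat) (L Q : tangent_distribution M)
  (ob : orthogonal_biLegendrian n eta g L Q).
Local Notation sL := (section_of L).
Local Notation sQ := (section_of Q).

(** With biLegendrian_connection_sym below, this lets every statement about L be
    used for Q as well. *)
Lemma orthogonal_biLegendrian_sym : orthogonal_biLegendrian n eta g Q L.
Proof.
have [lL lQ cLQ oLQ] := ob; split=> //.
  move=> p; have [c1 c2] := cLQ p; split=> v; last by move=> Qv Lv; exact: c2.
  by move=> /c1 [l [q [Ll Qq ->]]]; exists q, l; rewrite addrC.
by move=> V W QV LW; rewrite (Defs.metric_sym mg) oLQ.
Qed.

Lemma sub_L : subbundle n L. Proof. by have [[[]]] := ob. Qed.
Lemma sub_Q : subbundle n Q. Proof. by have [_ [[]]] := ob. Qed.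

Lemma section_lin k (D : tangent_distribution M) f V W : subbundle k D ->
  section_of D V -> section_of D W -> section_of D (f *: V + W).
Proof.
move=> sD DV DW p; rewrite at_pointD at_pointZ; exact: (subbundle_submod sD).
Qed.

Lemma section0 k (D : tangent_distribution M) : subbundle k D -> section_of D 0.
Proof. by move=> sD p; rewrite at_point0; exact: (subbundle0 p sD). Qed.

Lemma sLZ f V : sL V -> sL (f *: V).
Proof. by move=> LV; rewrite -[_ *: _]addr0; apply: (section_lin _ sub_L LV (section0 sub_L)). Qed.
Lemma sLD V W : sL V -> sL W -> sL (V + W).
Proof. by move=> LV; have := section_lin 1 sub_L LV; rewrite scale1r; apply. Qed.
Lemma sLN V : sL V -> sL (- V).
Proof. by rewrite -scaleN1r; exact: sLZ. Qed.
Lemma sL0 : sL 0. Proof. exact: (section0 sub_L). Qed.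
Lemma sQZ f V : sQ V -> sQ (f *: V).
Proof. by move=> QV; rewrite -[_ *: _]addr0; apply: (section_lin _ sub_Q QV (section0 sub_Q)). Qed.
Lemma sQD V W : sQ V -> sQ W -> sQ (V + W).
Proof. by move=> QV; have := section_lin 1 sub_Q QV; rewrite scale1r; apply. Qed.
Lemma sQN V : sQ V -> sQ (- V).
Proof. by rewrite -scaleN1r; exact: sQZ. Qed.
Lemma sQ0 : sQ 0. Proof. exact: (section0 sub_Q). Qed.

Lemma section_eta (D : tangent_distribution M) V :
  (forall p, D p `<=` @contact_dist _ _ _ eta p) -> section_of D V -> eta V = 0 :> C.
Proof.
move=> Dc DV; apply: cinf_eq => p; have : @contact_dist _ _ _ eta p (at_point V p) by exact/Dc/DV.
move=> [W Wp W0].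
by rewrite -[RHS]W0; apply: tensorial_fun_eq.
Qed.

Lemma sL_eta V : sL V -> eta V = 0 :> C.
Proof. by apply: section_eta; have [[[]]] := ob. Qed.
Lemma sQ_eta V : sQ V -> eta V = 0 :> C.
Proof. by apply: section_eta; have [_ [[]]] := ob. Qed.

Lemma LQ_orth V W : sL V -> sQ W -> g V W = 0 :> C.
Proof. by have [_ _ _] := ob; apply. Qed.
Lemma QL_orth V W : sQ V -> sL W -> g V W = 0 :> C.
Proof. by move=> QV LW; rewrite (gC mg) LQ_orth. Qed.
Lemma LL_phi V W : sL V -> sL W -> g V (phi W) = 0 :> C.
Proof. by rewrite -ext_dE; have [[[_ _ +] _] _ _ _] := ob; apply. Qed.
Lemma QQ_phi V W : sQ V -> sQ W -> g V (phi W) = 0 :> C.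
Proof. by rewrite -ext_dE; have [_ [[_ _ +] _] _ _] := ob; apply. Qed.
Lemma sL_lie V W : sL V -> sL W -> sL (lie V W).
Proof. by have [[_ [_ iL]] _ _ _] := ob; exact: iL. Qed.

(** Complementarity only provides tangent vectors; the component in L becomes a
    smooth section by taking the orthogonal projection. *)
Lemma biLegendrian_decomposition V : exists A B,
  [/\ sL A, sQ B & V = A + B + eta V *: xi].
Proof.
have [V0 VE etaV0] : exists2 V0, V = V0 + eta V *: xi & eta V0 = 0 :> C.
  exists (V - eta V *: xi); first by rewrite subrK.
  by rewrite etaD etaN etaZ eta_xi mulr1 subrr.
have [A LA HA] := orthogonal_projection mg V0 sub_L.
exists A, (V0 - A); split=> //; last by rewrite {1}VE (addrC A) subrK.
move=> p; have [_ _ /(_ p) [cLQ _] _] := ob.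
have [|l [q [Ll Qq V0E]]] := cLQ (at_point V0 p).
  by exists V0 => //; rewrite etaV0.
have [X LX Xl] := section_extends sub_L Ll.
have [Y QY Yq] := section_extends sub_Q Qq.
have V0p : at_point (V0 - A) p = at_point (X - A + Y) p.
  by rewrite !at_pointD !at_pointN V0E Xl Yq addrAC.
have LXA : sL (X - A) by apply/sLD/sLN.
have XA0 : at_point (X - A) p = 0.
  apply: (g_definite mg); have := cinf_at (HA _ LXA) p.
  rewrite (gC mg) (g_at mg _ V0p) gDr // cinfD (gC mg _ Y) (QL_orth QY LXA).
  by rewrite addr0.
by rewrite V0p at_pointD XA0 add0r.
Qed.

(** L is Legendrian: phi V is orthogonal to L. *)
Lemma sL_phi V : sL V -> sQ (phi V).
Proof.
move=> LV; have [A [B [LA QB VE]]] := biLegendrian_decomposition (phi V).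
rewrite eta_phi scale0r addr0 in VE.
have := LL_phi LA LV; rewrite VE !gE (LQ_orth LA QB) addr0 => /g_self_eq0 ->.
by rewrite add0r.
Qed.

Lemma sQ_phi V : sQ V -> sL (phi V).
Proof.
move=> QV; have [A [B [LA QB VE]]] := biLegendrian_decomposition (phi V).
rewrite eta_phi scale0r addr0 in VE.
have := QQ_phi QB QV; rewrite VE !gE (QL_orth QB LA) add0r => /g_self_eq0 ->.
by rewrite addr0.
Qed.

Lemma sL_phiK V : sL V -> phi (phi V) = - V.
Proof. by move=> /sL_eta; exact: phi2_ker. Qed.
Lemma sQ_phiK V : sQ V -> phi (phi V) = - V.
Proof. by move=> /sQ_eta; exact: phi2_ker. Qed.

Lemma LQ_sum0 A B f : sL A -> sQ B -> A + B + f *: xi = 0 -> A = 0 /\ B = 0.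
Proof.
move=> LA QB E.
have f0 : f = 0.
  have := congr1 eta E; rewrite linear0 !etaD etaZ (sL_eta LA) (sQ_eta QB).
  by rewrite eta_xi mulr1 !add0r.
rewrite f0 scale0r addr0 in E.
have A0 : A = 0.
  apply: g_self_eq0; have := congr1 (fun Z => g A Z : C) E.
  by rewrite !gE (g0r mg) (LQ_orth LA QB) addr0.
by split=> //; rewrite A0 add0r in E.
Qed.

(** If v is an eigenvector for l, comparing its components in L, Q and along xi with
    those of its image shows that the last two vanish, l being nonzero. *)
Lemma eigendist_of_scalar (l : R) : l != 0 ->
  (forall X, sL X -> h X = csm M l *: X) -> (forall Y, sQ Y -> h Y = csm M (- l) *: Y) ->
  L = eigendist (tensor_h phi xi) l.
Proof.
move=> l0 hL hQ; apply: functional_extensionality_dep => p; apply/seteqP; split=> [v Lv|v [V Vp]].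
  have [X LX Xp] := section_extends sub_L Lv; exists X => //.
  by rewrite -hdef hL // at_pointZ csmE Xp.
rewrite -hdef => hV; have [A [B [LA QB VE]]] := biLegendrian_decomposition V.
suff AV : at_point V p = at_point A p by rewrite -Vp AV; exact: LA.
(* At p, l A - l B = l (A + B + eta V xi). *)
pose D := csm M 2 *: B + eta V *: xi.
have D0 : at_point D p = 0.
  apply: (scalerI l0); rewrite scaler0; move: hV; rewrite -Vp [in LHS]VE !hD hZ h_xi hL // hQ //.
  rewrite scaler0 addr0 => E; apply/eqP; rewrite -(subrr (l *: at_point V p)) -{2}E.
  rewrite VE /D !(at_pointD, at_pointZ) !csmE !scalerDr !scalerA scaleNr; apply/eqP.
  apply: tangentE => f; rewrite !(tangent_addE, tangent_oppE, tangent_scaleE).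
  by rewrite /GRing.scale /=; ring.
have B0 : at_point B p = 0.
  apply: (g_definite mg); have := g_at0 mg B D0.
  rewrite /D gDr // !gZr // g_xi (sQ_eta QB) mulr0 addr0 cinfM csmE => /eqP.
  by rewrite mulf_eq0 pnatr_eq0 /= => /eqP.
have x0 : eta V p = 0.
  have := tensorial_fun eta D0; rewrite /D etaD !etaZ (sQ_eta QB) eta_xi mulr0 add0r.
  by rewrite mulr1.
by rewrite VE !at_pointD at_pointZ B0 x0 scale0r !addr0.
Qed.

Lemma subbundle0_section V : n = 0%N -> sL V -> V = 0.
Proof.
move=> n0 LV; apply: at_point_inj => p; rewrite at_point0.
have [U [_ Up] [E H]] := sub_L p; have [_ Lp] := H p Up.
have := LV p; rewrite Lp => -[c _ <-]; rewrite big1 // => i.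
by have := ltn_ord i; rewrite {2}n0.
Qed.

(** * The bi-Legendrian connection *)

Context (nb : VF -> VF -> VF) (bl : biLegendrian_connection xi eta L Q nb).

Lemma biLegendrian_connection_sym : biLegendrian_connection xi eta Q L nb.
Proof.
case: bl => c pL pQ px pd tLQ tx; split=> //.
  move=> V W QV LW; rewrite torsionC tLQ // !ext_dE (gC mg) phi_skew.
  by apply: vfieldE => f; rewrite vf_oppE !vf_scaleE; ring.
move=> V VQ VL QQ QL LQ LL [QVQ LVL [f VE]] [Q1 L1 [f1 E1]] [Q2 L2 [f2 E2]].
rewrite addrC; apply: (tx V VL VQ LL LQ QL QQ); split=> //.
- by exists f; rewrite VE (addrC VL).
- by exists f2; rewrite E2 (addrC LL).
- by exists f1; rewrite E1 (addrC QL).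
Qed.

Context (pphi : parallel_endo nb phi).
Let bn : connection nb := bl_connection bl.

Lemma nbL V W : sL W -> sL (nb V W). Proof. exact: (bl_preserves_L bl). Qed.
Lemma nbQ V W : sQ W -> sQ (nb V W). Proof. exact: (bl_preserves_Q bl). Qed.

Lemma nb_reeb V : nb V xi = eta (nb V xi) *: xi.
Proof.
apply/section_reeb_line/(bl_preserves_xi bl)/section_reeb_line.
by rewrite eta_xi scale1r.
Qed.

Lemma eta_nb_D V W : eta W = 0 :> C -> eta (nb V W) = 0 :> C.
Proof.
move=> eW; have [A [B [LA QB ->]]] := biLegendrian_decomposition W.
rewrite eW scale0r addr0 (cnDr bn) etaD (sL_eta (nbL V LA)) (sQ_eta (nbQ V QB)).
by rewrite addr0.
Qed.

(** nb preserves d eta and phi, hence g(W, Z) = - d eta (W, phi Z) for Z in the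
    contact distribution. *)
Lemma nb_metric V W Z : eta Z = 0 :> C ->
  V (g W Z) = (g (nb V W) Z : C) + g W (nb V Z) :> C.
Proof.
move=> eZ; have := bl_parallel bl V W (phi Z).
rewrite !ext_dE pphi !phi2_ker //; last exact: eta_nb_D.
by rewrite !gE vfN -opprD => /oppr_inj.
Qed.

Lemma nb_torsion_LQ X Y : sL X -> sQ Y ->
  torsion nb X Y = ((g X (phi Y) : C) + g X (phi Y)) *: xi.
Proof.
move=> LX QY; rewrite (bl_torsion_LQ bl) // ext_dE; congr (_ *: xi).
by apply: cinf_eq => p; rewrite cinfM cinfD csmE mulr2n mulrDl mul1r.
Qed.

(** On sections V of L or Q this is the torsion T(V, xi), as xi is parallel in those
    directions. *)
Definition reeb_torsion V := lie xi V - nb xi V.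
Local Notation tau := reeb_torsion.

Lemma reeb_torsionD V W : tau (V + W) = tau V + tau W.
Proof. rewrite /reeb_torsion lieDr (cnDr bn); vf_ring. Qed.
Lemma reeb_torsionZ f V : tau (f *: V) = f *: tau V.
Proof. rewrite /reeb_torsion lieZr (cnZr bn); vf_ring. Qed.

(** The prescribed value of T(X, xi) is the Q-component of [xi, X]. In the resulting
    equation nb X xi is a multiple of xi, the rest is a section of L, and so both
    vanish. *)
Lemma nb_reeb_L X : sL X -> nb X xi = 0 /\ sQ (tau X).
Proof.
move=> LX; have [LL [LQ [LLL QLQ E]]] := biLegendrian_decomposition (lie xi X).
rewrite eta_lie_xi (sL_eta LX) vf0 scale0r addr0 in E.
have : torsion nb X xi = LQ + 0.
  apply: (bl_torsion_xi bl (VL := X) (VQ := 0) (LL := LL) (QQ := 0)).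
  - by split; [| exact: sQ0 | exists 0; rewrite scale0r !addr0].
  - by split=> //; exists 0; rewrite scale0r !addr0.
  - by split; [exact: sL0 | exact: sQ0 | exists 0; rewrite lie0r scale0r !addr0].
rewrite addr0 /torsion (lieC X) E => T.
have {}T : nb X xi = nb xi X - LL.
  apply/eqP; rewrite -subr_eq0; apply/eqP.
  transitivity (nb X xi - nb xi X - - (LL + LQ) - LQ); first by vf_ring.
  by rewrite T subrr.
have [||D _] := LQ_sum0 (A := nb xi X - LL) (B := 0) (f := - eta (nb X xi)) _ sQ0.
- by apply/sLD/sLN => //; exact: nbL.
- by rewrite -T addr0 scaleNr -nb_reeb subrr.
split; first by rewrite T D.
have -> : tau X = LQ - (nb xi X - LL) by rewrite /reeb_torsion E; vf_ring.
by rewrite D subr0.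
Qed.

Lemma reeb_torsion_L X : sL X -> sQ (tau X). Proof. by case/nb_reeb_L. Qed.
Lemma nb_xi_L X : sL X -> nb X xi = 0. Proof. by case/nb_reeb_L. Qed.

(** Closedness of the fundamental form on (xi, X, X'). *)
Lemma reeb_torsion_sym X X' : sL X -> sL X' -> g (tau X) (phi X') = g (tau X') (phi X) :> C.
Proof.
move=> LX LX'; have := closed_fundamental xi X X'.
rewrite phi_xi !(g0r mg) !vf0 (LL_phi LX LX') vf0 g_xil eta_phi vf0 (lieC X') !gE.
have E U : lie xi U = tau U + nb xi U by rewrite /reeb_torsion subrK.
rewrite !E !gE (LL_phi (nbL xi LX) LX') (LL_phi (nbL xi LX') LX) => H.
apply: cinf_eq => p; have {}H := cinf_at H p.
by rewrite !(cinfD, cinfN, cinf0) in H *; lra.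
Qed.

(** The torsion of two sections of L lies in L because L is involutive, and it is
    orthogonal to L = phi Q by closedness of the fundamental form on (X, X', Y). *)
Lemma nb_torsion_LL X X' : sL X -> sL X' -> torsion nb X X' = 0.
Proof.
move=> LX LX'; apply: g_self_eq0; set D := torsion nb X X'.
have LD : sL D.
  by rewrite /D /torsion; apply: sLD; [apply: sLD; [|apply: sLN]|apply: sLN];
    [exact: nbL|exact: nbL|exact: sL_lie].
suff H Y : sQ Y -> g D (phi Y) = 0 :> C.
  by have := H _ (sL_phi LD); rewrite (sL_phiK LD) gE => /(congr1 -%R); rewrite opprK oppr0.
move=> QY; have := closed_fundamental X X' Y.
have T1 : lie X' Y = nb X' Y - nb Y X' - torsion nb X' Y by rewrite /torsion; vf_ring.
have T2 : lie Y X = nb Y X - nb X Y + torsion nb X Y by rewrite /torsion (lieC Y); vf_ring.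
rewrite T1 T2 !nb_torsion_LQ // (LL_phi LX LX') vf0.
have eY := sQ_eta QY; have eX := sL_eta LX; have eX' := sL_eta LX'.
rewrite !nb_metric ?eta_phi // !pphi !gE !g_xil !eta_phi.
rewrite (LL_phi (nbL Y LX') LX) (LL_phi (nbL Y LX) LX').
rewrite /D /torsion ?gE.
rewrite (gC mg Y (phi (nb X' X))) (gC mg X' (phi (nb X Y))) !phi_skew.
move=> E; apply: cinf_eq => p; have {}E := cinf_at E p.
by rewrite !(cinfD, cinfN, cinfM, cinf0) in E *; lra.
Qed.

Lemma curvature_L U V X : sL X -> sL (curvature nb U V X).
Proof.
move=> LX; rewrite /curvature; apply/sLD/sLN/nbL => //.
by apply/sLD/sLN; apply/nbL/nbL.
Qed.
Lemma curvature_Q U V X : sQ X -> sQ (curvature nb U V X).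
Proof.
move=> QX; rewrite /curvature; apply/sQD/sQN/nbQ => //.
by apply/sQD/sQN; apply/nbQ/nbQ.
Qed.

(** nb is metric on the contact distribution. *)
Lemma curvature_skew U V X X' : eta X = 0 :> C -> eta X' = 0 :> C ->
  g (curvature nb U V X) X' = - (g (curvature nb U V X') X : C) :> C.
Proof.
move=> eX eX'.
have E1 := nb_metric (lie U V) X eX'; rewrite lieE in E1.
rewrite !nb_metric ?eta_nb_D // !vfD !nb_metric ?eta_nb_D // in E1.
rewrite /curvature !gE !(gC mg _ X).
apply: cinf_eq => p; have {}E1 := cinf_at E1 p.
by rewrite !(cinfD, cinfN) in E1 *; lra.
Qed.

End BiLegendrian.

(** * The torsion of the bi-Legendrian connection with the Reeb field *)

Section ReebTorsion.
Context (n : nat) (L Q : tangent_distribution M)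
  (ob : orthogonal_biLegendrian n eta g L Q).
Local Notation sL := (section_of L).
Local Notation sQ := (section_of Q).
Context (nb : VF -> VF -> VF) (bl : biLegendrian_connection xi eta L Q nb).
(* Earlier results for the fixed pair (L, Q); below, ob' and bl' give access to
   those for (Q, L). *)
Let sLD := @sLD n L Q ob.
Let sLN := @sLN n L Q ob.
Let sQZ := @sQZ n L Q ob.
Let sQD := @sQD n L Q ob.
Let sQN := @sQN n L Q ob.
Let sL_eta := @sL_eta n L Q ob.
Let sQ_eta := @sQ_eta n L Q ob.
Let LQ_orth := @LQ_orth n L Q ob.
Let QL_orth := @QL_orth n L Q ob.
Let biLegendrian_decomposition := @biLegendrian_decomposition n L Q ob.
Let sL_phi := @sL_phi n L Q ob.
Let sQ_phi := @sQ_phi n L Q ob.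
Let sL_phiK := @sL_phiK n L Q ob.
Let sQ_phiK := @sQ_phiK n L Q ob.
Context (pphi : parallel_endo nb phi).
Let bn : connection nb := bl_connection bl.
(* An abstract tau keeps its definition out of the way of rewriting. *)
Context (tau : VF -> VF) (tau_def : forall V, tau V = reeb_torsion nb V).
Let nbL := @nbL L Q nb bl.
Let nbQ := @nbQ L Q nb bl.
Let nb_reeb V : nb V xi = eta (nb V xi) *: xi := nb_reeb bl V.
Let ob' : orthogonal_biLegendrian n eta g Q L := orthogonal_biLegendrian_sym ob.
Let bl' : biLegendrian_connection xi eta Q L nb := biLegendrian_connection_sym bl.
Let T_LQ X Y (LX : sL X) (QY : sQ Y) := nb_torsion_LQ bl LX QY.
Let T_QL Y X (QY : sQ Y) (LX : sL X) := nb_torsion_LQ bl' QY LX.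
Let T_LL X X' (LX : sL X) (LX' : sL X') := nb_torsion_LL ob bl pphi LX LX'.
Let T_QQ Y Y' (QY : sQ Y) (QY' : sQ Y') := nb_torsion_LL ob' bl' pphi QY QY'.
Let nb_xi_Q Y (QY : sQ Y) : nb Y xi = 0 := nb_xi_L ob' bl' QY.
Let nb_xi_L X (LX : sL X) : nb X xi = 0 := nb_xi_L ob bl LX.

Lemma tauD V W : tau (V + W) = tau V + tau W.
Proof. by rewrite !tau_def (reeb_torsionD bl). Qed.
Lemma tauZ f V : tau (f *: V) = f *: tau V.
Proof. by rewrite !tau_def (reeb_torsionZ bl). Qed.
Lemma tau_L X : sL X -> sQ (tau X).
Proof. by rewrite tau_def; exact: (reeb_torsion_L ob bl). Qed.
Lemma tau_Q Y : sQ Y -> sL (tau Y).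
Proof. by rewrite tau_def; exact: (reeb_torsion_L ob' bl'). Qed.
Lemma tau_sym X X' : sL X -> sL X' -> g (tau X) (phi X') = g (tau X') (phi X) :> C.
Proof. by rewrite !tau_def; exact: (reeb_torsion_sym ob bl). Qed.

Lemma T_xi_L X : sL X -> torsion nb xi X = - tau X.
Proof. by move=> LX; rewrite tau_def /torsion (nb_xi_L LX) /reeb_torsion; vf_ring. Qed.
Lemma T_xi_Q Y : sQ Y -> torsion nb xi Y = - tau Y.
Proof. by move=> QY; rewrite tau_def /torsion (nb_xi_Q QY) /reeb_torsion; vf_ring. Qed.
Lemma lie_xi_split V : lie xi V = tau V + nb xi V.
Proof. by rewrite tau_def subrK. Qed.

Lemma torsion_L_test_Q U X Y : sL X -> sQ Y ->
  g (torsion nb U X) Y = - (eta U * g (tau X) Y) :> C.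
Proof.
move=> LX QY; have [A [B [LA QB UE]]] := biLegendrian_decomposition U.
rewrite {1}UE !(torsionDl bn) (torsionZl bn) T_LL // T_QL // T_xi_L //.
rewrite !gE (g0l mg) g_xil (sQ_eta QY); ring.
Qed.

Lemma torsion_L_test_L U X X' : sL X -> sL X' -> g (torsion nb U X) X' = 0 :> C.
Proof.
move=> LX LX'; have [A [B [LA QB ->]]] := biLegendrian_decomposition U.
rewrite !(torsionDl bn) (torsionZl bn) T_LL // T_QL // T_xi_L //.
rewrite !gE (g0l mg) g_xil (sL_eta LX') (QL_orth (tau_L LX) LX'); ring.
Qed.

Lemma torsion_Q_test_L U Y X : sQ Y -> sL X ->
  g (torsion nb U Y) X = - (eta U * g (tau Y) X) :> C.
Proof.
move=> QY LX; have [A [B [LA QB UE]]] := biLegendrian_decomposition U.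
rewrite {1}UE !(torsionDl bn) (torsionZl bn) (T_LQ LA QY) (T_QQ QB QY) T_xi_Q //.
rewrite !gE (g0l mg) g_xil (sL_eta LX); ring.
Qed.

Lemma torsion_Q_test_Q U Y Y' : sQ Y -> sQ Y' -> g (torsion nb U Y) Y' = 0 :> C.
Proof.
move=> QY QY'; have [A [B [LA QB ->]]] := biLegendrian_decomposition U.
rewrite !(torsionDl bn) (torsionZl bn) (T_LQ LA QY) (T_QQ QB QY) T_xi_Q //.
rewrite !gE (g0l mg) g_xil (sQ_eta QY') (LQ_orth (tau_Q QY) QY'); ring.
Qed.

Lemma eta_lie_LQ V W : eta V = 0 :> C -> eta W = 0 :> C ->
  eta (lie V W) = - ((g V (phi W) : C) + g V (phi W)) :> C.
Proof. by move=> eV eW; rewrite d_eta eV eW !vf0; ring. Qed.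

Lemma g_nb_reeb_scale V f Z : eta Z = 0 :> C -> g (nb V (f *: xi)) Z = 0 :> C.
Proof.
move=> eZ; rewrite (cnZr bn) nb_reeb !gE g_xil eZ; ring.
Qed.

Lemma bianchi_test U V W Z :
  (g (curvature nb U V W) Z : C) + g (curvature nb V W U) Z + g (curvature nb W U V) Z =
  (g (nb U (torsion nb V W)) Z : C) + g (nb V (torsion nb W U)) Z
  + g (nb W (torsion nb U V)) Z - (g (torsion nb (lie U V) W) Z : C)
  - g (torsion nb (lie V W) U) Z - g (torsion nb (lie W U) V) Z :> C.
Proof.
have := congr1 (fun V => g V Z : C) (bianchi bn U V W).
move: (curvature nb U V W) (curvature nb V W U) (curvature nb W U V) => a b c.
move: (torsion nb (lie U V) W) (torsion nb (lie V W) U) (torsion nb (lie W U) V).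
move=> d e f; rewrite !gE => ->; ring.
Qed.

(** The Bianchi identity paired with Y': the two curvature terms applied to sections
    of L are orthogonal to Q. *)
Lemma curvature_LLQ X X' Y Y' : sL X -> sL X' -> sQ Y -> sQ Y' ->
  csm M 2^-1 * g (curvature nb X X' Y) Y' =
  g X (phi Y) * g (tau X') Y' - g X' (phi Y) * g (tau X) Y' :> C.
Proof.
move=> LX LX' QY QY'; have eY' := sQ_eta QY'.
have := bianchi_test X X' Y Y'.
rewrite (LQ_orth (curvature_L ob bl X' Y LX) QY').
rewrite (LQ_orth (curvature_L ob bl Y X LX') QY') (T_LL LX LX') (cn0r bn) (g0l mg).
rewrite (T_LQ LX' QY) (T_QL QY LX) !g_nb_reeb_scale // (torsion_Q_test_Q _ QY QY').
rewrite (torsion_L_test_Q _ LX QY') (torsion_L_test_Q _ LX' QY').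
rewrite !eta_lie_LQ ?(sL_eta LX) ?(sL_eta LX') ?(sQ_eta QY) //.
rewrite (gC mg Y (phi X)) phi_skew !addr0 => ->; apply: cinf_eq => p.
by rewrite !(cinfD, cinfN, cinfM, csmE, cinf0); field.
Qed.

(** Take Y = phi X and Y' = phi X' in curvature_LLQ, and compare with the result for
    Y and Y' exchanged by means of the skew-symmetry of the curvature. *)
Lemma tau_quadratic X X' : sL X -> sL X' ->
  g X X * g (tau X') (phi X') = g X' X' * g (tau X) (phi X) :> C.
Proof.
move=> LX LX'; have Q1 := sL_phi LX; have Q2 := sL_phi LX'.
have E1 := curvature_LLQ LX LX' Q1 Q2; have E2 := curvature_LLQ LX LX' Q2 Q1.
rewrite (curvature_skew ob bl pphi _ _ (sQ_eta Q2) (sQ_eta Q1)) in E2.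
rewrite !(sL_phiK LX) !(sL_phiK LX') !gE in E1 E2.
rewrite (tau_sym LX' LX) (gC mg X' X) in E1 E2.
apply: cinf_eq => p; have {}E1 := cinf_at E1 p; have {}E2 := cinf_at E2 p.
rewrite !(cinfD, cinfN, cinfM, csmE) in E1 E2 *.
lra.
Qed.

(** By tau_quadratic the quadratic forms g(tau X, phi X) and g(X, X) on L are
    proportional at p; the conclusion follows by polarisation. *)
Lemma tau_at p X0 : sL X0 -> g X0 X0 p != 0 -> forall X, sL X ->
  at_point (tau X) p = (g (tau X0) (phi X0) p / g X0 X0 p) *: at_point (phi X) p.
Proof.
move=> LX0 N0 X LX; set rho := _ / _.
have quad Y : sL Y -> g (tau Y) (phi Y) p = rho * g Y Y p.
  move=> LY; have := cinf_at (tau_quadratic LX0 LY) p; rewrite !cinfM => E.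
  by apply: (mulfI N0); rewrite E /rho; field.
have polar Y : sL Y -> g (tau X) (phi Y) p = rho * g X Y p.
  move=> LY; have := quad _ (sLD LX LY); have := quad _ LX; have := quad _ LY.
  have := cinf_at (tau_sym LX LY) p.
  rewrite tauD phiD !gE !cinfD (gC mg Y X); lra.
pose V := tau X - csm M rho *: phi X.
have QV : sQ V by apply/sQD/sQN/sQZ/sL_phi => //; exact: tau_L.
have LW := sLN (sQ_phi QV); set W := - phi V in LW.
have VW : V = phi W by rewrite /W phiN (sQ_phiK QV) opprK.
have V0 : at_point V p = 0.
  apply: (g_definite mg); rewrite {2}VW {1}/V gDl // gNl // gZl // g_compat (sL_eta LX).
  by rewrite cinfD cinfN !cinfM cinfD cinfN cinfM cinf0 csmE polar // mul0r subr0 subrr.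
by apply/eqP; rewrite -subr_eq0 -[rho](csmE rho p) -at_pointZ -at_pointN -at_pointD V0.
Qed.

Lemma section_nonzero p : (0 < n)%N -> exists2 X, sL X & g X X p != 0.
Proof.
move=> n0; have sub := sub_L ob; have [U [oU Up] [E H]] := sub p.
have [free Lp] := H p Up; pose i0 := Ordinal n0.
have LE : @L p (at_point (E i0) p).
  rewrite Lp; exists (fun i => (i == i0)%:R) => //.
  rewrite (bigD1 i0) // big1 => [|i /negPf ->]; last by rewrite scale0r.
  by rewrite eqxx scale1r; exact: addr0.
have [X LX Xp] := section_extends sub LE; exists X => //.
apply/eqP => /(g_definite mg); rewrite Xp => E0.
have S0 : \sum_i (i == i0)%:R *: at_point (E i) p = 0.
  rewrite (bigD1 i0) // big1 => [|i /negPf ->]; last by rewrite scale0r.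
  by rewrite E0 scaler0; exact: addr0.
by have := free _ S0 i0; rewrite eqxx => /eqP; rewrite oner_eq0.
Qed.

(** The factor of tau_at is determined by tau, since phi X does not vanish where X
    does not; the local expressions for it therefore agree and are smooth. *)
Lemma tau_scalar : (0 < n)%N -> exists a : C, forall X, sL X -> tau X = a *: phi X.
Proof.
move=> n0.
have [s Hs] : exists s : M -> VF, forall p, sL (s p) /\ g (s p) (s p) p != 0.
  have H p : exists X, sL X /\ g X X p != 0.
    by have [X] := section_nonzero p n0; exists X.
  by exists (fun p => sval (cid (H p))) => p; exact: (svalP (cid (H p))).
pose r p := g (tau (s p)) (phi (s p)) p / g (s p) (s p) p.
have rP p X : sL X -> at_point (tau X) p = r p *: at_point (phi X) p.
  by move=> LX; have [Ls Ns] := Hs p; exact: tau_at.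
have uniq_r p X c : sL X -> g X X p != 0 ->
    at_point (tau X) p = c *: at_point (phi X) p -> r p = c.
  move=> LX N0; rewrite rP // => /eqP; rewrite -subr_eq0 -scalerBl => /eqP E.
  apply/eqP; rewrite -subr_eq0; apply: contraT => c0; move/negP: N0; case.
  apply/eqP; have P0 : at_point (phi X) p = 0.
    by rewrite -[LHS]scale1r -(mulVf c0) -scalerA E scaler0.
  rewrite -[X in g X _]opprK -(sL_phiK LX) gNl // cinfN.
  have e0 : at_point (phi (phi X)) p = at_point (0 : VF) p.
    by rewrite at_point0; exact: tensorial_vf P0.
  by rewrite (gC mg) (g_at mg _ e0) g0r // cinf0 oppr0.
have [a ar] : exists a : C, forall p, a p = r p.
  apply: glue_cinf => p; have [Ls N0] := Hs p.
  have [e [ O oO He]] := inverse_near N0.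
  exists (e * g (tau (s p)) (phi (s p))); exists O => // q Oq.
  have Nq : g (s p) (s p) q != 0.
    by apply/eqP => h0; have := He q Oq; rewrite h0 mulr0 => /eqP; rewrite eq_sym oner_eq0.
  apply: (uniq_r q _ _ Ls Nq); rewrite (tau_at Ls Nq Ls); congr (_ *: _).
  rewrite cinfM mulrC; congr (_ * _).
  by apply: (mulIf Nq); rewrite He // mulVf.
by exists a => X LX; apply: at_point_inj => p; rewrite rP // at_pointZ ar.
Qed.

Lemma g_torsion_reeb U Z : eta Z = 0 :> C -> g (torsion nb U xi) Z = g (tau U) Z :> C.
Proof.
move=> eZ; have -> : torsion nb U xi = tau U + nb U xi.
  by rewrite tau_def /torsion /reeb_torsion (lieC U); vf_ring.
by rewrite gDl // nb_reeb gZl // g_xil eZ mulr0 addr0.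
Qed.

Lemma g_tau_reeb f Z : eta Z = 0 :> C -> g (tau (f *: xi)) Z = 0 :> C.
Proof.
move=> eZ; rewrite tauZ gZl // tau_def /reeb_torsion lievv nb_reeb gDl // g0l // gNl //.
by rewrite gZl // g_xil eZ mulr0 oppr0 addr0 mulr0.
Qed.

(** The Bianchi identity for (X, phi X, xi) paired with X: all curvature terms
    vanish, by skew-symmetry or because they lie in Q or along xi, and of the
    torsion terms only X b g(X, X) survives. *)
Lemma tau_coefficient_L (b : C) (tb : forall Y, sQ Y -> tau Y = b *: phi Y) X :
  sL X -> X b = 0 :> C.
Proof.
move=> LX; have eX := sL_eta LX; have QY := sL_phi LX; set Y := phi X in QY.
have eY := sQ_eta QY; have YX : phi Y = - X by exact: sL_phiK.
have lieXY : lie X Y = nb X Y - nb Y X - torsion nb X Y by rewrite /torsion; vf_ring.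
have tauXY : g (tau (lie X Y)) X = b * g (phi (nb X Y)) X :> C.
  rewrite lieXY (T_LQ LX QY) -scaleNr -scaleN1r !tauD tauZ !gE.
  rewrite g_tau_reeb // (tb _ (nbQ X QY)) (QL_orth (tau_L (nbL Y LX)) LX) gZl //.
  by rewrite mulr0 !addr0.
have := bianchi_test X Y xi X.
have -> : g (curvature nb X Y xi) X = 0 :> C.
  rewrite /curvature (nb_xi_L LX) (nb_xi_Q QY) !(cn0r bn) nb_reeb !gE (g0l mg) g_xil eX.
  ring.
have -> : g (curvature nb Y xi X) X = 0 :> C.
  apply: cinf_dbl_inj; rewrite {1}(curvature_skew ob bl pphi _ _ eX eX); ring.
rewrite (QL_orth (curvature_Q ob bl xi X QY) LX).
have -> : torsion nb Y xi = b *: phi Y by rewrite -tb // torsionC (T_xi_Q QY) opprK.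
rewrite (T_xi_L LX) (cnNr bn) (gNl mg) (QL_orth (nbQ Y (tau_L LX)) LX).
rewrite (T_LQ LX QY) (g_nb_reeb_scale _ _ eX) g_torsion_reeb // tauXY.
rewrite torsion_L_test_L // torsion_Q_test_L // eta_lie_xi eX vf0.
rewrite (cnZr bn) pphi !gE YX !gE => E.
apply: cinf_eq => p; rewrite cinf0; have {}E := cinf_at E p.
have [g0|g0] := eqVneq (g X X p) 0.
  have X0 := g_definite mg g0; by rewrite -[LHS]/(at_point X p b) X0.
apply: (mulIf g0); rewrite !(cinfD, cinfN, cinfM, cinf0) in E; lra.
Qed.

End ReebTorsion.

(** * Comparison with the Levi-Civita connection *)

Section Curvature.
Context (n : nat) (L Q : tangent_distribution M)
  (ob : orthogonal_biLegendrian n eta g L Q).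
Local Notation sL := (section_of L).
Local Notation sQ := (section_of Q).
Context (nb : VF -> VF -> VF) (bl : biLegendrian_connection xi eta L Q nb).
(* Earlier results for the fixed pair (L, Q); below, ob' and bl' give access to
   those for (Q, L). *)
Let sL_eta := @sL_eta n L Q ob.
Let sQ_eta := @sQ_eta n L Q ob.
Let biLegendrian_decomposition := @biLegendrian_decomposition n L Q ob.
Let sL_phi := @sL_phi n L Q ob.
Let sL_phiK := @sL_phiK n L Q ob.
Context (pphi : parallel_endo nb phi) (ph : forall V W, nb V (h W) = h (nb V W)).
Let bn : connection nb := bl_connection bl.
Context (tau : VF -> VF) (tau_def : forall V, tau V = reeb_torsion nb V).
Let lie_xi_split := lie_xi_split tau_def.
Let nbL := @nbL L Q nb bl.
Let nb_metric V W Z : eta Z = 0 :> C ->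
  V (g W Z) = (g (nb V W) Z : C) + g W (nb V Z) :> C := nb_metric ob bl pphi V W (Z := Z).
Let ob' : orthogonal_biLegendrian n eta g Q L := orthogonal_biLegendrian_sym ob.
Let bl' : biLegendrian_connection xi eta Q L nb := biLegendrian_connection_sym bl.
Let T_LQ X Y (LX : sL X) (QY : sQ Y) := nb_torsion_LQ bl LX QY.
Let T_QL Y X (QY : sQ Y) (LX : sL X) := nb_torsion_LQ bl' QY LX.
Let T_LL X X' (LX : sL X) (LX' : sL X') := nb_torsion_LL ob bl pphi LX LX'.
Let T_QQ Y Y' (QY : sQ Y) (QY' : sQ Y') := nb_torsion_LL ob' bl' pphi QY QY'.

Section Coefficients.
Context (n0 : (0 < n)%N) (a b : C) (ta : forall X, sL X -> tau X = a *: phi X)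
  (tb : forall Y, sQ Y -> tau Y = b *: phi Y).

(** 2 h X = [xi, phi X] - phi [xi, X] = tau (phi X) - phi (tau X), as phi is
    parallel. *)
Lemma h_L X : sL X -> h X = (csm M 2^-1 * (a - b)) *: X.
Proof.
move=> LX; apply: vf_dbl_inj; rewrite -scalerDl -mulrDr cinf_half_add.
rewrite hE !lie_xi_split (tb (sL_phi LX)) (ta LX) pphi phiD phiZ (sL_phiK LX); vf_ring.
Qed.

(** a - b is twice the eigenvalue of the parallel operator h on L. *)
Lemma coefficient_sub_const V : V (a - b) = 0 :> C.
Proof.
set c := csm M 2^-1 * (a - b).
suff Vc : V c = 0 :> C.
  have -> : a - b = c + c by rewrite -mulrDr cinf_half_add.
  by rewrite vfD Vc addr0.
apply: cinf_eq => p; have [X LX Xp] := section_nonzero ob p n0.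
have := ph V X; rewrite (h_L LX) (h_L (nbL V LX)) -/c (cnZr bn) => /eqP.
rewrite -subr_eq0 addrK => /eqP /(congr1 (fun W => g W X : C)).
rewrite gZl // g0l // => /cinf_at /(_ p); rewrite cinfM cinf0 => /eqP.
by rewrite mulf_eq0 (negPf Xp) orbF => /eqP.
Qed.

(** Derivatives of b along L vanish by tau_coefficient_L, those of a along Q by the
    same lemma for (Q, L), and a - b is constant. In the direction of xi one uses
    the bracket of X and phi X, whose component along xi is 2 g(X, X). *)
Lemma coefficient_const V : V b = 0 :> C.
Proof.
have Lb X : sL X -> X b = 0 :> C by exact: (tau_coefficient_L ob bl pphi tau_def tb).
have Qb Y : sQ Y -> Y b = 0 :> C.
  move=> QY; have := coefficient_sub_const Y.
  rewrite vfD vfN (tau_coefficient_L ob' bl' pphi tau_def ta QY) sub0r.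
  by move=> /eqP; rewrite oppr_eq0 => /eqP.
suff xb : xi b = 0 :> C.
  have [A [B [LA QB ->]]] := biLegendrian_decomposition V.
  by rewrite !vf_addE vf_scaleE Lb // Qb // xb mulr0 !addr0.
apply: cinf_eq => p; have [X LX Xp] := section_nonzero ob p n0.
have QY := sL_phi LX; have eX := sL_eta LX; have eY := sQ_eta QY.
have [A [B [LA QB E]]] := biLegendrian_decomposition (lie X (phi X)).
have : lie X (phi X) b = 0 :> C by rewrite lieE (Lb _ LX) (Qb _ QY) !vf0 subr0.
rewrite E !vf_addE vf_scaleE Lb // Qb // !add0r.
rewrite (eta_lie_LQ eX eY) (sL_phiK LX) !gNr // => /cinf_at /(_ p).
rewrite !(cinfD, cinfN, cinfM, cinf0) => H; apply: (mulfI Xp); lra.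
Qed.
End Coefficients.

Lemma nb_torsion_D V W : eta V = 0 :> C -> eta W = 0 :> C ->
  exists f : C, torsion nb V W = f *: xi.
Proof.
move=> eV eW; have [A [B [LA QB ->]]] := biLegendrian_decomposition V.
have [A' [B' [LA' QB' ->]]] := biLegendrian_decomposition W.
rewrite eV eW !scale0r !addr0 !(torsionDl bn) !(torsionDr bn) (T_LL LA LA') (T_QQ QB QB').
rewrite (T_LQ LA QB') (T_QL QB LA') add0r addr0 -scalerDl.
by exists (g A (phi B') + g A (phi B') + (g B (phi A') + g B (phi A'))).
Qed.

(** The uniqueness argument for the Levi-Civita connection: the difference s of the
    two sides is skew in its last two arguments, and symmetric in the first two
    because both torsions are multiples of xi. *)
Lemma nabla_nb V W Z : eta V = 0 :> C -> eta W = 0 :> C -> eta Z = 0 :> C ->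
  g (nabla V W) Z = g (nb V W) Z :> C.
Proof.
pose s V W Z : C := (g (nabla V W) Z : C) - g (nb V W) Z.
have skew U U' U'' : eta U' = 0 :> C -> eta U'' = 0 :> C -> s U U' U'' = - s U U'' U'.
  move=> e' e''; have := lcM U U' U''; rewrite (nb_metric U U' e'').
  rewrite (gC mg U' (nb U U'')) (gC mg U' (nabla U U'')) /s => E.
  apply: cinf_eq => p; have {}E := cinf_at E p.
  by rewrite !(cinfD, cinfN) in E *; lra.
have sym U U' U'' : eta U = 0 :> C -> eta U' = 0 :> C -> eta U'' = 0 :> C ->
    s U U' U'' = s U' U U''.
  move=> e e' e''; have [f Tf] := nb_torsion_D e e'.
  have := congr1 (fun W => g W U'' : C) Tf; rewrite gZl // g_xil e'' mulr0 /torsion -lcC.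
  rewrite !gDl // !gNl // !gDl // !gNl // /s => E.
  apply: cinf_eq => p; have {}E := cinf_at E p.
  by rewrite !(cinfD, cinfN, cinf0) in E *; lra.
move=> eV eW eZ; apply/eqP; rewrite -subr_eq0; apply/eqP; rewrite -/(s V W Z).
apply: cinf_dbl_inj; rewrite addr0.
by rewrite {1}sym // skew // sym // skew // opprK sym // skew // addNr.
Qed.

(** By nabla_nb the derivatives of nabla xi = - phi (1 + h) may be computed with nb,
    for which phi and h are parallel. What remains is phi (1 + h) applied to the
    torsion T(V, W), a multiple of xi. *)
Lemma curvature_D_reeb V W : eta V = 0 :> C -> eta W = 0 :> C -> curvature nabla V W xi = 0.
Proof.
move=> eV eW.
have nxi U : nabla U xi = - phi (U + h U) by rewrite nabla_xi phiD; vf_ring.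
have eta_nn U U' : eta (nabla U (nabla U' xi)) = - g (nabla U' xi) (nabla U xi) :> C.
  have := lcM U (nabla U' xi) xi; rewrite !g_xi eta_nabla_xi vf0 => /eqP.
  by rewrite eq_sym addr_eq0 => /eqP.
have eR : eta (curvature nabla V W xi) = 0 :> C.
  rewrite /curvature !etaD !etaN eta_nabla_xi !eta_nn (gC mg); ring.
suff H Z : eta Z = 0 :> C -> g (curvature nabla V W xi) Z = 0 :> C.
  by apply: g_self_eq0; exact: H.
move=> eZ; rewrite /curvature !nxi !(cnNr cn) !gDl // !gNl //.
have ePhi U : eta (phi U) = 0 :> C by exact: eta_phi.
rewrite !nabla_nb // !pphi !(cnDr bn) !ph; have [f Tf] := nb_torsion_D eV eW.
have lieVW : lie V W = nb V W - nb W V - f *: xi by rewrite -Tf /torsion; vf_ring.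
have hl : h (lie V W) = h (nb V W) - h (nb W V).
  by rewrite lieVW !hD !hN hZ h_xi scaler0 subr0.
have pl : phi (lie V W) = phi (nb V W) - phi (nb W V).
  by rewrite lieVW !phiD !phiN phiZ phi_xi scaler0 subr0.
rewrite !phiD pl hl phiD phiN !gE; ring.
Qed.

Section ConstantCoefficients.
Context (al be : R) (ta : forall X, sL X -> tau X = csm M al *: phi X)
  (tb : forall Y, sQ Y -> tau Y = csm M be *: phi Y).
Let l := (al - be) / 2.

Lemma h_L_const X : sL X -> h X = csm M l *: X.
Proof.
move=> LX; rewrite (h_L ta tb LX); congr (_ *: _).
by apply: cinf_eq => p; rewrite /l !(cinfM, cinfD, cinfN, csmE) mulrC.
Qed.

(** In reeb_curvature the derivative of X along xi is [xi, X] + nabla_X xi, which is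
    known up to a section of L, and h has the constant eigenvalue l on L. *)
Lemma reeb_curvature_L X : sL X ->
  curvature nabla xi X xi = - (csm M (1 - l ^+ 2) *: X + csm M (2 - al - be) *: h X).
Proof.
move=> LX; rewrite (reeb_curvature X); have hX := h_L_const LX.
have nx : nabla xi X = csm M (al - 1 - l) *: phi X + nb xi X.
  have -> : nabla xi X = lie xi X + nabla X xi by rewrite -lcC; vf_ring.
  rewrite lie_xi_split (ta LX) nabla_xi hX phiZ.
  by apply: vfieldE => f; apply: cinf_eq => p;
    rewrite !(vf_addE, vf_oppE, vf_scaleE) !(cinfD, cinfN, cinfM, csmE); ring.
have hp : h (phi X) = - csm M l *: phi X by rewrite h_phi hX phiZ scaleNr.
rewrite hX hZ hX (cn_csm cn) nx hD hZ hp (h_L_const (nbL xi LX)).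
have -> : csm M l *: (csm M (al - 1 - l) *: phi X + nb xi X)
  - (csm M (al - 1 - l) *: (- csm M l *: phi X) + csm M l *: nb xi X)
  = (csm M l * csm M (al - 1 - l) + csm M l * csm M (al - 1 - l)) *: phi X by vf_ring.
rewrite phiZ (sL_phiK LX).
apply: vfieldE => f; apply: cinf_eq => p.
rewrite !(vf_addE, vf_oppE, vf_scaleE) !(cinfD, cinfN, cinfM, csmE) /l; by field.
Qed.
End ConstantCoefficients.

End Curvature.

(** * From a bi-Legendrian structure to the nullity condition *)

Section Scalars.
Context (n : nat) (L Q : tangent_distribution M)
  (ob : orthogonal_biLegendrian n eta g L Q).
Local Notation sL := (section_of L).
Local Notation sQ := (section_of Q).
Context (nb : VF -> VF -> VF) (bl : biLegendrian_connection xi eta L Q nb).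
(* Earlier results for the fixed pair (L, Q); below, ob' and bl' give access to
   those for (Q, L). *)
Let biLegendrian_decomposition := @biLegendrian_decomposition n L Q ob.
Context (pphi : parallel_endo nb phi) (ph : forall V W, nb V (h W) = h (nb V W)).
Context (tau : VF -> VF) (tau_def : forall V, tau V = reeb_torsion nb V).
Let ob' : orthogonal_biLegendrian n eta g Q L := orthogonal_biLegendrian_sym ob.
Let bl' : biLegendrian_connection xi eta Q L nb := biLegendrian_connection_sym bl.

(** So kappa = 1 - l ^ 2 and mu = 2 - al - be. Neither value nor the formula for
    R(xi, V) xi changes when L and Q are exchanged, so that reeb_curvature_L covers
    Q too; the rest is curvature_D_reeb and tensoriality. *)
Lemma kappa_mu_of_scalar (al be : R) (l := (al - be) / 2)
  (ta : forall X, sL X -> tau X = csm M al *: phi X)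
  (tb : forall Y, sQ Y -> tau Y = csm M be *: phi Y) V W :
  curvature nabla V W xi =
    csm M (1 - l ^+ 2) *: (eta W *: V - eta V *: W) +
    csm M (2 - al - be) *: (eta W *: h V - eta V *: h W).
Proof.
set kap := 1 - _; set mu := 2 - _ - _.
have RL X : sL X -> curvature nabla xi X xi = - (csm M kap *: X + csm M mu *: h X).
  exact: (reeb_curvature_L ob bl pphi tau_def ta tb).
have RQ Y : sQ Y -> curvature nabla xi Y xi = - (csm M kap *: Y + csm M mu *: h Y).
  move=> QY; rewrite (reeb_curvature_L ob' bl' pphi tau_def tb ta QY).
  have -> : ((be - al) / 2) ^+ 2 = l ^+ 2 by rewrite /l; field.
  by have -> : 2 - be - al = mu by rewrite /mu; ring.
have R0 U : curvature nabla 0 U xi = 0.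
  by have := curvatureZl cn 0 0 U xi; rewrite !scale0r.
have Rxx : curvature nabla xi xi xi = 0.
  by apply: vf_dbl_inj; rewrite {1}(curvatureC cn) addNr addr0.
have RD U : eta U = 0 :> C -> curvature nabla xi U xi = - (csm M kap *: U + csm M mu *: h U).
  move=> eU; have [A [B [LA QB ->]]] := biLegendrian_decomposition U.
  rewrite eU scale0r addr0 (curvatureC cn) (curvatureDl cn) !(curvatureC cn _ xi) RL // RQ //.
  rewrite hD; vf_ring.
have split U : exists2 U0, eta U0 = 0 :> C & U = U0 + eta U *: xi.
  exists (U - eta U *: xi); last by rewrite subrK.
  by rewrite etaD etaN etaZ eta_xi mulr1 subrr.
have [V0 eV0 VE] := split V; have [W0 eW0 WE] := split W.
have hV : h V = h V0 by rewrite VE hD hZ h_xi scaler0 addr0.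
have hW : h W = h W0 by rewrite WE hD hZ h_xi scaler0 addr0.
rewrite hV hW [in LHS]VE [in LHS]WE (curvatureDl cn) (curvatureZl cn).
rewrite !(curvatureC cn _ (_ + _)) !(curvatureDl cn) !(curvatureZl cn) Rxx.
rewrite (curvature_D_reeb ob bl pphi ph eW0 eV0).
rewrite (curvatureC cn W0) !RD //.
by move: VE WE; move: (eta V) (eta W) => v w -> ->; vf_ring.
Qed.

Lemma biLegendrian_scalars : (0 < n)%N -> connected [set: M] -> exists al be : R,
  [/\ forall X, sL X -> tau X = csm M al *: phi X,
      forall Y, sQ Y -> tau Y = csm M be *: phi Y,
      forall X, sL X -> h X = csm M ((al - be) / 2) *: X &
      forall Y, sQ Y -> h Y = csm M (- ((al - be) / 2)) *: Y].
Proof.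
move=> n0 cM; have [a ta] := tau_scalar ob bl pphi tau_def n0.
have [b tb] := tau_scalar ob' bl' pphi tau_def n0.
have cb := coefficient_const ob bl pphi ph tau_def n0 ta tb.
have ca := coefficient_const ob' bl' pphi ph tau_def n0 tb ta.
have [al aE] := constant_of_derive0 cM ca; have [be bE] := constant_of_derive0 cM cb.
rewrite {}aE in ta ca *; rewrite {}bE in tb cb *.
exists al, be; split=> // [X LX|Y QY].
  exact: (h_L_const ob pphi tau_def ta tb).
have -> : - ((al - be) / 2) = (be - al) / 2 by field.
exact: (h_L_const ob' pphi tau_def tb ta).
Qed.

End Scalars.

Section Structure.
Context (n : nat) (connected_M : connected [set: M]) (hn0 : exists V, h V <> 0).
Context (L Q : tangent_distribution M) (ob : orthogonal_biLegendrian n eta g L Q)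
  (nb : VF -> VF -> VF) (bl : biLegendrian_connection xi eta L Q nb)
  (pphi : parallel_endo nb phi) (ph : forall V W, nb V (h W) = h (nb V W)).

Lemma h_split_neq0 : (exists2 X, section_of L X & h X <> 0) \/
  (exists2 Y, section_of Q Y & h Y <> 0).
Proof.
have [V hV] := hn0; have [A [B [LA QB VE]]] := biLegendrian_decomposition ob V.
have [hA|hA] := pselect (h A = 0); last by left; exists A.
right; exists B => // hB; apply: hV.
by rewrite VE !linearD hA hB linearZ /= h_xi scaler0 !addr0.
Qed.

(** In rank 0 the tangent spaces are lines along xi, which h kills. *)
Lemma rank_gt0 : (0 < n)%N.
Proof.
rewrite lt0n; apply/negP => /eqP n0; have ob' := orthogonal_biLegendrian_sym ob.
case: h_split_neq0 => -[X sX]; apply.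
  by rewrite (subbundle0_section ob n0 sX) linear0.
by rewrite (subbundle0_section ob' n0 sX) linear0.
Qed.

Lemma structure_kappa_mu : exists kap mu : R, forall V W, curvature nabla V W xi =
  csm M kap *: (eta W *: V - eta V *: W) + csm M mu *: (eta W *: h V - eta V *: h W).
Proof.
have [al [be [ta tb _ _]]] := biLegendrian_scalars ob bl pphi ph
  (fun V => erefl (reeb_torsion nb V)) rank_gt0 connected_M.
eexists; eexists => V W.
exact: (kappa_mu_of_scalar ob bl pphi ph _ ta tb).
Qed.

(** kappa_mu_sum, applied to a section of L, gives l ^ 2 = 1 - kap for the eigenvalue l
    of h on L; the sign of l is the ambiguity in the conclusion. *)
Lemma structure_eigendist (kap mu : R) (km : forall V W, curvature nabla V W xi =
    csm M kap *: (eta W *: V - eta V *: W) + csm M mu *: (eta W *: h V - eta V *: h W))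
    (lam := Num.sqrt (1 - kap)) (eigd := eigendist (tensor_h phi xi)) :
  (L = eigd lam /\ Q = eigd (- lam)) \/ (L = eigd (- lam) /\ Q = eigd lam).
Proof.
have [al [be [_ _ hL hQ]]] := biLegendrian_scalars ob bl pphi ph
  (fun V => erefl (reeb_torsion nb V)) rank_gt0 connected_M.
set l := (al - be) / 2 in hL hQ.
have l0 : l != 0.
  apply/eqP => l0; rewrite l0 ?oppr0 in hL hQ.
  have z (X : VF) : csm M 0 *: X = 0.
    by apply: at_point_inj => p; rewrite at_pointZ csmE scale0r at_point0.
  by case: h_split_neq0 => -[X sX]; [rewrite hL // z | rewrite hQ // z].
have LE : L = eigd l by apply: (eigendist_of_scalar ob l0).
have QE : Q = eigd (- l).
  apply: (eigendist_of_scalar (orthogonal_biLegendrian_sym ob)) => //.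
    by rewrite oppr_eq0.
  by rewrite opprK.
have [V hV] := hn0; have k1 := kappa_lt1 km hV.
have l2 : l ^+ 2 = lam ^+ 2.
  have [p _] : exists p : M, True.
    apply: contrapT => H; apply: hV; apply: at_point_inj => p.
    by exfalso; apply: H; exists p.
  have [X LX Xp] := section_nonzero ob p rank_gt0.
  have := (kappa_mu_sum km X).1.
  rewrite (hL _ LX) linearZ /= (hL _ LX) (phi2_ker (sL_eta ob LX)).
  move=> /(congr1 (fun W => g W X : C)); rewrite !gZl // gNl // => /cinf_at /(_ p).
  rewrite !(cinfM, cinfN, csmE) /lam sqr_sqrtr ?subr_ge0 ?ltW // => E.
  by apply: (mulIf Xp); rewrite expr2 -mulrA E; ring.
have [ll|ll] : l = lam \/ l = - lam.
  by move/eqP: l2; rewrite eqf_sqr => /orP[] /eqP; [left|right].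
- by left; rewrite LE QE ll.
- by right; rewrite LE QE ll opprK.
Qed.
End Structure.

End ContactMetric.

Theorem theorem1p1 (R : realType) (n : nat) (M : manifold R n.*2.+1)
    (connected_M : connected [set: M])
    (phi : {linear vfield M -> vfield M}) (xi : vfield M)
    (eta : {linear vfield M -> (Cinf M)^o})
    (g : vfield M -> vfield M -> (Cinf M)^o)
    (nabla : vfield M -> vfield M -> vfield M)
    (contact_M : contact_metric phi xi eta g)
    (lc_nabla : levi_civita g nabla)
    (not_K_contact : ~ K_contact phi xi eta g) :
  let h := tensor_h phi xi in
  let characterizing (L Q : tangent_distribution M) :=
    orthogonal_biLegendrian n eta g L Q /\
    exists nablab : vfield M -> vfield M -> vfield M,
      [/\ biLegendrian_connection xi eta L Q nablab,
          parallel_endo nablab phi & parallel_endo nablab h] in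
  ((exists kappa mu : R, kappa_mu_space phi xi eta g nabla kappa mu) <->
   (exists L Q : tangent_distribution M, characterizing L Q)) /\
  (forall (kappa mu : R) (L Q : tangent_distribution M),
     kappa_mu_space phi xi eta g nabla kappa mu -> characterizing L Q ->
     let lambda := Num.sqrt (1 - kappa) in
     (L = eigendist h lambda /\ Q = eigendist h (- lambda)) \/
     (L = eigendist h (- lambda) /\ Q = eigendist h lambda)).
Proof.
move=> th characterizing; have [h hdef] := tensor_h_exists phi xi.
have hV := h0_of_not_K_contact contact_M hdef not_K_contact.
have kmE kap mu : kappa_mu_space phi xi eta g nabla kap mu -> forall V W,
    curvature nabla V W xi = csm M kap *: (eta W *: V - eta V *: W) +
      csm M mu *: (eta W *: h V - eta V *: h W).
  by case=> _ km V W; rewrite km !hdef.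
have phE nb : parallel_endo nb th <-> forall V W, nb V (h W) = h (nb V W).
  by split=> ph V W; have := ph V W; rewrite !hdef.
split; last first.
  move=> kap mu L Q /kmE km [ob [nb [bl pphi /phE ph]]].
  exact: (structure_eigendist contact_M lc_nabla hdef connected_M hV ob bl pphi ph km).
split=> [[kap [mu /kmE km]]|[L [Q [ob [nb [bl pphi /phE ph]]]]]].
  have [V hV0] := hV.
  have [L [Q [ob [nb [bl pphi /phE ph]]]]] :=
    kappa_mu_structure contact_M lc_nabla hdef km hV0 erefl.
  by exists L, Q; split=> //; exists nb.
have [kap [mu km]] :=
  structure_kappa_mu contact_M lc_nabla hdef connected_M hV ob bl pphi ph.
by exists kap, mu; split=> // V W; rewrite km !hdef.
Qed.
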